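(* Let $x\in\mathbb C$ be generic. Then for any $\vec\Lambda\in\mathbb C^n[2\mathfrak m]$ we have $$\Psi(\lambda,x;\vec\Lambda)=\mathcal F(\lambda,x;\vec\Lambda)\ \Xi_{\vec\Lambda},$$ i.e. $\Psi_{\vec m}^{\vec m'}(\lambda,x;\vec\Lambda)=\mathcal F_{\vec m}^{\vec m'}(\lambda,x;\vec\Lambda)\,\Xi^{\vec m'}_{\vec\Lambda}$ for all $\vec m,\vec m'\in\mathcal Z^n[\mathfrak m]$, where $\Xi^{\vec m}_{\vec\Lambda}=q^{\sum_{j=1}^nm_j\sum_{i=1}^{j-1}(\Lambda_i-m_i)}$ are the diagonal entries of the diagonal operator $\Xi_{\vec\Lambda}$ in the basis $\{v^{(\vec m)}_{\vec\Lambda}\}$.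
   Context: Fix $\eta\in\mathbb C$ with $\operatorname{Im}\eta>0$; $q^x=e^{\pi i\eta x}$, $[x]=\frac{q^x-q^{-x}}{q-q^{-1}}$, $[x]_k=[x][x+1]\cdots[x+k-1]$, $[k]!=[1]\cdots[k]$. Fix integers $\mathfrak m\ge0$, $n\ge1$. $\mathcal Z^n=(\mathbb Z_{\ge0})^n$, $\mathcal Z^n[\mathfrak m]=\{\vec m\in\mathcal Z^n:\sum m_i=\mathfrak m\}$, $\mathbb C^n[2\mathfrak m]=\{\vec\Lambda\in\mathbb C^n:\sum\Lambda_i=2\mathfrak m\}$. ''Generic'' means outside a countable union of zero loci of holomorphic functions that are not identically zero. $\mathcal U_q(\mathfrak{sl}_2)$ is the unital algebra generated by $\mathbf E,\mathbf F,q^{x\mathbf h}$ ($x\in\mathbb C$) with $q^{x\mathbf h}q^{y\mathbf h}=q^{(x+y)\mathbf h}$, $q^{x\mathbf h}\mathbf E=q^{2x}\mathbf Eq^{x\mathbf h}$, $q^{x\mathbf h}\mathbf F=q^{-2x}\mathbf Fq^{x\mathbf h}$, $\mathbf{EF}-\mathbf{FE}=\frac{q^{\mathbf h}-q^{-\mathbf h}}{q-q^{-1}}$, and comultiplication $\Delta\mathbf E=\mathbf E\otimes1+q^{\mathbf h}\otimes\mathbf E$, $\Delta\mathbf F=\mathbf F\otimes q^{-\mathbf h}+1\otimes\mathbf F$, $\Delta q^{x\mathbf h}=q^{x\mathbf h}\otimes q^{x\mathbf h}$. $M_\lambda$ is the Verma module with highest weight vector $v_\lambda$ of weight $\lambda$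 and basis $v_\lambda^{(k)}=\mathbf F^kv_\lambda/[k]!$, $k\ge0$. $M_\Lambda^\star$ has basis $\{u_m^\Lambda\}_{m\ge0}$ with $\mathbf Eu_m^\Lambda=[m]u_{m-1}^\Lambda$, $q^{x\mathbf h}u_m^\Lambda=q^{(\Lambda-2m)x}u_m^\Lambda$, $\mathbf Fu_m^\Lambda=[\Lambda-m]u_{m+1}^\Lambda$. Put $M_{\vec\Lambda}=M_{\Lambda_1}\otimes\dots\otimes M_{\Lambda_n}$, $v_{\vec\Lambda}^{(\vec m)}=v_{\Lambda_1}^{(m_1)}\otimes\dots\otimes v_{\Lambda_n}^{(m_n)}$, $u_{\vec m}^{\vec\Lambda}=u_{m_1}^{\Lambda_1}\otimes\dots\otimes u_{m_n}^{\Lambda_n}$. Universal trace matrix $\mathcal F=\{\mathcal F_{\vec m}^{\vec m'}\}_{\vec m,\vec m'\in\mathcal Z^n[\mathfrak m]}$ ($\vec m$ labels rows, $\vec m'$ columns): $\Phi_m^\Lambda(\lambda):M_{\lambda-1}\to M_{\lambda-\Lambda+2m-1}\otimes M_\Lambda^\star$ is the module map determined by $\Phi_m^\Lambda(\lambda)v_{\lambda-1}=\sum_{i=0}^mq^{i(\lambda-\Lambda+2m-i)}[-\lambda+\Lambda-2m+i+1]_{m-i}\,v^{(i)}_{\lambda-\Lambda+2m-1}\otimes\mathbf E^iu_m^\Lambda$; $\Phi_{\vec m}^{\vec\Lambda}(\lambda)=\big(\Phi_{m_1}^{\Lambda_1}(\lambda-\sum_{i=2}^n(\Lambda_i-2m_i))\otimes1^{n-1}\big)\cdots\big(\Phi_{m_{n-1}}^{\Lambda_{n-1}}(\lambda-\Lambda_n+2m_n)\otimes1\big)\Phi_{m_n}^{\Lambda_n}(\lambda)$;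 and $$q^{-\mathfrak m(\mathfrak m+1)/2}(q-q^{-1})^{\mathfrak m}(q^x-q^{-x})\operatorname{Tr}\big|_{M_{\lambda-1}}\big(\Phi_{\vec m}^{\vec\Lambda}(\lambda)q^{x\mathbf h}\big)=\sum_{\vec m'\in\mathcal Z^n[\mathfrak m]}\mathcal F_{\vec m}^{\vec m'}(\lambda,x;\vec\Lambda)\,u_{\vec m'}^{\vec\Lambda},$$ the trace being convergent for $|q^{2x}|\gg1$ and continued meromorphically in $x$. Resonance relations: a holomorphic function $\varphi(\lambda)=\sum_{\vec m\in\mathcal Z^n[\mathfrak m]}\varphi_{\vec m}(\lambda)v^{(\vec m)}$ satisfies the $n$-point resonance relations with respect to $\vec\Lambda\in\mathbb C^n[2\mathfrak m]$ if for all $\vec m\in\mathcal Z^n[\mathfrak m]$: (1) for $j=1,\dots,n-1$, $\delta\in\{1,\dots,m_j\}$: $\varphi_{\vec m}\big(-\delta+\sum_{i=j+1}^n(\Lambda_i-2m_i)\big)=\varphi_{\tau_j^\delta(\vec m)}\big(-\delta+\sum_{i=j+1}^n(\Lambda_i-2m_i)\big)$, where $\tau_j^\delta(\vec m)=(m_1,\dots,m_{j-1},m_j-\delta,m_{j+1}+\delta,m_{j+2},\dots,m_n)$; (2) for $\delta\in\{1,\dots,m_n\}$: $\varphi_{\vec m}(-\delta)=\varphi_{\tau_n^\delta(\vec m)}(\delta)$, where $\tau_n^\delta(\vec m)=(m_1+\delta,m_2,\dots,m_{n-1},m_n-\delta)$ (and $\tau_1^\delta(\vec m)=\vec m$ if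 $n=1$). Fundamental resonance matrix $\Psi=\{\Psi_{\vec m}^{\vec m'}\}$: for generic $x$ and $\vec\Lambda\in\mathbb C^n[2\mathfrak m]$, $\Psi^{\vec m'}(\lambda,x;\vec\Lambda)=\sum_{\vec m}\Psi_{\vec m}^{\vec m'}(\lambda,x;\vec\Lambda)v^{(\vec m)}$ is the unique function of the form $q^{\lambda(x-\mathfrak m)}\sum_{k=0}^{\mathfrak m}q^{2k\lambda}\psi^{(k)}$ with $\psi^{(0)}=v^{(\vec m')}$ that satisfies the $n$-point resonance relations with respect to $\vec\Lambda$; it depends meromorphically on $x,\vec\Lambda$ and is extended to all $\vec\Lambda\in\mathbb C^n[2\mathfrak m]$ by meromorphic continuation. *)

(* Defs.v *)
From HB Require Import structures.
From mathcomp Require Import all_boot all_order all_algebra ring.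
From mathcomp Require Import freeg complex.
From mathcomp Require Import all_classical all_reals all_analysis.

Set Implicit Arguments.
Unset Strict Implicit.
Unset Printing Implicit Defensive.

Import Order.TTheory GRing.Theory Num.Theory.
Import numFieldNormedType.Exports.

Local Open Scope classical_set_scope.
Local Open Scope ring_scope.
Local Open Scope complex_scope.

Section FreeModuleLinear.
Variables (R : nzRingType) (I : choiceType) (V : lmodType R).

Lemma fglift_is_linear (f : I -> V) : linear (fglift f : {freeg I / R} -> V).
Proof.
move=> c D1 D2.
have addf (A B : {freeg I / R}) : fglift f (A + B) = fglift f A + fglift f B.
  have L := lift_is_additive f; have L0 : fglift f 0 = 0.
    by rewrite -(subrr 0) L subrr.
  have LN (C : {freeg I / R}) : fglift f (- C) = - fglift f C.
    by rewrite -[- C]add0r L L0 add0r.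
  by rewrite -{1}[B]opprK L LN opprK.
rewrite addf; congr (_ + _).
rewrite -{2}[D1]freeg_sumE {1}/GRing.scale /= /fgscale.
have sumf (r : seq I) (g : I -> {freeg I / R}) :
    fglift f (\sum_(x <- r) g x) = \sum_(x <- r) fglift f (g x).
  elim: r => [|x r IHr]; last by rewrite !big_cons addf IHr.
  by rewrite !big_nil -(subrr 0) (lift_is_additive f) subrr.
rewrite !sumf scaler_sumr; apply: eq_bigr => i _.
by rewrite !liftU scalerA.
Qed.

HB.instance Definition _ (f : I -> V) :=
  GRing.isLinear.Build R {freeg I / R} V _ (fglift f) (fglift_is_linear f).

Lemma fgliftB (f : I -> V) i : fglift f << i >> = f i.
Proof. by rewrite liftU scale1r. Qed.

Lemma eq_lin_freeg (f g : {linear {freeg I / R} -> V}) :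
  (forall i, f << i >> = g << i >>) -> f =1 g.
Proof.
move=> fg D; rewrite -[D]freeg_sumE !linear_sum; apply: eq_bigr => i _.
have -> : << coeff i D *g i >> = coeff i D *: << i >> :> {freeg I / R}.
  apply/eqP/freeg_eqP => x; rewrite /= coeffZ !coeffU.
  by rewrite mul1r.
by rewrite !linearZ /= fg.
Qed.

End FreeModuleLinear.

Section Tensor.
Variable R : comNzRingType.

(* {freeg I / R} (x) {freeg J / R} is realised as {freeg (I * J) / R}, with
   << i >> (x) << j >> = << (i, j) >> *)
Definition tens (I J : choiceType) (a : {freeg I / R}) (b : {freeg J / R}) :
    {freeg (I * J) / R} :=
  fglift (fun i => fglift (fun j => << (i, j) >> : {freeg (I * J) / R}) b) a.

Variables (I J : choiceType).
Implicit Types (a : {freeg I / R}) (b : {freeg J / R}).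

Definition tensl b : {linear {freeg I / R} -> {freeg (I * J) / R}} :=
  fglift (fun i => fglift (fun j => << (i, j) >> : {freeg (I * J) / R}) b).

Lemma tenslE a b : tens a b = tensl b a.
Proof. by []. Qed.

Lemma tens_linr a : linear (@tens I J a).
Proof.
move=> c b1 b2.
rewrite -[a]freeg_sumE !tenslE !linear_sum.
rewrite -big_split; apply: eq_bigr => i _ /=.
rewrite /tensl !liftU linearP scalerDr; congr (_ + _).
by rewrite !scalerA mulrC.
Qed.

HB.instance Definition _ a :=
  GRing.isLinear.Build R {freeg J / R} {freeg (I * J) / R} _
    (@tens I J a) (tens_linr a).

Lemma tensB i j : tens << i >> << j >> = << (i, j) >> :> {freeg (I * J) / R}.
Proof. by rewrite /tens !fgliftB. Qed.

End Tensor.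

Definition tens_map (R : comNzRingType) (I J I' J' : choiceType)
    (f : {linear {freeg I / R} -> {freeg I' / R}})
    (g : {linear {freeg J / R} -> {freeg J' / R}}) :
    {linear {freeg (I * J) / R} -> {freeg (I' * J') / R}} :=
  fglift (fun p => tens (f << p.1 >>) (g << p.2 >>)).

Lemma tens_mapE (R : comNzRingType) (I J I' J' : choiceType)
    (f : {linear {freeg I / R} -> {freeg I' / R}})
    (g : {linear {freeg J / R} -> {freeg J' / R}}) a b :
  tens_map f g (tens a b) = tens (f a) (g b).
Proof.
rewrite /tens_map /=.
move: a; apply: (eq_lin_freeg
  (f := (fglift (fun p => tens (f << p.1 >>) (g << p.2 >>)) \o
         tensl I b))
  (g := (tensl _ (g b) \o f))) => i /=.
move: b; apply: (eq_lin_freeg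
  (f := (fglift (fun p => tens (f << p.1 >>) (g << p.2 >>)) \o
         (tens << i >>)))
  (g := (tens (f << i >>) \o g))) => j /=.
by rewrite tensB fgliftB.
Qed.

Section QNumbers.
Variable R : realType.
Implicit Types (z x y : R[i]).

Definition cexp z : R[i] :=
  (expR (complex.Re z))%:C * (cos (complex.Im z) +i* sin (complex.Im z)).

Lemma cexpD x y : cexp (x + y) = cexp x * cexp y.
Proof.
case: x => a b; case: y => c d; rewrite /cexp /= expRD cosD sinD.
by apply/eqP; rewrite eq_complex /=; apply/andP; split; apply/eqP; ring.
Qed.

Lemma cexp0 : cexp 0 = 1.
Proof. by rewrite /cexp /= expR0 cos0 sin0 mul1r. Qed.

Variable eta : R[i].

Definition qpow x : R[i] := cexp (pi%:C * 'i%C * eta * x).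

Definition qnum x : R[i] := (qpow x - qpow (- x)) / (qpow 1 - qpow (- 1)).

Definition qpoch x (k : nat) : R[i] := \prod_(i < k) qnum (x + i%:R).

Definition qfact (k : nat) : R[i] := \prod_(1 <= i < k.+1) qnum i%:R.

Lemma qpowD x y : qpow (x + y) = qpow x * qpow y.
Proof. by rewrite /qpow mulrDr cexpD. Qed.

Lemma qpow0 : qpow 0 = 1.
Proof. by rewrite /qpow mulr0 cexp0. Qed.

Lemma qpowK x : qpow x * qpow (- x) = 1.
Proof. by rewrite -qpowD subrr qpow0. Qed.

Lemma qnum0 : qnum 0 = 0.
Proof. by rewrite /qnum oppr0 subrr mul0r. Qed.

Lemma qnum_comm x y :
  qnum (x + 1) * qnum (y - x) - qnum x * qnum (y - x + 1) = qnum (y - x - x).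
Proof.
rewrite /qnum; have [->|d0] := eqVneq (qpow 1 - qpow (- 1)) 0.
  by rewrite invr0 !mulr0 subrr.
rewrite !opprD !opprK !qpowD; field.
exact: d0.
Qed.

End QNumbers.

Section QuantumGroup.
Variables (R : realType) (eta : R[i]).
Local Notation C := R[i].
Local Notation qpow := (qpow eta).
Local Notation qnum := (qnum eta).

(* A U_q(sl_2)-module structure on the vector space with basis I; uK x is the
   action of q^{x h}. *)
Record uq_module (I : choiceType) := UqModule {
  uE : {linear {freeg I / C} -> {freeg I / C}};
  uF : {linear {freeg I / C} -> {freeg I / C}};
  uK : C -> {linear {freeg I / C} -> {freeg I / C}};
  uKK : forall x y a, uK x (uK y a) = uK (x + y) a;
  uKE : forall x a, uK x (uE a) = qpow (x *+ 2) *: uE (uK x a);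
  uKF : forall x a, uK x (uF a) = qpow (- (x *+ 2)) *: uF (uK x a);
  uEF : forall a, uE (uF a) - uF (uE a) =
          (qpow 1 - qpow (- 1))^-1 *: (uK 1 a - uK (- 1) a) }.

Definition uq_hom (I J : choiceType) (M : uq_module I) (N : uq_module J)
    (f : {linear {freeg I / C} -> {freeg J / C}}) : Prop :=
  [/\ forall a, f (uE M a) = uE N (f a),
      forall a, f (uF M a) = uF N (f a) &
      forall x a, f (uK M x a) = uK N x (f a)].

Section Verma.
Variable lam : C.

(* << k >> is the basis vector v_lam^(k) = F^k v_lam / [k]! *)
Definition verma_E : {linear {freeg nat / C} -> {freeg nat / C}} :=
  fglift (fun k : nat =>
    if k is k'.+1 then qnum (lam - k'%:R) *: << k' >> else 0).
Definition verma_F : {linear {freeg nat / C} -> {freeg nat / C}} :=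
  fglift (fun k : nat => qnum k.+1%:R *: << k.+1 >>).
Definition verma_K (x : C) : {linear {freeg nat / C} -> {freeg nat / C}} :=
  fglift (fun k : nat => qpow (x * (lam - (k.*2)%:R)) *: << k >>).

Fact verma_KK x y a : verma_K x (verma_K y a) = verma_K (x + y) a.
Proof.
apply: (eq_lin_freeg (f := (verma_K x \o verma_K y)) (g := verma_K (x + y))).
move=> k /=; rewrite !fgliftB linearZ /= fgliftB scalerA -qpowD.
by rewrite addrC -mulrDl.
Qed.

Fact verma_KE x a : verma_K x (verma_E a) =
  qpow (x *+ 2) *: verma_E (verma_K x a).
Proof.
apply: (eq_lin_freeg (f := (verma_K x \o verma_E))
  (g := (qpow (x *+ 2) \*: (verma_E \o verma_K x)))).
case=> [|k] /=; rewrite !fgliftB !linearZ /= !fgliftB ?linear0 ?scaler0 //.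
rewrite !scalerA -qpowD mulrC; congr (qpow _ * _ *: _).
by rewrite -!mul2n !natrM mulrSr; ring.
Qed.

Fact verma_KF x a : verma_K x (verma_F a) =
  qpow (- (x *+ 2)) *: verma_F (verma_K x a).
Proof.
apply: (eq_lin_freeg (f := (verma_K x \o verma_F))
  (g := (qpow (- (x *+ 2)) \*: (verma_F \o verma_K x)))).
move=> k /=; rewrite !fgliftB !linearZ /= !fgliftB.
rewrite !scalerA -qpowD mulrC; congr (qpow _ * _ *: _).
by rewrite -!mul2n !natrM mulrSr; ring.
Qed.

Fact verma_EF a : verma_E (verma_F a) - verma_F (verma_E a) =
  (qpow 1 - qpow (- 1))^-1 *: (verma_K 1 a - verma_K (- 1) a).
Proof.
apply: (eq_lin_freeg (f := ((verma_E \o verma_F) \- (verma_F \o verma_E)))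
  (g := ((qpow 1 - qpow (- 1))^-1 \*: (verma_K 1 \- verma_K (- 1))))).
move=> k /=; rewrite !fgliftB !linearZ /= !fgliftB scalerN -scalerBl !scalerA.
have -> : (qpow 1 - qpow (- 1))^-1 *
    (qpow (1 * (lam - k.*2%:R)) - qpow (-1 * (lam - k.*2%:R))) =
    qnum (lam - k%:R - k%:R).
  by rewrite mulrC mul1r mulN1r -addnn natrD opprD addrA.
rewrite -(qnum_comm eta k%:R lam) scalerBl natr1; congr (_ - _).
case: k => [|k]; first by rewrite linear0 qnum0 ?mul0r ?mulr0 scale0r.
rewrite linearZ /= fgliftB scalerA mulrC; congr (_ * qnum _ *: _).
by rewrite mulrSr; ring.
Qed.

Definition verma : uq_module nat :=
  UqModule verma_KK verma_KE verma_KF verma_EF.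

Lemma verma_basis k :
  qfact eta k *: << k >> = iter k (uF verma) << 0%N >> :> {freeg nat / C}.
Proof.
elim: k => [|k IHk] /=; first by rewrite /qfact big_geq // scale1r.
by rewrite -IHk linearZ /= fgliftB /qfact big_nat_recr //= scalerA.
Qed.

End Verma.

Section VermaStar.
Variable Lam : C.

(* << m >> is the basis vector u_m^Lam of M_Lam^star *)
Definition star_E : {linear {freeg nat / C} -> {freeg nat / C}} :=
  fglift (fun m : nat => if m is m'.+1 then qnum m%:R *: << m' >> else 0).
Definition star_F : {linear {freeg nat / C} -> {freeg nat / C}} :=
  fglift (fun m : nat => qnum (Lam - m%:R) *: << m.+1 >>).
Definition star_K (x : C) : {linear {freeg nat / C} -> {freeg nat / C}} :=
  fglift (fun m : nat => qpow ((Lam - (m.*2)%:R) * x) *: << m >>).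

Fact star_KK x y a : star_K x (star_K y a) = star_K (x + y) a.
Proof.
apply: (eq_lin_freeg (f := (star_K x \o star_K y)) (g := star_K (x + y))).
move=> k /=; rewrite !fgliftB linearZ /= fgliftB scalerA -qpowD.
by rewrite addrC -mulrDr.
Qed.

Fact star_KE x a : star_K x (star_E a) =
  qpow (x *+ 2) *: star_E (star_K x a).
Proof.
apply: (eq_lin_freeg (f := (star_K x \o star_E))
  (g := (qpow (x *+ 2) \*: (star_E \o star_K x)))).
case=> [|k] /=; rewrite !fgliftB !linearZ /= !fgliftB ?linear0 ?scaler0 //.
rewrite !scalerA -qpowD mulrC; congr (qpow _ * _ *: _).
by rewrite -!mul2n !natrM mulrSr; ring.
Qed.

Fact star_KF x a : star_K x (star_F a) =
  qpow (- (x *+ 2)) *: star_F (star_K x a).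
Proof.
apply: (eq_lin_freeg (f := (star_K x \o star_F))
  (g := (qpow (- (x *+ 2)) \*: (star_F \o star_K x)))).
move=> k /=; rewrite !fgliftB !linearZ /= !fgliftB.
rewrite !scalerA -qpowD mulrC; congr (qpow _ * _ *: _).
by rewrite -!mul2n !natrM mulrSr; ring.
Qed.

Fact star_EF a : star_E (star_F a) - star_F (star_E a) =
  (qpow 1 - qpow (- 1))^-1 *: (star_K 1 a - star_K (- 1) a).
Proof.
apply: (eq_lin_freeg (f := ((star_E \o star_F) \- (star_F \o star_E)))
  (g := ((qpow 1 - qpow (- 1))^-1 \*: (star_K 1 \- star_K (- 1))))).
move=> k /=; rewrite !fgliftB !linearZ /= !fgliftB scalerN -scalerBl !scalerA.
have -> : (qpow 1 - qpow (- 1))^-1 *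
    (qpow ((Lam - k.*2%:R) * 1) - qpow ((Lam - k.*2%:R) * -1)) =
    qnum (Lam - k%:R - k%:R).
  by rewrite mulrC mulr1 mulrN1 -addnn natrD opprD addrA.
rewrite -(qnum_comm eta k%:R Lam) scalerBl natr1.
rewrite [_ * qnum k.+1%:R]mulrC; congr (_ - _).
case: k => [|k]; first by rewrite linear0 qnum0 ?mul0r ?mulr0 scale0r.
rewrite linearZ /= fgliftB scalerA; congr (_ * qnum _ *: _).
by rewrite mulrSr; ring.
Qed.

Definition verma_star : uq_module nat :=
  UqModule star_KK star_KE star_KF star_EF.

End VermaStar.

Section TensorModule.
Variables (I J : choiceType) (M : uq_module I) (N : uq_module J).
Local Notation W := {freeg (I * J) / C}.

(* the comultiplication Delta E = E (x) 1 + q^h (x) E,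
   Delta F = F (x) q^{-h} + 1 (x) F *)
Definition tensor_E : {linear W -> W} :=
  tens_map (uE M) idfun \+ tens_map (uK M 1) (uE N).
Definition tensor_F : {linear W -> W} :=
  tens_map (uF M) (uK N (- 1)) \+ tens_map idfun (uF N).
Definition tensor_K (x : C) : {linear W -> W} :=
  tens_map (uK M x) (uK N x).

Lemma eq_lin_tens (V : lmodType C) (f g : {linear W -> V}) :
  (forall a b, f (tens a b) = g (tens a b)) -> f =1 g.
Proof. by move=> fg; apply: eq_lin_freeg => -[i j]; rewrite -tensB. Qed.

Fact tensor_KK x y a : tensor_K x (tensor_K y a) = tensor_K (x + y) a.
Proof.
apply: (eq_lin_tens (f := (tensor_K x \o tensor_K y)) (g := tensor_K (x + y))).
by move=> {}a b; rewrite /= !tens_mapE !uKK.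
Qed.

Lemma tensor_EE a b : tensor_E (tens a b) =
  tens (uE M a) b + tens (uK M 1 a) (uE N b).
Proof. exact: (congr2 +%R (tens_mapE _ idfun a b) (tens_mapE _ _ a b)). Qed.

Lemma tensor_FE a b : tensor_F (tens a b) =
  tens (uF M a) (uK N (- 1) b) + tens a (uF N b).
Proof. exact: (congr2 +%R (tens_mapE _ _ a b) (tens_mapE idfun _ a b)). Qed.

Lemma tensor_KT x a b : tensor_K x (tens a b) = tens (uK M x a) (uK N x b).
Proof. exact: tens_mapE. Qed.

Lemma tensZl c (a : {freeg I / C}) (b : {freeg J / C}) :
  tens (c *: a) b = c *: tens a b.
Proof. by rewrite !tenslE linearZ. Qed.

Lemma tensZr c (a : {freeg I / C}) (b : {freeg J / C}) :
  tens a (c *: b) = c *: tens a b.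
Proof. by rewrite linearZ. Qed.

Fact tensor_KE x a : tensor_K x (tensor_E a) =
  qpow (x *+ 2) *: tensor_E (tensor_K x a).
Proof.
apply: (eq_lin_tens (f := (tensor_K x \o tensor_E))
  (g := (qpow (x *+ 2) \*: (tensor_E \o tensor_K x)))) => {}a b.
suff: tensor_K x (tensor_E (tens a b)) =
  qpow (x *+ 2) *: tensor_E (tensor_K x (tens a b)) by [].
rewrite tensor_KT !tensor_EE linearD !tensor_KT !uKE !uKK.
by rewrite tensZl tensZr -scalerDr [1 + x]addrC.
Qed.

Fact tensor_KF x a : tensor_K x (tensor_F a) =
  qpow (- (x *+ 2)) *: tensor_F (tensor_K x a).
Proof.
apply: (eq_lin_tens (f := (tensor_K x \o tensor_F))
  (g := (qpow (- (x *+ 2)) \*: (tensor_F \o tensor_K x)))) => {}a b.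
suff: tensor_K x (tensor_F (tens a b)) =
  qpow (- (x *+ 2)) *: tensor_F (tensor_K x (tens a b)) by [].
rewrite tensor_KT !tensor_FE linearD !tensor_KT !uKF !uKK.
by rewrite tensZl tensZr -scalerDr [- 1 + x]addrC.
Qed.

Fact tensor_EF a : tensor_E (tensor_F a) - tensor_F (tensor_E a) =
  (qpow 1 - qpow (- 1))^-1 *: (tensor_K 1 a - tensor_K (- 1) a).
Proof.
apply: (eq_lin_tens
  (f := ((tensor_E \o tensor_F) \- (tensor_F \o tensor_E)))
  (g := ((qpow 1 - qpow (- 1))^-1 \*: (tensor_K 1 \- tensor_K (- 1)))))
  => {}a b.
suff: tensor_E (tensor_F (tens a b)) - tensor_F (tensor_E (tens a b)) =
  (qpow 1 - qpow (- 1))^-1 *: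
    (tensor_K 1 (tens a b) - tensor_K (- 1) (tens a b)) by [].
rewrite tensor_FE tensor_EE.
have -> u v : tensor_E (u + v) = tensor_E u + tensor_E v by exact: linearD.
have -> u v : tensor_F (u + v) = tensor_F u + tensor_F v by exact: linearD.
rewrite !tensor_EE !tensor_FE !tensor_KT.
have EFM := uEF M a; have EFN := uEF N b.
have -> : tens (uK M 1 (uF M a)) (uE N (uK N (- 1) b)) =
    tens (uF M (uK M 1 a)) (uK N (- 1) (uE N b)).
  by rewrite uKF uKE tensZl tensZr mulNrn.
have -> : uE M (uF M a) = uF M (uE M a) +
    (qpow 1 - qpow (- 1))^-1 *: (uK M 1 a - uK M (- 1) a).
  by rewrite -EFM addrC subrK.
have -> : uE N (uF N b) = uF N (uE N b) +
    (qpow 1 - qpow (- 1))^-1 *: (uK N 1 b - uK N (- 1) b).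
  by rewrite -EFN addrC subrK.
set e := (_ - _)^-1.
have tDl u v (w : {freeg J / C}) : tens (u + v) w = tens u w + tens v w.
  by rewrite !tenslE linearD.
have tDr (w : {freeg I / C}) u v : tens w (u + v) = tens w u + tens w v.
  exact: linearD.
rewrite !(tDl, tDr) !tensZl !tensZr !tDl !tDr !scalerDr.
have tNl u (w : {freeg J / C}) : tens (- u) w = - tens u w.
  by rewrite !tenslE linearN.
have tNr (w : {freeg I / C}) u : tens w (- u) = - tens w u.
  exact: linearN.
rewrite tNl tNr !scalerN; apply/eqP/freeg_eqP => i /=.
by rewrite !(coeffD, coeffN); ring.
Qed.

Definition tensor : uq_module (I * J)%type :=
  UqModule tensor_KK tensor_KE tensor_KF tensor_EF.

End TensorModule.

Section UniversalTrace.

Definition is_vertex_operator (lam Lam : C) (m : nat)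
    (f : {linear {freeg nat / C} -> {freeg (nat * nat) / C}}) : Prop :=
  let w := lam - Lam + m.*2%:R in
  uq_hom (verma (lam - 1)) (tensor (verma (w - 1)) (verma_star Lam)) f /\
  f << 0%N >> = \sum_(i < m.+1)
    (qpow (i%:R * (w - i%:R)) *
     qpoch eta (- lam + Lam - m.*2%:R + i%:R + 1) (m - i)) *:
    tens << val i >> (iter i (uE (verma_star Lam)) << m >>).

Variable Phi :
  C -> C -> nat -> {linear {freeg nat / C} -> {freeg (nat * nat) / C}}.

(* For s = [:: (Lam_1, m_1); ...; (Lam_n, m_n)], the operator
     (Phi_{m_1}^{Lam_1}(lam - \sum_{i > 1} (Lam_i - 2 m_i)) (x) 1^{n-1}) ...
       (Phi_{m_{n-1}}^{Lam_{n-1}}(lam - Lam_n + 2 m_n) (x) 1)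
       Phi_{m_n}^{Lam_n}(lam);
   the vector v^(k) (x) u_{s_1} (x) ... (x) u_{s_j} is encoded as << (k, s) >>.*)
Fixpoint vertex_product (lam : C) (s : seq (C * nat)) :
    {linear {freeg nat / C} -> {freeg (nat * seq nat) / C}} :=
  if s is p :: s' then
    let lam' := lam - \sum_(p' <- s') (p'.1 - p'.2.*2%:R) in
    let step (kt : nat * seq nat) : {freeg (nat * seq nat) / C} :=
      fglift (fun ka : nat * nat =>
          << (ka.1, ka.2 :: kt.2) >> : {freeg (nat * seq nat) / C})
        (Phi lam' p.1 p.2 << kt.1 >>) in
    fglift step \o vertex_product lam s'
  else fglift (fun k => << (k, [::]) >>).

Variables (n M : nat).

(* Z^n[M] *)
Definition compositions : pred (n.-tuple nat) := fun m => sumn m == M.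

(* C^n[2M] *)
Definition weights : set 'rV[C]_n :=
  [set Lam | \sum_(i < n) Lam 0 i = M.*2%:R].

(* N-th partial sum of the u_{m'}-component of
   Tr|_{M_{lam-1}} (Phi_m^Lam(lam) q^{x h}) *)
Definition trace_psum (lam x : C) (Lam : 'rV[C]_n) (m m' : n.-tuple nat)
    (N : nat) : C :=
  \sum_(k < N) coeff (val k, val m')
    (vertex_product lam [seq (Lam 0 i, tnth m i) | i <- enum 'I_n]
       (uK (verma (lam - 1)) x << val k >>)).

End UniversalTrace.
End QuantumGroup.

Section Meromorphy.
Variables (R : realType) (V : normedModType R[i]).

Definition entire (f : V -> R[i]^o) : Prop := forall z, differentiable f z.

Definition holomorphic_at (f : V -> R[i]^o) (p : V) : Prop :=
  \forall z \near p, differentiable f z.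

(* Below S is an affine subspace of V. As S is a holomorphic retract of V, the
   (germs of) holomorphic functions on S are the restrictions to S of (germs
   of) holomorphic functions on V. *)
Variable S : set V.

Definition generic (P : V -> Prop) : Prop :=
  exists h : nat -> V -> R[i]^o,
    (forall k, entire (h k) /\ exists2 z, S z & h k z != 0) /\
    (forall z, S z -> (forall k, h k z != 0) -> P z).

Definition nonzero_germ (h : V -> R[i]^o) (p : V) : Prop :=
  holomorphic_at h p /\ ~ (\forall z \near p, S z -> h z = 0).

(* f is meromorphic on S. Being a total function, f has an arbitrary value at a
   point of indeterminacy or at a pole; the second clause says that at any
   other point its value is that of its meromorphic continuation. *)
Definition meromorphic (f : V -> R[i]^o) : Prop :=
  forall p, S p ->
    (exists g h, [/\ holomorphic_at g p, nonzero_germ h p &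
       \forall z \near p, S z -> h z != 0 -> f z = g z / h z]) /\
    (forall g h, holomorphic_at g p -> nonzero_germ h p ->
       (\forall z \near p, S z -> h z != 0 -> f z = g z) -> f p = g p).

End Meromorphy.

Section TraceAndResonance.
Variables (R : realType) (eta : R[i]) (n M : nat).
Local Notation C := R[i].
Local Notation qpow := (qpow eta).
Implicit Types (lam x : C) (Lam : 'rV[C]_n) (m : n.-tuple nat).

(* F lam x Lam m m' is the entry of row m and column m'. The trace has weight 0,
   so its u_{m'}-components with m' not in compositions M vanish. *)
Definition is_universal_trace_matrix
    (Phi : C -> C -> nat -> {linear {freeg nat / C} -> {freeg (nat * nat) / C}})
    (F : C -> C -> 'rV[C]_n -> n.-tuple nat -> n.-tuple nat -> C) : Prop :=
  forall lam Lam m m', weights M Lam -> compositions M m -> compositions M m' ->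
    meromorphic [set: C^o] (fun x : C^o => F lam x Lam m m' : C^o) /\
    exists rho : R, forall x, rho%:C < `|qpow (x *+ 2)| ->
      exists2 T : C^o,
        (trace_psum eta Phi lam x Lam m m' : nat -> C^o) @ \oo --> T &
        qpow (- ((M * M.+1)%:R / 2)) * (qpow 1 - qpow (- 1)) ^+ M *
          (qpow x - qpow (- x)) * T = F lam x Lam m m'.

(* tau_j^delta; for the last index j the cyclic successor ordS j is the first
   index *)
Definition tau (j : 'I_n) (delta : nat) m : n.-tuple nat :=
  [tuple (tnth m i + delta * (i == ordS j) - delta * (i == j))%N | i < n].

Definition resonance_relations Lam (phi : C -> n.-tuple nat -> C) : Prop :=
  forall m, compositions M m ->
    forall (j : 'I_n) (delta : nat), (1 <= delta <= tnth m j)%N ->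
      if (j.+1 < n)%N then
        let c := - delta%:R +
          \sum_(i < n | (j < i)%N) (Lam 0 i - (tnth m i).*2%:R) in
        phi c m = phi c (tau j delta m)
      else phi (- delta%:R) m = phi delta%:R (tau j delta m).

Definition is_resonance_solution x Lam (m' : n.-tuple nat)
    (phi : C -> n.-tuple nat -> C) : Prop :=
  (exists psi : nat -> n.-tuple nat -> C,
     (forall m, compositions M m -> psi 0%N m = (m == m')%:R) /\
     (forall lam m, compositions M m ->
        phi lam m = qpow (lam * (x - M%:R)) *
          \sum_(k < M.+1) qpow (k.*2%:R * lam) * psi k m)) /\
  resonance_relations Lam phi.

(* Psi lam x Lam m m' is the entry of row m and column m' *)
Definition is_fundamental_resonance_matrix
    (Psi : C -> C -> 'rV[C]_n -> n.-tuple nat -> n.-tuple nat -> C) : Prop :=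
  let S := [set p : C^o * 'rV[C]_n | weights M p.2] in
  generic S (fun p => forall m', compositions M m' ->
    is_resonance_solution p.1 p.2 m' (fun lam m => Psi lam p.1 p.2 m m') /\
    (forall phi, is_resonance_solution p.1 p.2 m' phi ->
       forall lam m, compositions M m -> phi lam m = Psi lam p.1 p.2 m m')) /\
  (forall lam m m', compositions M m -> compositions M m' ->
     meromorphic S (fun p => Psi lam p.1 p.2 m m')).

Definition Xi Lam m : C :=
  qpow (\sum_(j < n) (tnth m j)%:R *
          \sum_(i < n | (i < j)%N) (Lam 0 i - (tnth m i)%:R)).

End TraceAndResonance.

(* Main.v *)
Require Import Defs.
From HB Require Import structures.
From mathcomp Require Import all_boot all_order all_algebra ring lra zify.
From mathcomp Require Import freeg complex.
From mathcomp Require Import all_classical all_reals all_analysis.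

(** For generic parameters the columns of [Psi] are characterised by the shape
    of their dependence on [lam] together with the resonance relations.  The
    proof shows that the columns of [F], multiplied by [Xi], have this shape and
    satisfy these relations, and then passes from generic to all weights.

    Resonance.  At [lam = - d] with [d] a positive integer, the Verma module of
    highest weight [- d - 1] embeds into the one of highest weight [d - 1], its
    highest weight vector going to [F^d v].  A vertex operator is determined by
    its components along [u_0], because the relation for [E] computes the
    components along [u_(a+1)] from those along [u_a].  Comparing components
    along [u_0], the restriction along the embedding of the vertex operator of
    index [m - d] is the one of index [m] ([vertex_coef_source]), and a vertex
    operator of index [m] ending in the small module becomes, after embedding,
    the one of index [m + d] ([vertex_coef_target]).  Inserting the embedding
    between two consecutive factors of a product of vertex operators gives the
    first kind of resonance relations ([product_coef_resonance]); inserting it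
    at the end and moving it to the front, under the trace, gives the second
    kind ([product_coef_cyclic]).

    Shape.  Every matrix coefficient of the vertex operator of index [m] is
    [q^(- m lam)] times a polynomial of degree at most [m] in [q^(2 lam)].  The
    constant term of this polynomial comes from the single summand
    [v (x) u_m] of the image of the highest weight vector, and [F] can only
    raise the index of [u_m]; so in a trace, where the total index is
    conserved, constant terms occur on the diagonal only.  They do not depend on
    the position along the trace, and their value is the inverse of [Xi] up to
    the normalisation of [F] ([lpoly_product_coef], [lowcoef_Xi]).

    Trace.  For [k >= 2 M] the [k]-th diagonal coefficient of a product of
    vertex operators is a linear combination of the [q^(c k)] for finitely many
    integers [c], since the sum of the weights is an integer
    ([trace_entry_expsum]).  With [t = q^(- 2 x)], the trace is therefore a
    polynomial in [t], linear in finitely many diagonal coefficients, over the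
    fixed denominator [\prod_c (1 - q^c t)].  Shape and resonance relations are
    thus inherited by the meromorphic continuation in [x]
    ([explicit_solution]), whose poles do not depend on the weights.

    Continuation.  The hypotheses speak of arbitrary functions that are complex
    differentiable on an open set, so the identity theorem is needed for such
    functions.  It is derived from Goursat's theorem on rectangles, which in
    logarithmic coordinates gives the mean value property on circles
    ([mean_value]), hence the maximum principle ([max_principle]); the latter,
    applied to [f z / (z - a)^n] for all [n], shows that a function vanishing
    near [a] vanishes on a disc about [a] ([identity_disc]).  Consequently [F]
    equals the explicit quotient wherever the denominator does not vanish
    ([trace_quotient]), and by Baire's theorem generic parameters are dense
    among those with prescribed sum of weights ([generic_dense]).  As the
    explicit quotient is holomorphic in [x] and the weights jointly, its
    equality with [Psi] extends from generic parameters to all weights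
    ([meromorphic_eq]). *)

Set Implicit Arguments.
Unset Strict Implicit.
Unset Printing Implicit Defensive.

Import Order.TTheory GRing.Theory Num.Theory.
Import numFieldNormedType.Exports.
Local Open Scope classical_set_scope.
Local Open Scope ring_scope.
Local Open Scope complex_scope.

(** * Integrals of continuous functions on segments *)

Section ContinuousIntegral.
Variable R : realType.
Local Notation mu := (@lebesgue_measure R).
Implicit Types (f g : R -> R) (a b c : R).

(** Two-sided continuity, also at the end points, so that it is inherited
    by subsegments and by restrictions of functions of two variables. *)
Definition cont_on a b f := forall x, a <= x <= b -> {for x, continuous f}.

Definition intg f a b : R := \int[mu]_(x in `[a, b]) f x.

Lemma cont_on_sub a b a' b' f : a <= a' -> b' <= b ->
  cont_on a b f -> cont_on a' b' f.
Proof.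
move=> aa bb cf x /andP[ax xb]; apply: cf.
by rewrite (le_trans aa) ?(le_trans xb).
Qed.

Lemma cont_on_within a b f : cont_on a b f -> {within `[a, b], continuous f}.
Proof.
move=> cf; apply: continuous_in_subspaceT => x.
by rewrite inE /= in_itv /= => xab; apply: cf.
Qed.

Lemma cont_on_integrable a b f : cont_on a b f ->
  mu.-integrable `[a, b] (EFin \o f).
Proof.
move=> cf; apply: continuous_compact_integrable; first exact: segment_compact.
exact: cont_on_within.
Qed.

Lemma intgD f g a b : cont_on a b f -> cont_on a b g ->
  intg (fun x => f x + g x) a b = intg f a b + intg g a b.
Proof. by move=> cf cg; apply: RintegralD => //; exact: cont_on_integrable. Qed.

Lemma intgB f g a b : cont_on a b f -> cont_on a b g ->
  intg (fun x => f x - g x) a b = intg f a b - intg g a b.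
Proof. by move=> cf cg; apply: RintegralB => //; exact: cont_on_integrable. Qed.

Lemma intg_cst k a b : a <= b -> intg (fun=> k) a b = k * (b - a).
Proof.
move=> ab; rewrite /intg Rintegral_cst //=; congr (_ * _).
rewrite lebesgue_measure_itv /= lte_fin.
by case: ltgtP ab => // ->; rewrite subrr.
Qed.

Lemma intg_split f a c b : a <= c -> c <= b -> cont_on a b f ->
  intg f a b = intg f a c + intg f c b.
Proof.
move=> ac cb cf.
have := @Rintegral_itvB R f (BLeft a) (BRight b) c (cont_on_integrable cf).
rewrite !bnd_simp => /(_ ac cb) E.
rewrite [X in _ = _ + X]/intg -Rintegral_itv_obnd_cbnd; first last.
  apply: integrableS (cont_on_integrable (cont_on_sub ac (lexx b) cf)) => //.
  by apply: subset_itvr; rewrite bnd_simp.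
by rewrite -E /intg addrC subrK.
Qed.

Lemma intg_norm f a b k : a <= b -> cont_on a b f ->
  (forall x, a <= x <= b -> `|f x| <= k) -> `|intg f a b| <= k * (b - a).
Proof.
move=> ab cf fk; rewrite -intg_cst //.
apply: le_trans (le_normr_Rintegral _ (cont_on_integrable cf)) _ => //.
apply: le_Rintegral => //.
- apply: (@cont_on_integrable a b (fun x => `|f x|)) => x xab.
  by apply: continuous_comp; [exact: cf|exact: norm_continuous].
- by apply: (@cont_on_integrable a b (fun=> k)) => x xab; exact: cst_continuous.
Qed.

Lemma intg_ge0 f a b : (forall x, a <= x <= b -> 0 <= f x) -> 0 <= intg f a b.
Proof.
by move=> f0; apply: Rintegral_ge0 => x /=; rewrite in_itv /=; exact: f0.
Qed.

End ContinuousIntegral.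

(** * Goursat's theorem for closed forms on rectangles *)

Lemma nested_halves (R : realType) (X : nat -> R) (s : R) : 0 <= s ->
  (forall n, X n <= X n.+1 /\ X n.+1 + s / 2 ^+ n.+1 <= X n + s / 2 ^+ n) ->
  exists c, forall n, X n <= c <= X n + s / 2 ^+ n.
Proof.
move=> s0 H.
have s2 n : 0 <= s / 2 ^+ n by rewrite divr_ge0 // exprn_ge0.
have up n k : X n <= X (n + k)%N.
  elim: k => [|k IH]; first by rewrite addn0.
  by rewrite addnS (le_trans IH) //; case: (H (n + k)%N).
have dn n k : X (n + k)%N + s / 2 ^+ (n + k) <= X n + s / 2 ^+ n.
  elim: k => [|k IH]; first by rewrite addn0.
  by rewrite addnS (le_trans _ IH) //; case: (H (n + k)%N).
have bd n m : X m <= X n + s / 2 ^+ n.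
  have [nm|mn] := leqP n m.
    by rewrite -(subnKC nm) (le_trans _ (dn n (m - n)%N)) // lerDl.
  by rewrite -(subnKC (ltnW mn)) (le_trans (up m (n - m)%N)) // lerDl.
have hs : has_sup (range X).
  split; first by exists (X 0%N), 0%N.
  by exists (X 0%N + s / 2 ^+ 0) => _ [m _ <-]; exact: bd.
exists (sup (range X)) => n; apply/andP; split.
  by apply: ub_le_sup; [exact: hs.2|exists n].
by apply: ge_sup; [exact: hs.1|move=> _ [m _ <-]; exact: bd].
Qed.

Section Goursat.
Variable R : realType.
Variables P Q : R -> R -> R.

(** The form [P dx + Q dy] has a first order expansion at [(x, y)] with
    symmetric Jacobian: closedness without continuity of the derivatives. *)
Definition closed_at (x y : R) := exists a b d, forall e, 0 < e ->
  exists2 r, 0 < r & forall x' y', `|x' - x| < r -> `|y' - y| < r ->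
   `|P x' y' - P x y - (a * (x' - x) + b * (y' - y))|
     <= e * (`|x' - x| + `|y' - y|) /\
   `|Q x' y' - Q x y - (b * (x' - x) + d * (y' - y))|
     <= e * (`|x' - x| + `|y' - y|).

Lemma lin_approx_cts (f : R -> R) x a :
  (exists2 r, 0 < r & forall x', `|x' - x| < r ->
    `|f x' - f x - a * (x' - x)| <= `|x' - x|) -> {for x, continuous f}.
Proof.
move=> [r r0 fr]; apply/cvgrPdist_le => e e0.
have k0 : 0 < 1 + `|a| by rewrite ltr_wpDr.
have m0 : 0 < Num.min r (e / (1 + `|a|)) by rewrite lt_min r0 divr_gt0.
apply/nbhs_ballP; exists (Num.min r (e / (1 + `|a|))) => //= y.
rewrite /ball /= distrC lt_min => /andP[/fr yr ye].
rewrite distrC; have -> : f y - f x = (f y - f x - a * (y - x)) + a * (y - x).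
  by rewrite subrK.
apply: le_trans (ler_normD _ _) _; rewrite normrM.
move: ye; rewrite ltr_pdivlMr // => ye.
by apply: le_trans (lerD yr (lexx _)) _; lra.
Qed.

Lemma closed_at_cts x y : closed_at x y ->
  [/\ {for x, continuous (P^~ y)}, {for y, continuous (P x)},
      {for x, continuous (Q^~ y)} & {for y, continuous (Q x)}].
Proof.
move=> [a [b [d /(_ 1 ltr01)[r r0 H]]]].
have n0 : `|0 : R| < r by rewrite normr0.
split.
- apply: (@lin_approx_cts _ _ a); exists r => // x' xr.
  have := (H x' y xr); rewrite subrr => /(_ n0)[+ _].
  by rewrite mulr0 addr0 normr0 addr0 mul1r.
- apply: (@lin_approx_cts _ _ b); exists r => // x' xr.
  have := (H x x'); rewrite subrr => /(_ n0 xr)[+ _].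
  by rewrite mulr0 add0r normr0 add0r mul1r.
- apply: (@lin_approx_cts _ _ b); exists r => // x' xr.
  have := (H x' y xr); rewrite subrr => /(_ n0)[_].
  by rewrite mulr0 addr0 normr0 addr0 mul1r.
- apply: (@lin_approx_cts _ _ d); exists r => // x' xr.
  have := (H x x'); rewrite subrr => /(_ n0 xr)[_].
  by rewrite mulr0 add0r normr0 add0r mul1r.
Qed.

(** The integral of [P dx + Q dy] along the boundary of a rectangle.  Opposite
    sides are paired so that the linear part of the form cancels pointwise. *)
Definition bdint x0 x1 y0 y1 : R :=
  intg (fun x => P x y0 - P x y1) x0 x1 + intg (fun y => Q x1 y - Q x0 y) y0 y1.

Definition closed_on x0 x1 y0 y1 :=
  forall x y, x0 <= x <= x1 -> y0 <= y <= y1 -> closed_at x y.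

Lemma closed_on_sub x0 x1 y0 y1 x0' x1' y0' y1' :
  x0 <= x0' -> x1' <= x1 -> y0 <= y0' -> y1' <= y1 ->
  closed_on x0 x1 y0 y1 -> closed_on x0' x1' y0' y1'.
Proof.
move=> ? ? ? ? H x y /andP[? ?] /andP[? ?].
by apply: H; apply/andP; split; lra.
Qed.

Section Rect.
Variables x0 x1 y0 y1 : R.
Hypothesis H : closed_on x0 x1 y0 y1.

Lemma ctsP y : y0 <= y <= y1 -> cont_on x0 x1 (P^~ y).
Proof. by move=> yy x xx; have [] := closed_at_cts (H xx yy). Qed.

Lemma ctsQ x : x0 <= x <= x1 -> cont_on y0 y1 (Q x).
Proof. by move=> xx y yy; have [] := closed_at_cts (H xx yy). Qed.

Lemma ctsPB y y' : y0 <= y <= y1 -> y0 <= y' <= y1 ->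
  cont_on x0 x1 (fun x => P x y - P x y').
Proof.
by move=> yy yy' x xx; apply: continuousB; [apply: (ctsP yy)|apply: (ctsP yy')].
Qed.

Lemma ctsQB x x' : x0 <= x <= x1 -> x0 <= x' <= x1 ->
  cont_on y0 y1 (fun y => Q x y - Q x' y).
Proof.
by move=> xx xx' y yy; apply: continuousB; [apply: (ctsQ xx)|apply: (ctsQ xx')].
Qed.

Lemma bdint_splitx c : x0 <= c <= x1 -> y0 <= y1 ->
  bdint x0 x1 y0 y1 = bdint x0 c y0 y1 + bdint c x1 y0 y1.
Proof.
move=> /andP[c0 c1] yy; rewrite /bdint.
have y0i : y0 <= y0 <= y1 by rewrite lexx.
have y1i : y0 <= y1 <= y1 by rewrite yy lexx.
have xx : x0 <= x1 by apply: le_trans c1.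
rewrite (intg_split c0 c1 (ctsPB y0i y1i)) addrACA; congr (_ + _).
rewrite -intgD; first by congr intg; apply/funext => y; ring.
- by apply: ctsQB; rewrite ?c0 ?lexx.
- by apply: ctsQB; rewrite ?c0 ?lexx ?xx.
Qed.

Lemma bdint_splity c : y0 <= c <= y1 -> x0 <= x1 ->
  bdint x0 x1 y0 y1 = bdint x0 x1 y0 c + bdint x0 x1 c y1.
Proof.
move=> /andP[c0 c1] xx; rewrite /bdint.
have x0i : x0 <= x0 <= x1 by rewrite lexx.
have x1i : x0 <= x1 <= x1 by rewrite xx lexx.
have yy : y0 <= y1 by apply: le_trans c1.
rewrite (intg_split c0 c1 (ctsQB x1i x0i)) addrACA; congr (_ + _).
rewrite -intgD; first by congr intg; apply/funext => y; ring.
- by apply: ctsPB; rewrite ?c0 ?lexx.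
- by apply: ctsPB; rewrite ?c0 ?lexx ?yy.
Qed.

(** The coefficient [b] common to [P] and [Q] contributes
    [- b (y1 - y0) (x1 - x0)] to one integral and its opposite to the other;
    only the error terms of the expansions remain. *)
Lemma bdint_small x y a b d e r :
  x0 <= x <= x1 -> y0 <= y <= y1 -> x1 - x0 < r -> y1 - y0 < r -> 0 <= e ->
  (forall x' y', `|x' - x| < r -> `|y' - y| < r ->
   `|P x' y' - P x y - (a * (x' - x) + b * (y' - y))|
     <= e * (`|x' - x| + `|y' - y|) /\
   `|Q x' y' - Q x y - (b * (x' - x) + d * (y' - y))|
     <= e * (`|x' - x| + `|y' - y|)) ->
  `|bdint x0 x1 y0 y1| <= 2 * e * ((x1 - x0) + (y1 - y0)) ^+ 2.
Proof.
move=> xx yy xr yr e0 K.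
set s := (x1 - x0) + (y1 - y0).
have /andP[xx0 xx1] := xx; have /andP[yy0 yy1] := yy.
have x01 : x0 <= x1 by lra.
have y01 : y0 <= y1 by lra.
have dx x' : x0 <= x' <= x1 -> `|x' - x| <= x1 - x0.
  by move=> /andP[? ?]; rewrite ler_norml; apply/andP; split; lra.
have dy y' : y0 <= y' <= y1 -> `|y' - y| <= y1 - y0.
  by move=> /andP[? ?]; rewrite ler_norml; apply/andP; split; lra.
have L x' y' : x0 <= x' <= x1 -> y0 <= y' <= y1 ->
   `|P x' y' - P x y - (a * (x' - x) + b * (y' - y))| <= e * s /\
   `|Q x' y' - Q x y - (b * (x' - x) + d * (y' - y))| <= e * s.
  move=> xi yi.
  have [|//|k1 k2] := K x' y'; try exact: le_lt_trans (dx _ xi) _.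
    exact: le_lt_trans (dy _ yi) _.
  have es : e * (`|x' - x| + `|y' - y|) <= e * s.
    by rewrite ler_wpM2l // lerD ?dx ?dy.
  by split; [apply: le_trans k1 es|apply: le_trans k2 es].
have y0i : y0 <= y0 <= y1 by rewrite lexx.
have y1i : y0 <= y1 <= y1 by rewrite y01 lexx.
have x0i : x0 <= x0 <= x1 by rewrite lexx.
have x1i : x0 <= x1 <= x1 by rewrite x01 lexx.
have cc u v (k : R) : cont_on u v (fun=> k) by move=> ? _; exact: cst_continuous.
have -> : bdint x0 x1 y0 y1 =
   intg (fun x' => (P x' y0 - P x' y1) + b * (y1 - y0)) x0 x1 +
   intg (fun y' => (Q x1 y' - Q x0 y') + - (b * (x1 - x0))) y0 y1.
  have cPB := ctsPB y0i y1i; have cQB := ctsQB x1i x0i.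
  rewrite (intgD cPB (cc _ _ _)) (intgD cQB (cc _ _ _)) !intg_cst //.
  by rewrite /bdint; ring.
have i1 : `|intg (fun x' => (P x' y0 - P x' y1) + b * (y1 - y0)) x0 x1|
    <= 2 * e * s * (x1 - x0).
  apply: intg_norm => //.
    by move=> t ti; apply: continuousD; [apply: ctsPB|apply: cst_continuous].
  move=> t ti; have [+ _] := L t y0 ti y0i; have [+ _] := L t y1 ti y1i.
  rewrite !ler_norml => /andP[? ?] /andP[? ?]; apply/andP; split; lra.
have i2 : `|intg (fun y' => (Q x1 y' - Q x0 y') + - (b * (x1 - x0))) y0 y1|
    <= 2 * e * s * (y1 - y0).
  apply: intg_norm => //.
    by move=> t ti; apply: continuousD; [apply: ctsQB|apply: cst_continuous].
  move=> t ti; have [_ +] := L x0 t x0i ti; have [_ +] := L x1 t x1i ti.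
  rewrite !ler_norml => /andP[? ?] /andP[? ?]; apply/andP; split; lra.
apply: le_trans (ler_normD _ _) _; apply: le_trans (lerD i1 i2) _.
suff -> : 2 * e * s ^+ 2 = 2 * e * s * (x1 - x0) + 2 * e * s * (y1 - y0) by [].
by rewrite /s; ring.
Qed.

End Rect.

(** By additivity one of the four quarters carries at least a quarter of
    the boundary integral. *)
Lemma bdint_quarter x y s t : 0 <= s -> 0 <= t ->
  closed_on x (x + s) y (y + t) ->
  exists p : R * R, [/\ x <= p.1, p.1 + s / 2 <= x + s, y <= p.2,
     p.2 + t / 2 <= y + t &
     `|bdint x (x + s) y (y + t)| / 4 <=
     `|bdint p.1 (p.1 + s / 2) p.2 (p.2 + t / 2)|].
Proof.
move=> s0 t0 H.
set xm := x + s / 2; set ym := y + t / 2.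
have E : bdint x (x + s) y (y + t) =
    (bdint x xm y ym + bdint x xm ym (y + t)) +
    (bdint xm (x + s) y ym + bdint xm (x + s) ym (y + t)).
  rewrite (bdint_splitx H (c := xm)); last 2 first.
  - by apply/andP; split; rewrite /xm; lra.
  - lra.
  congr (_ + _); apply: bdint_splity.
  - by apply: closed_on_sub H; rewrite /xm; lra.
  - by apply/andP; split; rewrite /ym; lra.
  - by rewrite /xm; lra.
  - by apply: closed_on_sub H; rewrite /xm; lra.
  - by apply/andP; split; rewrite /ym; lra.
  - by rewrite /xm; lra.
have xE : x + s = xm + s / 2 by rewrite /xm; lra.
have yE : y + t = ym + t / 2 by rewrite /ym; lra.
apply: contrapT => /forallNP N.
have B p : x <= p.1 -> p.1 + s / 2 <= x + s -> y <= p.2 ->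
    p.2 + t / 2 <= y + t ->
    `|bdint p.1 (p.1 + s / 2) p.2 (p.2 + t / 2)| <
    `|bdint x (x + s) y (y + t)| / 4.
  by move=> p1 p2 p3 p4; rewrite ltNge; apply/negP => p5; apply: (N p).
have B1 : `|bdint x xm y ym| < `|bdint x (x + s) y (y + t)| / 4.
  by apply: (B (x, y)) => /=; lra.
have B2 : `|bdint x xm ym (y + t)| < `|bdint x (x + s) y (y + t)| / 4.
  by rewrite [X in bdint _ _ _ X]yE; apply: (B (x, ym)) => /=; rewrite /ym; lra.
have B3 : `|bdint xm (x + s) y ym| < `|bdint x (x + s) y (y + t)| / 4.
  by rewrite [X in bdint _ X _ _]xE; apply: (B (xm, y)) => /=; rewrite /xm; lra.
have B4 : `|bdint xm (x + s) ym (y + t)| < `|bdint x (x + s) y (y + t)| / 4.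
  rewrite [X in bdint _ X _ _]xE [X in bdint _ _ _ X]yE.
  by apply: (B (xm, ym)) => /=; rewrite /xm /ym; lra.
have := ler_normD (bdint x xm y ym + bdint x xm ym (y + t))
    (bdint xm (x + s) y ym + bdint xm (x + s) ym (y + t)).
rewrite -E.
have := ler_normD (bdint x xm y ym) (bdint x xm ym (y + t)).
have := ler_normD (bdint xm (x + s) y ym) (bdint xm (x + s) ym (y + t)).
lra.
Qed.

(** Quartering repeatedly gives rectangles shrinking to a point whose
    boundary integral is at least a fixed multiple of their area, which
    contradicts the expansion of the form at that point. *)
Theorem Goursat x y s t : 0 <= s -> 0 <= t ->
  closed_on x (x + s) y (y + t) -> bdint x (x + s) y (y + t) = 0.
Proof.
move=> s0 t0 H; set K := bdint _ _ _ _.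
apply/eqP; rewrite -normr_eq0; apply/negPn/negP => K0.
have {}K0 : 0 < `|K| by rewrite lt_neqAle eq_sym K0 normr_ge0.
pose inv n (p : R * R) := [/\ x <= p.1, p.1 + s / 2 ^+ n <= x + s, y <= p.2,
   p.2 + t / 2 ^+ n <= y + t &
   `|K| / 4 ^+ n <= `|bdint p.1 (p.1 + s / 2 ^+ n) p.2 (p.2 + t / 2 ^+ n)|].
pose nxt n (p p' : R * R) :=
  (p.1 <= p'.1 /\ p'.1 + s / 2 ^+ n.+1 <= p.1 + s / 2 ^+ n) /\
  (p.2 <= p'.2 /\ p'.2 + t / 2 ^+ n.+1 <= p.2 + t / 2 ^+ n).
have stepP (np : nat * (R * R)) : exists p', inv np.1 np.2 ->
    inv np.1.+1 p' /\ nxt np.1 np.2 p'.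
  case: np => n p /=; have [I|I] := pselect (inv n p); last by exists p.
  have [I1 I2 I3 I4 I5] := I.
  have sn : 0 <= s / 2 ^+ n by rewrite divr_ge0 // exprn_ge0.
  have tn : 0 <= t / 2 ^+ n by rewrite divr_ge0 // exprn_ge0.
  have [p' [p1 p2 p3 p4 p5]] := bdint_quarter sn tn (closed_on_sub I1 I2 I3 I4 H).
  exists p' => _; have e2 (u : R) : u / 2 ^+ n.+1 = u / 2 ^+ n / 2.
    by rewrite exprSr invfM mulrA.
  split; last by split; rewrite e2.
  split; rewrite ?e2; try lra.
  apply: le_trans p5; rewrite exprSr invfM mulrA.
  by rewrite ler_pM2r ?invr_gt0.
have [F FP] := choice stepP.
pose S := fix S n := if n is n'.+1 then F (n', S n') else (x, y).
have SI n : inv n (S n).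
  elim: n => [|n IH]; last by case: (FP (n, S n) IH).
  by split; rewrite /= ?expr0 ?divr1.
have SN n : nxt n (S n) (S n.+1) by case: (FP (n, S n) (SI n)).
have [cx cxP] := nested_halves s0 (fun n => (SN n).1).
have [cy cyP] := nested_halves t0 (fun n => (SN n).2).
have hx : x <= cx <= x + s by have := cxP 0%N; rewrite /= expr0 divr1.
have hy : y <= cy <= y + t by have := cyP 0%N; rewrite /= expr0 divr1.
have [a [b [d D]]] := H _ _ hx hy.
have st0 : 0 < 1 + (s + t) ^+ 2 by rewrite ltr_wpDr // sqr_ge0.
pose e := `|K| / (4 * (1 + (s + t) ^+ 2)).
have e0 : 0 < e by rewrite divr_gt0 // mulr_gt0.
have [r r0 Dr] := D e e0.
have [n [ns nt]] : exists n, s / 2 ^+ n < r /\ t / 2 ^+ n < r.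
  pose n := (Num.truncn ((s + t) / r)).+1.
  have n2 : (s + t) / r < 2 ^+ n.
    apply: lt_trans (truncnS_gt _) _.
    by rewrite -natrX ltr_nat ltn_expl.
  have p2 : 0 < 2 ^+ n :> R by rewrite exprn_gt0.
  exists n; move: n2; rewrite !ltr_pdivrMr // mulrC => n2.
  by split; lra.
have [I1 I2 I3 I4 I5] := SI n.
have := @bdint_small _ _ _ _ (closed_on_sub I1 I2 I3 I4 H) _ _ _ _ _ _ _
  (cxP n) (cyP n) _ _ (ltW e0) Dr.
have -> u v : u + v - u = v :> R by rewrite addrC addKr.
have -> u v : u + v - u = v :> R by rewrite addrC addKr.
move=> /(_ ns nt) U; have {I5 U} := le_trans I5 U.
have -> : 2 * e * (s / 2 ^+ n + t / 2 ^+ n) ^+ 2 = 2 * e * (s + t) ^+ 2 / 4 ^+ n.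
  have -> : 4 = 2 ^+ 2 :> R by rewrite -natrX.
  rewrite -exprM mulnC exprM.
  field; exact: expf_neq0.
rewrite ler_pM2r ?invr_gt0 ?exprn_gt0 // leNgt => /negP; apply.
have -> : `|K| = e * (4 * (1 + (s + t) ^+ 2)).
  by rewrite /e divfK // gt_eqF // mulr_gt0.
rewrite -mulrA mulrCA ltr_pM2l //; have := sqr_ge0 (s + t); lra.
Qed.

End Goursat.

(** * Complex differentiability and the exponential *)

Lemma differentiable_epsP (K : numFieldType) (f : K^o -> K^o) (x : K^o) :
  differentiable f x <-> exists d : K, forall e : K, 0 < e ->
    \forall h \near (0 : K^o), `|f (h + x) - f x - h * d| <= e * `|h|.
Proof.
split.
  move=> /(derivable1_diffP f x) /cvg_ex [/= d /cvgrPdist_le D].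
  exists d => e e0; have := D e e0; rewrite near_withinE => De.
  near=> h; have [->|h0] := eqVneq h 0.
    by rewrite add0r subrr sub0r mul0r oppr0 !normr0 mulr0.
  have : `|d - h^-1 *: ((f \o shift x) (h *: 1) - f x)| <= e.
    by move: h0; near: h.
  have -> : f (h + x) - f x - h * d =
     - h * (d - h^-1 *: ((f \o shift x) (h *: 1) - f x)).
    rewrite /= /GRing.scale /= mulr1 mulrBr mulNr mulNr mulrA mulfV //.
    by rewrite mul1r opprK addrC.
  by rewrite normrM normrN mulrC => E; rewrite ler_wpM2r.
move=> [d D]; apply/(derivable1_diffP f x)/cvg_ex; exists d.
apply/cvgrPdist_le => e e0; rewrite near_withinE.
have := D e e0 => De; near=> h => h0.
have : `|f (h + x) - f x - h * d| <= e * `|h| by near: h.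
have -> : f (h + x) - f x - h * d =
     - h * (d - h^-1 *: ((f \o shift x) (h *: 1) - f x)).
  rewrite /= /GRing.scale /= mulr1 mulrBr mulNr mulNr mulrA mulfV //.
  by rewrite mul1r opprK addrC.
by rewrite normrM normrN mulrC ler_pM2r // normr_gt0.
Unshelve. all: by end_near. Qed.

Section ComplexNorm.
Variable R : realType.
Local Notation C := R[i].
Implicit Types z w : C.

(** The modulus as a real number: the norm of [R[i]] takes its values in
    [R[i]], ordered partially. *)
Definition cabs z : R := complex.Re `|z|.

Lemma cabsE z : `|z| = (cabs z)%:C.
Proof. by rewrite /cabs normc_def. Qed.

Lemma cabs_ge0 z : 0 <= cabs z.
Proof. by rewrite -lecR -cabsE; exact: normr_ge0. Qed.

Lemma cabs0 : cabs 0 = 0.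
Proof. by rewrite /cabs normr0. Qed.

Lemma cabsD z w : cabs (z + w) <= cabs z + cabs w.
Proof. by rewrite -lecR rmorphD /= -!cabsE ler_normD. Qed.

Lemma cabsN z : cabs (- z) = cabs z.
Proof. by rewrite /cabs normrN. Qed.

Lemma cabsB z w : cabs (z - w) = cabs (w - z).
Proof. by rewrite /cabs distrC. Qed.

Lemma cabsM z w : cabs (z * w) = cabs z * cabs w.
Proof. by apply: complexI; rewrite rmorphM /= -!cabsE normrM. Qed.

Lemma cabsV z : cabs z^-1 = (cabs z)^-1.
Proof. by apply: complexI; rewrite fmorphV /= -!cabsE normfV. Qed.

Lemma cabsX z n : cabs (z ^+ n) = cabs z ^+ n.
Proof. by apply: complexI; rewrite rmorphXn /= -!cabsE normrX. Qed.

Lemma cabs_real (a : R) : cabs a%:C = `|a|.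
Proof.
by rewrite /cabs normc_def /= expr0n /= addr0 sqrtr_sqr.
Qed.

Lemma cabs1 : cabs 1 = 1.
Proof. by rewrite /cabs normr1. Qed.

Lemma cabsi : cabs 'i = 1.
Proof. by rewrite /cabs normc_def /= expr0n expr1n /= add0r sqrtr1. Qed.

Lemma cabs_eq0 z : (cabs z == 0) = (z == 0).
Proof. by rewrite -[z == 0]normr_eq0 cabsE -(inj_eq (@complexI R)). Qed.

Lemma cabs_gt0 z : (0 < cabs z) = (z != 0).
Proof. by rewrite lt_neqAle cabs_ge0 andbT eq_sym cabs_eq0. Qed.

Lemma cabs_sqr z : cabs z ^+ 2 = complex.Re z ^+ 2 + complex.Im z ^+ 2.
Proof.
rewrite /cabs normc_def /= sqr_sqrtr //.
by rewrite addr_ge0 ?sqr_ge0.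
Qed.

Lemma Re_cabs z : `|complex.Re z| <= cabs z.
Proof.
rewrite -ler_sqr ?nnegrE ?cabs_ge0 // cabs_sqr real_normK ?num_real //.
by rewrite lerDl sqr_ge0.
Qed.

Lemma Im_cabs z : `|complex.Im z| <= cabs z.
Proof.
rewrite -ler_sqr ?nnegrE ?cabs_ge0 // cabs_sqr real_normK ?num_real //.
by rewrite lerDr sqr_ge0.
Qed.

Lemma cabs_ReIm z : cabs z <= `|complex.Re z| + `|complex.Im z|.
Proof.
rewrite {1}[z]complexE; apply: le_trans (cabsD _ _) _.
by rewrite cabsM cabsi mul1r !cabs_real.
Qed.

Lemma nbhs_cabs (z : C^o) (A : set C^o) :
  nbhs z A <-> exists2 r : R, 0 < r & forall w, cabs (w - z) < r -> A w.
Proof.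
split.
  move=> /nbhs_ballP [[a b] /= ab H].
  move: ab; rewrite ltcE /= => /andP[/eqP b0 a0].
  exists a => // w wz; apply: H; rewrite /ball /= distrC cabsE ltcE /= wz.
  by rewrite b0 eqxx.
move=> [r r0 H]; apply/nbhs_ballP; exists r%:C; first by rewrite /= ltcR.
by move=> w; rewrite /ball /= distrC cabsE ltcR => /H.
Qed.

Lemma cdiffP (f : C^o -> C^o) (z : C^o) :
  differentiable f z <-> exists d : C, forall e : R, 0 < e ->
    exists2 r : R, 0 < r & forall w, cabs (w - z) < r ->
      cabs (f w - f z - (w - z) * d) <= e * cabs (w - z).
Proof.
rewrite differentiable_epsP; split=> -[d D]; exists d => e e0.
  have := D e%:C; rewrite ltcR => /(_ e0) /nbhs_cabs [r r0 Dr].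
  exists r => // w wr; have := Dr (w - z); rewrite subr0 subrK => /(_ wr).
  by rewrite !cabsE -rmorphM lecR.
have e00 : 0 < complex.Re e by move: e0; rewrite ltcE /= => /andP[].
have eE : e = (complex.Re e)%:C.
  rewrite [LHS]complexE; move: e0; rewrite ltcE /= => /andP[/eqP -> _].
  by rewrite mulr0 addr0.
have [r r0 Dr] := D _ e00.
apply/nbhs_cabs; exists r => // h; rewrite subr0 => hr.
have := Dr (h + z); rewrite addrK => /(_ hr) K.
by rewrite eE !cabsE -rmorphM lecR.
Qed.

End ComplexNorm.

Section ComplexExponential.
Variable R : realType.
Local Notation C := R[i].

Lemma real_derive_eps (f : R -> R) (x d : R) : is_derive x (1 : R) f d ->
  forall e, 0 < e -> exists2 r, 0 < r & forall h, `|h| < r ->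
    `|f (h + x) - f x - h * d| <= e * `|h|.
Proof.
move=> [df fd] e e0; move: df => /cvg_ex [/= l lP].
have ld : l = d by rewrite -fd; symmetry; apply: cvg_lim.
move: lP => /cvgrPdist_le /(_ e e0); rewrite near_withinE => /nbhs_ballP.
move=> [r /= r0 H]; exists r => // h hr.
have [->|h0] := eqVneq h 0.
  by rewrite add0r subrr sub0r mul0r oppr0 !normr0 mulr0.
have /(_ _ h0) := H h; rewrite /ball /= sub0r normrN => /(_ hr).
have -> : f (h + x) - f x - h * d = - h * (l - h^-1 *: (f (h *: 1 + x) - f x)).
  rewrite /GRing.scale /= mulr1 mulrBr mulNr mulNr mulrA mulfV //.
  by rewrite mul1r opprK addrC ld.
by rewrite normrM normrN mulrC => E; rewrite ler_wpM2r.
Qed.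

Lemma cexp_near0 (e : R) : 0 < e -> exists2 r : R, 0 < r &
  forall h : C, cabs h < r -> cabs (cexp h - 1 - h) <= e * cabs h.
Proof.
move=> e0; have [e' [e'0 e'1 e'e]] : exists e', [/\ 0 < e', e' <= 1 & 10 * e' <= e].
  exists (Num.min 1 (e / 10)); rewrite lt_min ltr01 divr_gt0 // ge_min lexx.
  by split=> //; rewrite mulrC -ler_pdivlMr // ge_min lexx orbT.
have [r1 r10 H1] := real_derive_eps (is_derive_expR (0 : R)) e'0.
have [r2 r20 H2] := real_derive_eps (is_derive_cos (0 : R)) e'0.
have [r3 r30 H3] := real_derive_eps (is_derive_sin (0 : R)) e'0.
exists (Num.min (Num.min r1 r2) (Num.min r3 e')).
  by rewrite !lt_min r10 r20 r30 e'0.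
case=> a b; set h := a +i* b; rewrite !lt_min => /andP[/andP[h1 h2] /andP[h3 h4]].
have ah : `|a| <= cabs h by apply: (Re_cabs h).
have bh : `|b| <= cabs h by apply: (Im_cabs h).
have h0 := cabs_ge0 h.
have := H1 a (le_lt_trans ah h1); rewrite addr0 expR0 mulr1 => K1.
have := H2 b (le_lt_trans bh h2); rewrite addr0 cos0 sin0 oppr0 mulr0 subr0 => K2.
have := H3 b (le_lt_trans bh h3); rewrite addr0 cos0 sin0 subr0 mulr1 => K3.
apply: le_trans (cabs_ReIm _) _ => /=.
set X := expR a in K1 *.
have -> : X * cos b - 0 * sin b - 1 - a =
    (X - 1 - a) + X * (cos b - 1) by ring.
have -> : X * sin b + 0 * cos b - 0 - b =
    X * (sin b - b) + (X - 1 - a) * b + a * b by ring.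
set u := cabs h in K1 K2 K3 ah bh h0 h4 *.
have k1 : `|X - 1 - a| <= e' * u by apply: le_trans K1 _; rewrite ler_pM2l.
have k2 : `|cos b - 1| <= e' * u by apply: le_trans K2 _; rewrite ler_pM2l.
have k3 : `|sin b - b| <= e' * u by apply: le_trans K3 _; rewrite ler_pM2l.
have e'u : e' * u <= 1 by rewrite -[1]mulr1 ler_pM // ?(ltW e'0) //; lra.
have X3 : `|X| <= 3.
  have -> : X = (X - 1 - a) + 1 + a by ring.
  apply: le_trans (ler_normD _ _) _.
  apply: le_trans (lerD (ler_normD _ _) (lexx _)) _.
  rewrite normr1; lra.
have m1 : `|X * (cos b - 1)| <= 3 * (e' * u).
  by rewrite normrM ler_pM.
have m2 : `|X * (sin b - b)| <= 3 * (e' * u).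
  by rewrite normrM ler_pM.
have m3 : `|(X - 1 - a) * b| <= e' * u.
  by rewrite normrM -[leRHS]mulr1 ler_pM //; lra.
have m4 : `|a * b| <= e' * u.
  by rewrite normrM mulrC ler_pM //; lra.
have n1 := ler_normD (X - 1 - a) (X * (cos b - 1)).
have n2 := ler_normD (X * (sin b - b) + (X - 1 - a) * b) (a * b).
have n3 := ler_normD (X * (sin b - b)) ((X - 1 - a) * b).
have : 10 * e' * u <= e * u by rewrite ler_wpM2r.
have : 0 <= e' * u by rewrite mulr_ge0 // ltW.
lra.
Qed.

(** By [cexpD] the behaviour at [z] is that at [0]. *)
Lemma differentiable_cexp (z : C^o) : differentiable (@cexp R : C^o -> C^o) z.
Proof.
apply/cdiffP; exists (cexp z) => e e0.
have k0 : 0 < 1 + cabs (cexp z) by rewrite ltr_wpDr // cabs_ge0.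
have [r r0 H] := cexp_near0 (divr_gt0 e0 k0).
exists r => // w wr; have -> : cexp w = cexp z * cexp (w - z).
  by rewrite -cexpD addrC subrK.
have -> : cexp z * cexp (w - z) - cexp z - (w - z) * cexp z =
   cexp z * (cexp (w - z) - 1 - (w - z)) by ring.
rewrite cabsM; apply: le_trans (ler_wpM2l (cabs_ge0 _) (H _ wr)) _.
rewrite mulrA ler_wpM2r ?cabs_ge0 // mulrA ler_pdivrMr // mulrC ler_pM2l //.
lra.
Qed.

Lemma cabs_cexp (z : C) : cabs (cexp z) = expR (complex.Re z).
Proof.
rewrite /cexp cabsM cabs_real ger0_norm ?expR_ge0 //.
by rewrite /cabs normc_def /= addrC sin2cos2 subrK sqrtr1 mulr1.
Qed.

End ComplexExponential.

(** * Mean value property, maximum principle and identity theorem *)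

Lemma differentiable_mul (K : numFieldType) (V : normedModType K)
    (f g : V -> K^o) (x : V) : differentiable f x -> differentiable g x ->
  differentiable (fun y => f y * g y : K^o) x.
Proof. exact: differentiableM. Qed.

Lemma differentiable_exp (K : numFieldType) (V : normedModType K)
    (f : V -> K^o) (x : V) n :
  differentiable f x -> differentiable (fun y => f y ^+ n : K^o) x.
Proof.
move=> df; elim: n => [|n IH].
  by have -> : (fun y => f y ^+ 0 : K^o) = cst 1
    by [apply/funext => y; rewrite expr0|]; exact: differentiable_cst.
have -> : (fun y => f y ^+ n.+1 : K^o) = (fun y => f y * f y ^+ n : K^o).
  by apply/funext => y; rewrite exprS.
exact: differentiable_mul.
Qed.

Section MeanValue.
Variable R : realType.
Local Notation C := R[i].
Implicit Types w : C^o.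
Variables (f : C^o -> C^o) (e : C^o) (r : R).
Hypothesis df : forall w, cabs (w - e) < r -> differentiable f w.

Let P s t := complex.Im (f (e + cexp (s +i* t))).
Let Q s t := complex.Re (f (e + cexp (s +i* t))).

(** With [g] complex differentiable, [Im g ds + Re g dt] is the imaginary
    part of [g d(s + i t)], and the Cauchy-Riemann equations say that it is
    closed.  Here [g] is [f] in logarithmic coordinates around [e]. *)
Lemma log_closed_at s t : expR s < r -> closed_at P Q s t.
Proof.
move=> sr; pose g : C^o -> C^o := fun w => f (e + cexp w).
have dg : differentiable g (s +i* t : C^o).
  apply: (@differentiable_comp _ _ _ _ (fun w : C^o => e + cexp w : C^o) f).
    apply: differentiableD; first exact: differentiable_cst.
    exact: differentiable_cexp.
  by apply: df; rewrite addrC addKr cabs_cexp.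
have /cdiffP [[A B] D] := dg.
exists B, A, (- B) => k k0.
have [d d0 H] := D k k0.
exists (d / 2); first by rewrite divr_gt0.
move=> s' t' sd td; set w : C := s' +i* t'; set z : C := s +i* t.
have n : cabs (w - z) <= `|s' - s| + `|t' - t| by exact: cabs_ReIm.
have wd : cabs (w - z) < d by apply: le_lt_trans n _; lra.
have K : cabs (g w - g z - (w - z) * (A +i* B)) <= k * (`|s' - s| + `|t' - t|).
  by apply: le_trans (H w wd) _; rewrite ler_pM2l.
have E : g w - g z - (w - z) * (A +i* B) =
  (Q s' t' - Q s t - (A * (s' - s) + - B * (t' - t))) +i*
  (P s' t' - P s t - (B * (s' - s) + A * (t' - t))).
  rewrite /P /Q /g -/w -/z; case: (f (e + cexp w)) => p q.
  case: (f (e + cexp z)) => p' q'; apply/eqP; rewrite eq_complex /=.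
  by apply/andP; split; apply/eqP; ring.
by split; [apply: le_trans K; rewrite E; exact: (Im_cabs (_ +i* _))
          |apply: le_trans K; rewrite E; exact: (Re_cabs (_ +i* _))].
Qed.

Lemma cexp_periodic s : cexp (s +i* (pi *+ 2)) = cexp (s +i* 0) :> C.
Proof. by rewrite /cexp /= cos2pi sin2pi cos0 sin0. Qed.

Let T : R := pi *+ 2.
Let T0 : 0 < T. Proof. by rewrite mulrn_wgt0 // pi_gt0. Qed.

Lemma circle_cont s : expR s < r -> cont_on 0 T (Q s).
Proof. by move=> sr t _; case: (closed_at_cts (log_closed_at t sr)). Qed.

(** In logarithmic coordinates an annulus is a rectangle whose horizontal
    sides cancel by periodicity, so the vertical sides have equal integrals. *)
Lemma circle_intg_const s0 s1 : s0 <= s1 -> expR s1 < r ->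
  intg (Q s0) 0 T = intg (Q s1) 0 T.
Proof.
move=> s01 s1r; have s0r : expR s0 < r.
  by apply: le_lt_trans s1r; rewrite ler_expR.
have H : closed_on P Q s0 (s0 + (s1 - s0)) 0 (0 + T).
  move=> s t /andP[_ ss] _; apply: log_closed_at; apply: le_lt_trans s1r.
  by rewrite ler_expR; rewrite addrC subrK in ss.
have := Goursat _ (ltW T0) H; rewrite subr_ge0 => /(_ s01).
rewrite add0r [s0 + _]addrC subrK /bdint.
have -> : (fun x => P x 0 - P x T) = fun=> 0.
  by apply/funext => s; rewrite /P cexp_periodic subrr.
rewrite (intg_cst 0 s01) mul0r add0r.
rewrite (intgB (circle_cont s1r) (circle_cont s0r)) => E.
by symmetry; exact: subr0_eq E.
Qed.

(** The integral over a circle does not depend on the radius, and for small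
    radii it is close to the value at the centre by continuity. *)
Lemma mean_value s : expR s < r -> intg (Q s) 0 T = complex.Re (f e) * T.
Proof.
move=> sr; have r0 : 0 < r by apply: lt_trans sr; exact: expR_gt0.
apply/eqP; rewrite -subr_eq0 -normr_eq0; apply/negPn/negP => N.
have {}N : 0 < `|intg (Q s) 0 T - complex.Re (f e) * T|.
  by rewrite lt_neqAle eq_sym N normr_ge0.
set k := `|_| in N; pose d := k / (T *+ 2).
have d0 : 0 < d by rewrite divr_gt0 // mulrn_wgt0.
have cf : {for e, continuous f}.
  by apply: differentiable_continuous; apply: df; rewrite subrr cabs0.
have /cvgrPdist_lt /(_ d%:C) := cf; rewrite ltcR => /(_ d0) /nbhs_cabs [q q0 H].
pose s0 := Num.min s (ln (q / 2)).
have q2 : 0 < q / 2 by rewrite divr_gt0.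
have s0s : s0 <= s by rewrite ge_min lexx.
have es0 : expR s0 < q.
  apply: le_lt_trans (_ : expR (ln (q / 2)) < q).
    by rewrite ler_expR ge_min lexx orbT.
  by rewrite lnK ?posrE //; lra.
have s0r : expR s0 < r by apply: le_lt_trans sr; rewrite ler_expR.
have : `|intg (fun t => Q s0 t - complex.Re (f e)) 0 T| <= d * (T - 0).
  apply: intg_norm; first exact: ltW.
    move=> t tT; apply: continuousB; first exact: circle_cont.
    exact: cst_continuous.
  move=> t _; apply: ltW; have /H : cabs (e + cexp (s0 +i* t) - e) < q.
    by rewrite addrC addKr cabs_cexp.
  rewrite cabsE ltcR; apply: le_lt_trans; rewrite distrC /Q.
  have -> : complex.Re (f e) - complex.Re (f (e + cexp (s0 +i* t))) =
    complex.Re (f e - f (e + cexp (s0 +i* t))).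
    by case: (f e) => ? ?; case: (f _) => ? ?.
  exact: Re_cabs.
rewrite intgB; [|exact: circle_cont|by move=> ? _; exact: cst_continuous].
rewrite (intg_cst _ (ltW T0)) subr0 (circle_intg_const s0s sr) -/k.
rewrite /d leNgt => /negP; apply.
have TT : T *+ 2 = T * 2 by rewrite mulr_natr.
rewrite TT invfM mulrA -mulrA [_^-1 * T]mulrC mulrA mulfVK ?gt_eqF //.
lra.
Qed.

Lemma mean_value_le s k : expR s < r -> (forall t, Q s t <= k) ->
  complex.Re (f e) <= k.
Proof.
move=> sr H; have M := mean_value sr.
rewrite -(ler_pM2r T0) -M -[T in leRHS]subr0 -(intg_cst k (ltW T0)).
rewrite -subr_ge0 -intgB; first by apply: intg_ge0 => t _; rewrite subr_ge0.
  by move=> ? _; exact: cst_continuous.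
exact: circle_cont.
Qed.

End MeanValue.

Section MaximumPrinciple.
Variable R : realType.
Local Notation C := R[i].
Implicit Types (f : C^o -> C^o) (w : C^o).

Lemma complex_pair_continuous (p : R * R) :
  {for p, continuous (fun p : R * R => (p.1 +i* p.2 : C^o))}.
Proof.
move=> A /= /nbhs_cabs [r r0 H].
have r2 : 0 < r / 2 by rewrite divr_gt0.
apply/nbhs_ballP; exists (r / 2) => //= -[x y] [/= bx by_].
apply: H; apply: le_lt_trans (cabs_ReIm _) _ => /=.
move: bx by_; rewrite /ball /= distrC [X in _ -> X < _ -> _]distrC; lra.
Qed.

Lemma cabs_continuous : continuous (@cabs R : C^o -> R).
Proof.
move=> z A /= /nbhs_ballP [e /= e0 H]; apply/nbhs_cabs; exists e => // w wz.
apply: H; apply: le_lt_trans wz; have := cabsD (z - w) w; have := cabsD (w - z) z.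
by rewrite !subrK [cabs (z - w)]cabsB ler_norml => ? ?; apply/andP; split; lra.
Qed.

Definition in_rect (x0 x1 y0 y1 : R) (w : C) :=
  (x0 <= complex.Re w <= x1) && (y0 <= complex.Im w <= y1).

Lemma rect_max x0 x1 y0 y1 (phi : C^o -> R) : x0 <= x1 -> y0 <= y1 ->
  (forall w, in_rect x0 x1 y0 y1 w -> {for w, continuous phi}) ->
  exists2 c, in_rect x0 x1 y0 y1 c &
    forall w, in_rect x0 x1 y0 y1 w -> phi w <= phi c.
Proof.
move=> x01 y01 H.
pose A := (`[x0, x1] `*` `[y0, y1])%classic : set (R * R).
have A0 : A !=set0 by exists (x0, y0); split; rewrite /= in_itv /= lexx ?x01 ?y01.
have cA : compact A by apply: compact_setX; exact: segment_compact.
have [|c] := @compact_EVT_max _ _ (fun p : R * R => phi (p.1 +i* p.2)) A A0 cA.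
  apply: continuous_in_subspaceT => p; rewrite inE => -[/=].
  rewrite !in_itv /= => p1 p2.
  apply: (@continuous_comp _ _ _ (fun p : R * R => (p.1 +i* p.2 : C^o)) phi).
    exact: complex_pair_continuous.
  by apply: H; rewrite /in_rect /= p1 p2.
rewrite inE => -[/=]; rewrite !in_itv /= => c1 c2 cM.
exists (c.1 +i* c.2); first by rewrite /in_rect /= c1 c2.
move=> [x y] /andP[/= wx wy]; apply: (cM (x, y)).
by rewrite inE; split; rewrite /= in_itv.
Qed.

Lemma cabs_sqrD (u v : C) :
  cabs (u + v) ^+ 2 = cabs u ^+ 2 + cabs v ^+ 2 +
    complex.Re (2%:R * conjc u * v).
Proof.
rewrite -mulrA mulr_natl mulr2n !cabs_sqr; case: u v => [a b] [c d] /=; ring.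
Qed.

(** The phase [u] turns the modulus at one point into a real part, to
    which [mean_value_le] applies. *)
Lemma unimodular (z : C) : exists2 u : C, cabs u = 1 & u * z = (cabs z)%:C.
Proof.
have [->|z0] := eqVneq z 0; first by exists 1; rewrite ?cabs1 // mul1r cabs0.
have c0 : cabs z != 0 by rewrite cabs_eq0.
exists (z^-1 * (cabs z)%:C); last by rewrite mulrAC mulVf // mul1r.
by rewrite cabsM cabsV cabs_real ger0_norm ?cabs_ge0 // mulVf.
Qed.

Lemma ReImB (w p : C) : complex.Re (w - p) = complex.Re w - complex.Re p /\
  complex.Im (w - p) = complex.Im w - complex.Im p.
Proof. by case: w p => ? ? []. Qed.

(** Adding [k |w|^2] to [|f|] makes the mean over a small circle about an
    interior point exceed the value at that point by [k] times the square of
    the radius, so the perturbed function has its maximum on the boundary; then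
    [k] tends to [0]. *)
Lemma max_principle x0 x1 y0 y1 f (m : R) :
  (forall w, in_rect x0 x1 y0 y1 w -> differentiable f w) ->
  (forall w, in_rect x0 x1 y0 y1 w ->
    ~~ ((x0 < complex.Re w < x1) && (y0 < complex.Im w < y1)) ->
    cabs (f w) <= m) ->
  forall w, in_rect x0 x1 y0 y1 w -> cabs (f w) <= m.
Proof.
move=> df bd z zr.
have /andP[/andP[zx0 zx1] /andP[zy0 zy1]] := zr.
have x01 := le_trans zx0 zx1; have y01 := le_trans zy0 zy1.
have [b _ bM] := @rect_max x0 x1 y0 y1 (@cabs R) x01 y01
  (fun w _ => @cabs_continuous w).
apply/ler_addgt0Pr => d d0.
have B0 : 0 < 1 + cabs b ^+ 2 by rewrite ltr_wpDr // sqr_ge0.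
(* With this [k] the perturbation is at most [d] on the rectangle. *)
pose k := d / (1 + cabs b ^+ 2).
have k0 : 0 < k by rewrite divr_gt0.
pose phi (w : C^o) := cabs (f w) + k * cabs w ^+ 2.
have cphi w : in_rect x0 x1 y0 y1 w -> {for w, continuous phi}.
  move=> wr; apply: continuousD.
    apply: (@continuous_comp _ _ _ f (@cabs R)); last exact: cabs_continuous.
    exact/differentiable_continuous/df.
  apply: continuousM; first exact: cst_continuous.
  apply: (@continuous_comp _ _ _ (@cabs R : C^o -> R) (fun u : R => u ^+ 2)).
    exact: cabs_continuous.
  exact: exprn_continuous.
have [e er eM] := rect_max x01 y01 cphi.
have le1 : cabs (f z) <= phi e.
  by apply: le_trans (eM z zr); rewrite lerDl mulr_ge0 ?sqr_ge0 ?ltW.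
apply: le_trans le1 _.
have [eint|eb] := boolP ((x0 < complex.Re e < x1) && (y0 < complex.Im e < y1));
  last first.
  rewrite /phi lerD ?bd // /k mulrAC ler_pdivrMr // ler_pM2l //.
  have : cabs e ^+ 2 <= cabs b ^+ 2 by rewrite ler_sqr ?nnegrE ?cabs_ge0 ?bM.
  lra.
exfalso; have /andP[/andP[e1 e2] /andP[e3 e4]] := eint.
pose r := Num.min (Num.min (complex.Re e - x0) (x1 - complex.Re e))
   (Num.min (complex.Im e - y0) (y1 - complex.Im e)).
have r0 : 0 < r by rewrite /r !lt_min !subr_gt0 e1 e2 e3 e4.
have inr w : cabs (w - e) < r -> in_rect x0 x1 y0 y1 w.
  rewrite /r !lt_min => /andP[/andP[h1 h2] /andP[h3 h4]].
  have := Re_cabs (w - e); have := Im_cabs (w - e).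
  have [-> ->] := ReImB w e; rewrite !ler_norml => /andP[? ?] /andP[? ?].
  by rewrite /in_rect; apply/andP; split; apply/andP; split; lra.
have [u u1 uE] := unimodular (f e).
(* On the circle of radius [r / 2] about [e], [Re (G w)] plus a constant
   is a lower bound for [phi w]: the linear term of [k |w|^2] is harmonic. *)
pose G (w : C^o) : C^o := u * f w + (k%:C * (2 * conjc e)) * (w - e).
have dG w : cabs (w - e) < r -> differentiable G w.
  move=> wr; apply: differentiableD.
    apply: (@differentiableM _ _ (fun=> u) f); first exact: differentiable_cst.
    exact/df/inr.
  apply: (@differentiableM _ _ (fun=> k%:C * (2 * conjc e)) (fun w => w - e)).
    exact: differentiable_cst.
  by apply: differentiableB => //; exact: differentiable_cst.
have r2 : 0 < r / 2 by rewrite divr_gt0.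
have er2 : expR (ln (r / 2)) < r by rewrite lnK ?posrE //; lra.
have := @mean_value_le _ G e r dG (ln (r / 2))
  (cabs (f e) - k * (r / 2) ^+ 2) er2.
have -> : complex.Re (G e) = cabs (f e) by rewrite /G subrr mulr0 addr0 uE.
suff H t : complex.Re (G (e + cexp (ln (r / 2) +i* t))) <=
   cabs (f e) - k * (r / 2) ^+ 2.
  move=> /(_ H); have : 0 < k * (r / 2) ^+ 2 by rewrite mulr_gt0 // exprn_gt0.
  lra.
set v := cexp _; have v1 : cabs v = r / 2 by rewrite cabs_cexp /= lnK ?posrE.
have /inr wr : cabs (e + v - e) < r by rewrite addrC addKr v1; lra.
have := eM _ wr; rewrite /phi cabs_sqrD v1.
have -> : G (e + v) = u * f (e + v) + k%:C * (2 * conjc e * v).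
  by rewrite /G; ring.
have ReD (p q : C) : complex.Re (p + q) = complex.Re p + complex.Re q.
  by case: p q => ? ? [].
have ReZ (p : R) (q : C) : complex.Re (p%:C * q) = p * complex.Re q.
  by case: q => ? ? /=; rewrite mul0r subr0.
rewrite ReD ReZ.
have := Re_cabs (u * f (e + v)); rewrite cabsM u1 mul1r ler_norml => /andP[_].
lra.
Qed.

(** If [f] vanishes near [a] then [f w / (w - a)^n] is differentiable also
    at [a].  On the square of half side [r] about [a] the maximum principle
    bounds [|f z|] by a constant times [(|z - a| / r)^n], for every [n]. *)
Theorem identity_disc f (a : C^o) (r : R) :
  (forall w, cabs (w - a) < 2 * r -> differentiable f w) ->
  (\forall w \near a, f w = 0) ->
  forall w, cabs (w - a) < r -> f w = 0.
Proof.
move=> df /nbhs_cabs [q q0 fq] z zr.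
have r0 : 0 < r by apply: le_lt_trans zr; exact: cabs_ge0.
have dfr w : cabs (w - a) < 2 * r -> differentiable f w by exact: df.
pose x0 := complex.Re a - r; pose x1 := complex.Re a + r.
pose y0 := complex.Im a - r; pose y1 := complex.Im a + r.
have inr w : in_rect x0 x1 y0 y1 w -> cabs (w - a) < 2 * r.
  rewrite /in_rect /x0 /x1 /y0 /y1 => /andP[/andP[? ?] /andP[? ?]].
  rewrite -ltr_sqr ?nnegrE ?cabs_ge0 ?mulr_ge0 ?(ltW r0) // cabs_sqr.
  have [-> ->] := ReImB w a.
  have h1 : (complex.Re w - complex.Re a) ^+ 2 <= r ^+ 2.
    rewrite -real_normK ?num_real // ler_sqr ?nnegrE ?(ltW r0) //.
    by rewrite ler_norml; apply/andP; split; lra.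
  have h2 : (complex.Im w - complex.Im a) ^+ 2 <= r ^+ 2.
    rewrite -real_normK ?num_real // ler_sqr ?nnegrE ?(ltW r0) //.
    by rewrite ler_norml; apply/andP; split; lra.
  have : 0 < r ^+ 2 by rewrite exprn_gt0.
  have -> : (2 * r) ^+ 2 = 4 * r ^+ 2 by ring.
  lra.
have rin w : cabs (w - a) <= r -> in_rect x0 x1 y0 y1 w.
  move=> wr; have := Re_cabs (w - a); have := Im_cabs (w - a).
  have [-> ->] := ReImB w a; rewrite !ler_norml => /andP[? ?] /andP[? ?].
  rewrite /in_rect /x0 /x1 /y0 /y1.
  by apply/andP; split; apply/andP; split; lra.
have x01 : x0 <= x1 by rewrite /x0 /x1; lra.
have y01 : y0 <= y1 by rewrite /y0 /y1; lra.
have [c cr cM] := @rect_max x0 x1 y0 y1 (fun w => cabs (f w)) x01 y01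
  (fun w wr => continuous_comp (differentiable_continuous (dfr w (inr w wr)))
     (@cabs_continuous (f w))).
set M := cabs (f c) in cM.
have M0 : 0 <= M by exact: cabs_ge0.
have fa : f a = 0 by apply: fq; rewrite subrr cabs0.
have bound n : cabs (f z) <= M * (cabs (z - a) / r) ^+ n.
  have [->|za] := eqVneq z a.
    by rewrite fa cabs0 mulr_ge0 // exprn_ge0 // divr_ge0 ?cabs_ge0 // ltW.
  pose g (w : C^o) : C^o := f w * ((w - a) ^+ n)^-1.
  have dg w : in_rect x0 x1 y0 y1 w -> differentiable g w.
    move=> wr; have [wa|wa] := eqVneq w a.
      apply/cdiffP; exists 0 => e e0; exists q => // t; rewrite wa => tq.
      rewrite /g (fq t tq) fa !mul0r mulr0 !subr0 cabs0.
      by rewrite mulr_ge0 ?cabs_ge0 // ltW.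
    apply: (@differentiableM _ _ f (fun w => ((w - a) ^+ n)^-1)).
      exact/dfr/inr.
    apply: differentiableV; last by rewrite expf_neq0 // subr_eq0.
    apply: (@differentiable_exp _ _ (fun w => w - a)).
    by apply: differentiableB => //; exact: differentiable_cst.
  have bg w : in_rect x0 x1 y0 y1 w ->
      ~~ ((x0 < complex.Re w < x1) && (y0 < complex.Im w < y1)) ->
      cabs (g w) <= M / r ^+ n.
    move=> wr wb; have rw : r <= cabs (w - a).
      rewrite leNgt; apply: contra wb => wr'.
      have := Re_cabs (w - a); have := Im_cabs (w - a).
      have [-> ->] := ReImB w a; rewrite !ler_norml => /andP[? ?] /andP[? ?].
      by rewrite /x0 /x1 /y0 /y1; apply/andP; split; apply/andP; split; lra.
    rewrite /g cabsM cabsV cabsX ler_pM ?cabs_ge0 ?cM //.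
      by rewrite invr_ge0 exprn_ge0 // cabs_ge0.
    rewrite lef_pV2 ?posrE ?exprn_gt0 //; last exact: lt_le_trans rw.
    by rewrite lerXn2r ?nnegrE ?cabs_ge0 // ltW.
  have := max_principle dg bg (rin z (ltW zr)).
  rewrite /g cabsM cabsV cabsX ler_pdivrMr; last first.
    by rewrite exprn_gt0 // cabs_gt0 subr_eq0.
  by rewrite expr_div_n -mulrA [_^-1 * _]mulrC.
apply/eqP; rewrite -cabs_eq0; apply/eqP/le_anti; rewrite cabs_ge0 andbT.
set t := cabs (z - a) / r in bound.
have t1 : `|t| < 1.
  by rewrite ger0_norm ?divr_ge0 ?cabs_ge0 ?ltW // ltr_pdivrMr // mul1r.
have L : (fun n => M * t ^+ n) @ \oo --> M * 0.
  by apply: cvgM; [exact: cvg_cst|exact: cvg_expr].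
rewrite mulr0 in L.
apply: (ler_cvg_to (cvg_cst (cabs (f z))) L).
by near=> n; exact: bound.
Unshelve. all: by end_near. Qed.

End MaximumPrinciple.

(** * Germs of holomorphic functions and meromorphic continuation *)

Section Germs.
Variables (R : realType) (V : normedModType R[i]).
Local Notation C := R[i].
Implicit Types (h g : V -> C^o) (p q v : V).

(** The norm of [V] as a real number, as for [cabs]. *)
Definition vabs (v : V) : R := complex.Re `|v|.

Lemma vabsE v : `|v| = (vabs v)%:C.
Proof.
rewrite /vabs [LHS]complexE; have /ger0_Im -> : 0 <= `|v| by [].
by rewrite mulr0 addr0.
Qed.

Lemma vabs_ge0 v : 0 <= vabs v.
Proof. by rewrite -lecR -vabsE; exact: normr_ge0. Qed.

Lemma vabsD u v : vabs (u + v) <= vabs u + vabs v.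
Proof. by rewrite -lecR rmorphD /= -!vabsE ler_normD. Qed.

Lemma vabsB u v : vabs (u - v) = vabs (v - u).
Proof. by rewrite /vabs distrC. Qed.

Lemma vabsZ (c : C) v : vabs (c *: v) = cabs c * vabs v.
Proof. by apply: complexI; rewrite rmorphM /= -cabsE -!vabsE normrZ. Qed.

Lemma nbhs_vabs p (A : set V) :
  nbhs p A <-> exists2 r : R, 0 < r & forall w, vabs (w - p) < r -> A w.
Proof.
split.
  move=> /nbhs_ballP [[a b] /= ab H].
  move: ab; rewrite ltcE /= => /andP[/eqP b0 a0].
  exists a => // w wz; apply: H.
  rewrite -ball_normE /ball_ /= distrC vabsE ltcE /= wz.
  by rewrite b0 eqxx.
move=> [r r0 H]; apply/nbhs_ballP; exists r%:C; first by rewrite /= ltcR.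
by move=> w; rewrite -ball_normE /ball_ /= distrC vabsE ltcR => /H.
Qed.

Lemma differentiable_line p v (t : C^o) :
  differentiable (fun t : C^o => p + t *: v : V) t.
Proof.
apply: differentiableD; first exact: differentiable_cst.
exact: (@differentiableZl _ _ _ (fun t : C^o => t : C^o)).
Qed.

Lemma line_near p v (A : set V) : nbhs p A ->
  \forall t \near (0 : C^o), A (p + t *: v).
Proof.
move=> /nbhs_vabs [r r0 H]; have k0 : 0 < 1 + vabs v.
  by rewrite ltr_wpDr // vabs_ge0.
apply/nbhs_cabs; exists (r / (1 + vabs v)); first by rewrite divr_gt0.
move=> t; rewrite subr0 ltr_pdivlMr // => tr; apply: H.
rewrite addrC addKr vabsZ; apply: le_lt_trans tr.
by rewrite ler_wpM2l ?cabs_ge0 // lerDr.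
Qed.

(** The identity theorem on the complex line through [q] in the
    direction [v]. *)
Lemma line_identity h q v :
  (forall t : C, cabs t < 4 -> differentiable h (q + t *: v)) ->
  (\forall t \near (0 : C^o), h (q + t *: v) = 0) -> h (q + v) = 0.
Proof.
move=> dh h0; rewrite -[v]scale1r.
apply: (@identity_disc _ (fun t : C^o => h (q + t *: v)) 0 2 _ h0 1).
  move=> t; rewrite subr0 => tr.
  apply: (@differentiable_comp _ _ _ _ (fun t : C^o => q + t *: v : V) h).
    exact: differentiable_line.
  by apply: dh; apply: lt_le_trans tr _; rewrite -natrM.
by rewrite subr0 cabs1 ltr1n.
Qed.

(** Closed under complex affine combinations: what is needed for the
    identity theorem to propagate along complex lines within [S]. *)
Definition flat (S : set V) := forall p q (t : C),
  S p -> S q -> S (p + t *: (q - p)).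

Lemma flatT : flat [set: V]. Proof. by []. Qed.

Variable S : set V.
Hypothesis flatS : flat S.

(** A function vanishing on [S] near one point of a small ball vanishes on
    the part of [S] in that ball: join the two points by a complex line, on
    which the larger ball leaves room for [line_identity]. *)
Lemma ball_identity h p (r : R) : 0 < r ->
  (forall w, vabs (w - p) < 16 * r -> differentiable h w) ->
  forall q, vabs (q - p) < r -> S q -> (\forall z \near q, S z -> h z = 0) ->
  forall q', vabs (q' - p) < r -> S q' -> h q' = 0.
Proof.
move=> r0 dh q qr Sq hq q' q'r Sq'.
have -> : q' = q + (q' - q) by rewrite addrC subrK.
have v2 : vabs (q' - q) < 2 * r.
  have -> : q' - q = (q' - p) + (p - q) by rewrite addrA subrK.
  by apply: le_lt_trans (vabsD _ _) _; rewrite [vabs (p - q)]vabsB; lra.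
apply: line_identity.
  move=> t t4; apply: dh; rewrite addrAC; apply: le_lt_trans (vabsD _ _) _.
  rewrite vabsZ; have : cabs t * vabs (q' - q) <= 4 * (vabs (q' - q)).
    by rewrite ler_wpM2r ?vabs_ge0 // ltW.
  have := vabs_ge0 (q' - q); lra.
apply: filterS (line_near (q' - q) hq) => t; apply.
exact: flatS.
Qed.

Lemma entire_dense h z : entire h -> S z -> h z != 0 ->
  forall q, S q -> ~ (\forall z \near q, S z -> h z = 0).
Proof.
move=> eh Sz hz q Sq hq; move/eqP: hz; apply.
have -> : z = q + (z - q) by rewrite addrC subrK.
apply: line_identity; first by move=> t _; exact: eh.
apply: filterS (line_near (z - q) hq) => t; apply; exact: flatS.
Qed.

Lemma holomorphic_ball h p : holomorphic_at h p ->
  exists2 r, 0 < r & forall w, vabs (w - p) < 16 * r -> differentiable h w.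
Proof.
move=> /nbhs_vabs [r r0 H]; exists (r / 16); first by rewrite divr_gt0.
by move=> w wr; apply: H; lra.
Qed.

(** Vanishing on [S] near a point close to [p] would propagate to [p]. *)
Lemma nonzero_germ_dense h p : nonzero_germ S h p ->
  \forall q \near p, S q -> ~ (\forall z \near q, S z -> h z = 0).
Proof.
move=> [/holomorphic_ball [r r0 H] nz]; apply/nbhs_vabs; exists r => // q qr Sq hq.
apply: nz; apply/nbhs_vabs; exists r => // z zr Sz.
exact: (ball_identity r0 H qr Sq hq).
Qed.

Lemma near_neq0 (h : V -> C^o) q : {for q, continuous h} -> h q != 0 ->
  \forall z \near q, h z != 0.
Proof.
move=> ch hq; have : nbhs (h q) [set y : C^o | y != 0].
  apply/nbhs_cabs; exists (cabs (h q)); first by rewrite cabs_gt0.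
  move=> w; apply: contraTneq => ->; rewrite sub0r cabsN -leNgt //.
by move=> /ch.
Qed.

Lemma nonzero_near h q (P : V -> Prop) :
  ~ (\forall z \near q, S z -> h z = 0) -> (\forall z \near q, P z) ->
  exists z, [/\ S z, P z & h z != 0].
Proof.
move=> N HP; apply: contrapT => /forallNP nz; apply: N.
apply: filterS HP => z Pz Sz; apply/eqP/negPn/negP => hz.
exact: (nz z).
Qed.

Lemma near_vabs p q (r : R) : vabs (q - p) < r ->
  \forall w \near q, vabs (w - p) < r.
Proof.
move=> qr; apply/nbhs_vabs; exists (r - vabs (q - p)); first by rewrite subr_gt0.
move=> w wr; have -> : w - p = (w - q) + (q - p) by rewrite addrA subrK.
by apply: le_lt_trans (vabsD _ _) _; rewrite -ltrBrDr.
Qed.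

(** Where [h] does not vanish, [f = g / h]; the function [g - h G] is
    continuous and vanishes on a dense subset, hence [f = G] there.  The values
    of [f] elsewhere are those of the continuation, by the second clause of
    [meromorphic]. *)
Lemma meromorphic_eq (f G : V -> C^o) p : S p -> meromorphic S f ->
  holomorphic_at G p ->
  (\forall q \near p, S q -> forall U, nbhs q U ->
     exists z, [/\ S z, U z & f z = G z]) ->
  f p = G p.
Proof.
move=> Sp mf hG dense; have [[g [h [hg hh fgh]]] uniq] := mf p Sp.
apply: (uniq G h) => //.
have hhol : holomorphic_at h p by case: hh.
near=> z => Sz hz.
have fz : f z = g z / h z by move: Sz hz; near: z.
suff phi0 : g z - h z * G z = 0.
  by rewrite fz; move/eqP: phi0; rewrite subr_eq0 => /eqP ->; rewrite mulrC mulKf.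
apply/eqP/negPn/negP => phiz.
have dg : differentiable g z by near: z.
have dh : differentiable h z by near: z.
have dG : differentiable G z by near: z.
have dphi : differentiable (fun z => g z - h z * G z : C^o) z.
  by apply: differentiableB => //; apply: differentiableM.
have n1 := near_neq0 (differentiable_continuous dphi) phiz.
have n2 := near_neq0 (differentiable_continuous dh) hz.
have n3 : \forall y \near z, S y -> h y != 0 -> f y = g y / h y.
  by near: z; apply: near_join.
have dz : S z -> forall U, nbhs z U -> exists z', [/\ S z', U z' & f z' = G z'].
  by near: z.
have [y [Sy /= [[y1 y2] y3] fy]] := dz Sz _ (filterI (filterI n1 n2) n3).
by move: y1; rewrite -fy y3 // mulrC mulfVK // subrr eqxx.
Unshelve. all: by end_near. Qed.

End Germs.

Section MeromorphicContinuation.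
Variable R : realType.
Local Notation C := R[i].

(** The plane is connected, because every real segment is. *)
Lemma complex_clopen (A : set C^o) : open A -> closed A -> A !=set0 -> A = setT.
Proof.
move=> oA cA [x0 Ax0]; apply/seteqP; split => // x _.
pose path (t : R) : C^o := x0 + t%:C * (x - x0).
have cpath : continuous path.
  move=> t U /nbhs_cabs [r r0 H]; have k0 : 0 < 1 + cabs (x - x0).
    by rewrite ltr_wpDr // cabs_ge0.
  apply/nbhs_ballP; exists (r / (1 + cabs (x - x0))); first by rewrite /= divr_gt0.
  move=> s; rewrite /ball /= distrC ltr_pdivlMr // => sr; apply: H.
  have -> : path s - path t = (s - t)%:C * (x - x0).
    by rewrite /path rmorphB /=; ring.
  rewrite cabsM cabs_real; apply: le_lt_trans sr.
  by rewrite ler_wpM2l // lerDr.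
have cT : connected [set: R] by apply/connected_intervalP.
have E : path @^-1` A = setT.
  apply: cT.
  - by exists 0; rewrite /= /path mul0r addr0.
  - exists (path @^-1` A); last by rewrite setTI.
    by apply: open_comp => // *; exact: cpath.
  - exists (path @^-1` A); last by rewrite setTI.
    by apply: closed_comp => // *; exact: cpath.
have : (path @^-1` A) 1 by rewrite E.
by rewrite /= /path mul1r addrC subrK.
Qed.

(** The set of points having open sets of solutions of [F z * D z = H z]
    arbitrarily close to them is closed, and it is open since near each point
    [F] is a quotient [g / h] to which [ball_identity] applies.  Multiplying by
    [D] avoids the connectedness of the complement of its zeros. *)
Lemma meromorphic_quotient (F D H : C^o -> C^o) (x0 : C^o) :
  meromorphic setT F -> entire D -> entire H ->
  (\forall z \near x0, F z * D z = H z) ->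
  forall x, D x != 0 -> F x = H x / D x.
Proof.
move=> mF eD eH near0.
pose A : set C^o := [set p | forall U, nbhs p U ->
  exists2 q, U q & \forall z \near q, F z * D z = H z].
have ST : A = setT.
  apply: complex_clopen.
  - rewrite openE => p Ap.
    have [[g [h [hg hh fgh]]] _] := mF p I.
    have hhol : holomorphic_at h p by case: hh.
    pose phi (z : C^o) : C^o := g z * D z - h z * H z.
    have hphi : holomorphic_at phi p.
      near=> z; apply: differentiableB.
        by apply: differentiable_mul; [near: z|exact: eD].
      by apply: differentiable_mul; [near: z|exact: eH].
    have [r r0 dphi] := holomorphic_ball hphi.
    have hd := nonzero_germ_dense (@flatT _ _) hh.
    have [q qU qE] := Ap _ (filterI (filterI hd (near_join fgh))
       (filterI (near_join hhol) ((nbhs_vabs p [set w | vabs (w - p) < r]).2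
         (ex_intro2 _ _ r r0 (fun w => id))))).
    case: qU => -[/= q1 q2] [q3 q4].
    have [z1 [_ [[[z1f z1E] z1d] z1r] z1h]] := nonzero_near (q1 I)
      (filterI (filterI (filterI (near_join q2) (near_join qE)) q3)
         (near_vabs q4)).
    have phi0 w : vabs (w - p) < r -> phi w = 0.
      move=> wr; apply: (ball_identity (@flatT _ _) r0 dphi z1r) => //.
      have n := near_neq0 (differentiable_continuous z1d) z1h.
      apply: filterS (filterI (filterI z1f z1E) n) => z [[zf zE] hz] _.
      by rewrite /phi -zE zf // mulrA [h z * _]mulrC mulfVK // subrr.
    have pr : \forall w \near p, vabs (w - p) < r.
      by apply/nbhs_vabs; exists r.
    apply: filterS (filterI (filterI hd (near_join fgh))
      (filterI (near_join hhol) pr)) => q' [[/(_ I) q'1 q'2] [q'3 q'4]] U qU.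
    have [z2 [_ [[[z2f z2U] z2d] z2r] z2h]] := nonzero_near q'1
      (filterI (filterI (filterI (near_join q'2) qU) q'3) (near_vabs q'4)).
    exists z2; first exact: z2U.
    have n := near_neq0 (differentiable_continuous z2d) z2h.
    apply: filterS (filterI (filterI z2f n) (near_vabs z2r)) => z [[zf hz] zr].
    have gE : g z * D z = h z * H z by apply/eqP; rewrite -subr_eq0 -/(phi z) phi0.
    by rewrite zf // mulrAC gE mulrAC mulfV // mul1r.
  - move=> p pA U /near_join pU; have [a [Aa aU]] := pA _ pU.
    exact: Aa.
  - by exists x0 => U xU; exists x0 => //; exact: nbhs_singleton.
move=> x Dx.
apply: (@meromorphic_eq _ _ setT F (fun x => H x / D x) x) => //.
  have := near_neq0 (differentiable_continuous (eD x)) Dx => n.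
  near=> z; apply: differentiableM; first exact: eH.
  by apply: differentiableV; [exact: eD|near: z].
near=> q => _ U qU.
have Dq : D q != 0.
  by near: q; exact: (near_neq0 (differentiable_continuous (eD x)) Dx).
have n := near_neq0 (differentiable_continuous (eD q)) Dq.
have : A q by rewrite ST.
move=> /(_ _ (filterI qU n)) [z [Uz Dz] zE]; exists z; split => //.
by rewrite -(nbhs_singleton zE) mulfK.
Unshelve. all: by end_near. Qed.

End MeromorphicContinuation.

(** * Density of generic parameters *)

Section GenericDensity.
Variables (R : realType) (n M : nat).
Local Notation C := R[i].
Local Notation V := ((C^o * 'rV[C]_n.+1)%type : normedModType C).
Local Notation W := 'M[R]_(2, n.+1).
Let S := [set p : V | weights M p.2].

(** The constraint on the sum of the weights is affine. *)
Lemma weights_flat : flat S.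
Proof.
move=> p q t; rewrite /S /weights /= => Sp Sq.
under eq_bigr do rewrite !mxE.
by rewrite big_split /= -mulr_sumr big_split /= sumrN Sp Sq subrr mulr0 addr0.
Qed.

Lemma nbhs_coord (p : V) (A : set V) :
  nbhs p A <-> exists2 r : R, 0 < r & forall w : V, cabs (w.1 - p.1) < r ->
    (forall j, cabs (w.2 0 j - p.2 0 j) < r) -> A w.
Proof.
split.
  move=> /nbhs_ballP [[a b] /= ab H].
  move: ab; rewrite ltcE /= => /andP[/eqP b0 a0].
  rewrite b0 in H; exists a => // w w1 w2; apply: H; split=> /=.
    by rewrite /ball /= distrC cabsE ltcR.
  split=> [|i j]; first by rewrite ltcR.
  by rewrite ord1 /ball /= distrC cabsE ltcR.
move=> [r r0 H]; apply/nbhs_ballP; exists r%:C; first by rewrite /= ltcR.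
move=> w [/= w1 [_ w2]]; apply: H.
  by move: w1; rewrite /ball /= distrC cabsE ltcR.
by move=> j; have := w2 0 j; rewrite /ball /= distrC cabsE ltcR.
Qed.

Lemma nbhs_real_mx (u : W) (A : set W) :
  nbhs u A <-> exists2 r : R, 0 < r &
    forall w : W, (forall i j, `|w i j - u i j| < r) -> A w.
Proof.
split.
  move=> /nbhs_ballP [r /= r0 H]; exists r => // w wr; apply: H; split=> // i j.
  by rewrite /ball /= distrC.
move=> [r r0 H]; apply/nbhs_ballP; exists r => // w [_ wr]; apply: H => i j.
by have := wr i j; rewrite /ball /= distrC.
Qed.

Let entry (u : W) j : C := u 0 j +i* u 1 j.

(** Real coordinates, which make the affine space of parameters a complete
    real vector space, as needed for Baire's theorem; the weight of index [0] is
    determined by the others. *)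
Let chart (u : W) : V :=
  (entry u ord0,
   \row_j if unlift ord0 j is Some j' then entry u (fintype.lift ord0 j')
     else M.*2%:R - \sum_(j' < n) entry u (fintype.lift ord0 j')).

Let coord (p : V) : W := \matrix_(i, j)
  let z := if unlift ord0 j is Some j' then p.2 0 (fintype.lift ord0 j') else p.1 in
  if i == 0 then complex.Re z else complex.Im z.

Let entry_coord (p : V) j : entry (coord p) j =
  if unlift ord0 j is Some j' then p.2 0 (fintype.lift ord0 j') else p.1.
Proof.
rewrite /entry !mxE /=.
by case: (unlift _ _) => [j'|]; [case: (p.2 _ _)|case: p.1].
Qed.

Let chartK p : S p -> chart (coord p) = p.
Proof.
case: p => x L; rewrite /S /weights /= big_ord_recl => SL; congr pair.
  by rewrite entry_coord unlift_none.
apply/rowP => j; rewrite mxE; case: unliftP => [j' ->|->].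
  by rewrite entry_coord liftK.
under eq_bigr do rewrite entry_coord liftK /=.
by rewrite -SL addrK.
Qed.

Let coordK u : coord (chart u) = u.
Proof.
apply/matrixP => i j; rewrite mxE.
have -> : (if unlift ord0 j is Some j' then (chart u).2 0 (fintype.lift ord0 j')
    else (chart u).1) = entry u j.
  by case: unliftP => [j' ->|->] //; rewrite mxE liftK.
case: (i =P 0) => [->//|/eqP i0] /=; congr (u _ _).
by apply/val_inj; case: i i0 => [[|[|]]].
Qed.

Let chart_S u : S (chart u).
Proof.
rewrite /S /weights /chart /= big_ord_recl mxE unlift_none.
rewrite -[RHS](subrK (\sum_(j' < n) entry u (fintype.lift ord0 j'))).
by congr (_ + _); apply: eq_bigr => i _; rewrite mxE liftK.
Qed.

Let entry_near (u w : W) (r : R) j : (forall i j, `|w i j - u i j| < r) ->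
  cabs (entry w j - entry u j) < 2 * r.
Proof.
move=> H; apply: le_lt_trans (cabs_ReIm _) _ => /=.
have := H 0 j; have := H 1 j; lra.
Qed.

Let chart_continuous : continuous chart.
Proof.
move=> u A /= /nbhs_coord [r r0 H].
have k0 : 0 < 2 * n.+1%:R :> R by rewrite mulr_gt0.
apply/nbhs_real_mx; exists (r / (2 * n.+1%:R)); first by rewrite divr_gt0.
move=> w wr.
have d j : cabs (entry w j - entry u j) < r / n.+1%:R.
  have := entry_near j wr; congr (_ < _).
  by field; rewrite addrC natr1 pnatr_eq0.
have rn : r / n.+1%:R <= r.
  by rewrite ler_pdivrMr // ler_peMr ?ler1n ?(ltW r0).
apply: H => [|j]; first exact: lt_le_trans (d _) rn.
rewrite !mxE; case: unliftP => [j' _|_]; first exact: lt_le_trans (d _) rn.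
have -> : M.*2%:R - \sum_(j' < n) entry w (fintype.lift ord0 j') -
    (M.*2%:R - \sum_(j' < n) entry u (fintype.lift ord0 j')) =
    \sum_(j' < n) (entry u (fintype.lift ord0 j') - entry w (fintype.lift ord0 j')).
  by rewrite sumrB; ring.
have le : cabs (\sum_(j' < n)
      (entry u (fintype.lift ord0 j') - entry w (fintype.lift ord0 j')))
    <= \sum_(j' < n) (r / n.+1%:R).
  apply: (big_ind2 (fun (z : C) k => cabs z <= k)); first by rewrite cabs0.
    by move=> z1 k1 z2 k2 h1 h2; apply: le_trans (cabsD _ _) _; rewrite lerD.
  by move=> j' _; rewrite cabsB ltW.
apply: le_lt_trans le _; rewrite sumr_const card_ord -mulrnAr.
rewrite gtr_pMr // -mulr_natl -/(_ / _) ltr_pdivrMr // mul1r ltr_nat //.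
Qed.

Let coord_continuous (p : V) : {for p, continuous coord}.
Proof.
move=> A /= /nbhs_real_mx [r r0 H]; apply/nbhs_coord; exists r => // w w1 w2.
apply: H => i j; rewrite !mxE.
have part (z z' : C) : cabs (z - z') < r ->
   `|(if i == 0 then complex.Re z else complex.Im z) -
     (if i == 0 then complex.Re z' else complex.Im z')| < r.
  move=> zr; have [E1 E2] := ReImB z z'.
  by case: ifP => _; rewrite -?E1 -?E2; apply: le_lt_trans zr;
    [exact: Re_cabs|exact: Im_cabs].
by apply: part; case: unliftP => [j' _|_]; [exact: w2|exact: w1].
Qed.

(** By the identity theorem the complement of each zero locus is open and
    dense in the parameter space, and Baire's theorem intersects them. *)
Theorem generic_dense (h : nat -> V -> C^o) :
  (forall k, entire (h k) /\ exists2 z, S z & h k z != 0) ->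
  forall p, S p -> forall A, nbhs p A ->
  exists z, [/\ S z, A z & forall k, h k z != 0].
Proof.
move=> hP p Sp A pA.
pose U : completeNormedModType R :=
  HB.pack W (Complete.on W) (NormedModule.on W).
pose O k : set U := [set u | h k (chart u) != 0].
have ch k z : {for z, continuous (h k)}.
  by apply: differentiable_continuous; case: (hP k) => + _; apply.
have oO k : open (O k).
  by rewrite openE => u /(near_neq0 (ch k (chart u))) /chart_continuous.
have dO k : dense (O k).
  move=> D [u Du] oD; apply: contrapT => N.
  (* An open set on which [h k] vanishes would give an open subset of the
     parameter space on which it vanishes. *)
  have [z Sz hz] := (hP k).2.
  apply: (@entire_dense _ _ _ weights_flat _ z (hP k).1 Sz hz (chart u)) => //.
  have uD : nbhs (coord (chart u)) D by rewrite coordK; exact: open_nbhs_nbhs.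
  have uD' : nbhs (chart u) (coord @^-1` D) by exact: coord_continuous uD.
  apply: filterS uD' => w Dw Sw.
  apply/eqP/negPn/negP => hw; apply: N; exists (coord w); split=> //.
  by rewrite /O /= chartK.
have pA' : nbhs (chart (coord p)) A by rewrite chartK.
have /= uA := chart_continuous pA'.
pose B : set U := (chart @^-1` A)^°.
have B0 : B !=set0 by exists (coord p).
have oB : open B by exact: open_interior.
have [u [Bu Ou]] := @Baire R U O (fun k => conj (oO k) (dO k)) B B0 oB.
exists (chart u); split=> //; first exact: (interior_subset Bu).
by move=> k; exact: Ou.
Qed.

End GenericDensity.

(** * Matrix coefficients of vertex operators *)

Section QNumberFacts.
Variables (R : realType) (eta : R[i]).
Hypothesis heta : 0 < complex.Im eta.
Local Notation C := R[i].
Local Notation q := (qpow eta).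
Local Notation br := (qnum eta).

Lemma qpow_neq0 (x : C) : q x != 0.
Proof.
apply/eqP => x0; have := qpowK eta x; rewrite x0 mul0r => /eqP.
by rewrite eq_sym oner_eq0.
Qed.

Lemma qpowN (x : C) : q (- x) = (q x)^-1.
Proof. by apply: (mulfI (qpow_neq0 x)); rewrite qpowK mulfV // qpow_neq0. Qed.

Lemma qpowMn (x : C) n : q (x *+ n) = q x ^+ n.
Proof.
elim: n => [|n IH]; first by rewrite mulr0n qpow0.
by rewrite mulrS qpowD IH exprS.
Qed.

Lemma cabs_qpow_real (x : R) : cabs (q x%:C) = expR (- (pi * complex.Im eta * x)).
Proof.
rewrite /qpow cabs_cexp; congr expR; case: eta => a b /=; ring.
Qed.

(** Since [Im eta > 0], no nontrivial real power of [q] equals [1]; in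
    particular [q] is not a root of unity. *)
Lemma qpow_real_eq1 (x : R) : q x%:C = 1 -> x = 0.
Proof.
move=> qx; have := cabs_qpow_real x; rewrite qx cabs1 => /esym/eqP.
rewrite -expR0 (inj_eq (@expR_inj R)) oppr_eq0 !mulf_eq0.
by rewrite (gt_eqF (pi_gt0 R)) (gt_eqF heta) /= => /eqP.
Qed.

Lemma natC n : n%:R = (n%:R : R)%:C.
Proof. by rewrite rmorph_nat. Qed.

Lemma qdiff_neq0 (x : R) : x != 0 -> q x%:C - q (- x%:C) != 0.
Proof.
move=> x0; apply/negP; rewrite subr_eq0 => /eqP E.
have : q (x + x)%:C = 1.
  by rewrite rmorphD /= qpowD {1}E mulrC qpowK.
by move/qpow_real_eq1/eqP; rewrite -mulr2n mulrn_eq0 /= (negPf x0).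
Qed.

Lemma qdiff1_neq0 : q 1 - q (- 1) != 0.
Proof. by have := @qdiff_neq0 1 (oner_neq0 _). Qed.

Lemma qnum_nat_neq0 n : br n.+1%:R != 0.
Proof.
rewrite /qnum mulf_neq0 ?invr_eq0 ?qdiff1_neq0 // natC.
by apply: qdiff_neq0; rewrite pnatr_eq0.
Qed.

Lemma qnumN (x : C) : br (- x) = - br x.
Proof. by rewrite /qnum opprK -[RHS]mulNr opprB. Qed.

Lemma qfactS n : qfact eta n.+1 = qfact eta n * br n.+1%:R.
Proof. by rewrite /qfact big_nat_recr. Qed.

Lemma qfact0 : qfact eta 0 = 1.
Proof. by rewrite /qfact big_geq. Qed.

Lemma qfact_neq0 n : qfact eta n != 0.
Proof.
elim: n => [|n IH]; first by rewrite qfact0 oner_neq0.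
by rewrite qfactS mulf_neq0 ?qnum_nat_neq0.
Qed.

End QNumberFacts.

Section CoefficientFunctional.
Variable R : realType.
Local Notation C := R[i].

(** The functional [coeff x], in a form carrying its linear structure. *)
Definition coefl (I : choiceType) (x : I) : {linear {freeg I / C} -> C^o} :=
  fglift (fun y => (y == x)%:R : C^o).

Lemma coeflE (I : choiceType) (x : I) D : coeff x D = coefl x D.
Proof. by []. Qed.

Lemma coeff_basis (I : choiceType) (x y : I) :
  coeff x (<< y >> : {freeg I / C}) = (y == x)%:R.
Proof. by rewrite coeffU mul1r. Qed.

Lemma coeff_lin (I J : choiceType) (g : {linear {freeg I / C} -> {freeg J / C}})
    (D : {freeg I / C}) z :
  coeff z (g D) = \sum_(y <- dom D) coeff y D * coeff z (g << y >>).
Proof.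
rewrite -{1}[D]freeg_sumE linear_sum /= coeflE linear_sum /=.
apply: eq_bigr => y _.
have -> : << coeff y D *g y >> = coeff y D *: << y >> :> {freeg I / C}.
  apply/eqP/freeg_eqP => x; rewrite /= coeffZ !coeffU.
  by rewrite mul1r.
by rewrite !linearZ.
Qed.

End CoefficientFunctional.

Section TensorCoefficients.
Variables (R : realType) (eta : R[i]).
Local Notation C := R[i].
Local Notation q := (qpow eta).
Local Notation br := (qnum eta).
Variables w Lam : C.
Local Notation TM := (tensor (verma eta (w - 1)) (verma_star eta Lam)).
Implicit Types (D : {freeg (nat * nat) / C}).

Lemma tensor_F_basis i j : uF TM << (i, j) >> =
  (br i.+1%:R * q (- (Lam - j.*2%:R))) *: << (i.+1, j) >> +
  br (Lam - j%:R) *: << (i, j.+1) >>.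
Proof.
rewrite -tensB -[LHS]/(tensor_F (verma eta (w - 1)) (verma_star eta Lam) _).
rewrite tensor_FE /= !fgliftB mulrN1 tensZl tensZr scalerA !tensB.
by rewrite tensZr tensB.
Qed.

Lemma tensor_E_basis i j : uE TM << (i, j) >> =
  (if i is i'.+1 then br (w - 1 - i'%:R) *: << (i', j) >> else 0) +
  (if j is j'.+1 then (q (w - 1 - i.*2%:R) * br j%:R) *: << (i, j') >> else 0).
Proof.
rewrite -tensB -[LHS]/(tensor_E (verma eta (w - 1)) (verma_star eta Lam) _).
rewrite tensor_EE /= !fgliftB mul1r tensZl; congr (_ + _).
  case: i => [|i]; first by rewrite tenslE linear0.
  by rewrite tensZl tensB.
case: j => [|j]; first by rewrite linear0 scaler0.
by rewrite tensZr tensB scalerA.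
Qed.

Lemma coeff_tensor_F k a D : coeff (k, a) (uF TM D) =
  (if k is k1.+1 then br k%:R * q (- (Lam - a.*2%:R)) * coeff (k1, a) D
   else 0) +
  (if a is a1.+1 then br (Lam - a1%:R) * coeff (k, a1) D else 0).
Proof.
rewrite coeff_lin.
have E y : coeff (k, a) (uF TM << y >>) =
    (if k is k1.+1 then br k%:R * q (- (Lam - a.*2%:R)) * (y == (k1, a))%:R
     else 0) +
    (if a is a1.+1 then br (Lam - a1%:R) * (y == (k, a1))%:R else 0).
  case: y => i j; rewrite tensor_F_basis coeffD !coeffZ !coeff_basis.
  congr (_ + _).
    case: k => [|k]; first by rewrite mulr0.
    rewrite !xpair_eqE eqSS; have [->|ni] := eqVneq i k; last by rewrite !mulr0.
    by have [->|nj] := eqVneq j a; rewrite // !mulr0.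
  case: a => [|a]; first by rewrite xpair_eqE andbF mulr0.
  rewrite !xpair_eqE eqSS; have [->|ni] := eqVneq j a; first by [].
  by rewrite !andbF !mulr0.
have D1 x : \sum_(y <- dom D) coeff y D * (y == x)%:R = coeff x D.
  rewrite -[in RHS](freeg_sumE D) [RHS]coeflE linear_sum /=.
  by apply: eq_bigr => y _; rewrite -coeflE coeffU.
under eq_bigr do rewrite E mulrDr.
rewrite big_split /=; congr (_ + _).
  case: k E => [|k] _; first by rewrite big1 // => y _; rewrite mulr0.
  by under eq_bigr do rewrite mulrCA; rewrite -mulr_sumr D1.
case: a E => [|a] _; first by rewrite big1 // => y _; rewrite mulr0.
by under eq_bigr do rewrite mulrCA; rewrite -mulr_sumr D1.
Qed.

Lemma coeff_tensor_E k a D : coeff (k, a) (uE TM D) =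
  br (w - 1 - k%:R) * coeff (k.+1, a) D +
  q (w - 1 - k.*2%:R) * br a.+1%:R * coeff (k, a.+1) D.
Proof.
rewrite coeff_lin.
have E y : coeff (k, a) (uE TM << y >>) =
    br (w - 1 - k%:R) * (y == (k.+1, a))%:R +
    q (w - 1 - k.*2%:R) * br a.+1%:R * (y == (k, a.+1))%:R.
  case: y => i j; rewrite tensor_E_basis coeffD; congr (_ + _).
    case: i => [|i]; first by rewrite coeff0 xpair_eqE mulr0.
    rewrite coeffZ coeff_basis !xpair_eqE eqSS.
    by have [->|ni] := eqVneq i k; rewrite // !mulr0.
  case: j => [|j]; first by rewrite coeff0 xpair_eqE andbF mulr0.
  rewrite coeffZ coeff_basis !xpair_eqE eqSS.
  have [->|ni] := eqVneq i k; last by rewrite !mulr0.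
  by have [->|nj] := eqVneq j a; rewrite // !mulr0.
have D1 x : \sum_(y <- dom D) coeff y D * (y == x)%:R = coeff x D.
  rewrite -[in RHS](freeg_sumE D) [RHS]coeflE linear_sum /=.
  by apply: eq_bigr => y _; rewrite -coeflE coeffU.
under eq_bigr do rewrite E mulrDr.
rewrite big_split /=; congr (_ + _);
  by under eq_bigr do rewrite mulrCA; rewrite -mulr_sumr D1.
Qed.

End TensorCoefficients.

Section VertexCoefficients.
Variables (R : realType) (eta : R[i]).
Hypothesis heta : 0 < complex.Im eta.
Local Notation C := R[i].
Local Notation q := (qpow eta).
Local Notation br := (qnum eta).
Variables (lam Lam : C) (m : nat).
Variable f : {linear {freeg nat / C} -> {freeg (nat * nat) / C}}.
Hypothesis hf : is_vertex_operator eta lam Lam m f.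
Let w := lam - Lam + m.*2%:R.
Local Notation c k k' a := (coeff (k', a) (f << k >>)).

Lemma vertex_F k k' a : br k.+1%:R * c k.+1 k' a =
  (if k' is k1.+1 then br k'%:R * q (- (Lam - a.*2%:R)) * c k k1 a else 0) +
  (if a is a1.+1 then br (Lam - a1%:R) * c k k' a1 else 0).
Proof.
have [[_ HF _] _] := hf.
rewrite -(coeff_tensor_F eta w Lam) -HF /= fgliftB linearZ /= coeffZ //.
Qed.

Lemma vertex_E k k' a :
  br (w - 1 - k'%:R) * c k k'.+1 a +
  q (w - 1 - k'.*2%:R) * br a.+1%:R * c k k' a.+1 =
  if k is k1.+1 then br (lam - k%:R) * c k1 k' a else 0.
Proof.
have [[HE _ _] _] := hf.
rewrite -(coeff_tensor_E eta w Lam) -HE /= fgliftB; case: k => [|k].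
  by rewrite linear0 coeff0.
by rewrite linearZ /= coeffZ -natr1 opprD addrA addrAC.
Qed.

Lemma star_E_iter i : (i <= m)%N ->
  iter i (uE (verma_star eta Lam)) << m >> =
  (qfact eta m / qfact eta (m - i)) *: << (m - i)%N >> :> {freeg nat / C}.
Proof.
elim: i => [_|i IH im]; first by rewrite subn0 divff ?qfact_neq0 // scale1r.
rewrite iterS IH ?(ltnW im) // linearZ /= fgliftB.
rewrite -(subnSK im) scalerA; congr (_ *: _).
by rewrite qfactS invfM -!mulrA mulVf ?qnum_nat_neq0 // mulr1.
Qed.

Lemma vertex_init k' a : c 0 k' a =
  if (k' + a == m)%N then
    q (k'%:R * (w - k'%:R)) * qpoch eta (1 - w + k'%:R) a *
    (qfact eta m / qfact eta a) else 0.
Proof.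
have [_ ->] := hf; rewrite coeflE linear_sum /=.
have E (i : 'I_m.+1) : coefl _ (k', a)
    ((q (i%:R * (lam - Lam + m.*2%:R - i%:R)) *
      qpoch eta (- lam + Lam - m.*2%:R + i%:R + 1) (m - i)) *:
     tens << val i >> (iter i (uE (verma_star eta Lam)) << m >>)) =
   if (i == k' :> nat) && (k' + a == m)%N then
    q (k'%:R * (w - k'%:R)) * qpoch eta (1 - w + k'%:R) a *
    (qfact eta m / qfact eta a) else 0.
  have im : (i <= m)%N by rewrite -ltnS.
  rewrite star_E_iter // linearZ /= tensZr linearZ /= tensB -!coeflE coeff_basis.
  rewrite xpair_eqE; have [ik|_] := eqVneq (val i) k'; last by rewrite !scaler0.
  rewrite -ik /GRing.scale /=.
  have -> : (i + a == m)%N = (m - i == a)%N.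
    by rewrite -(eqn_add2l i (m - i)) subnKC // eq_sym.
  have [<-|_] := eqVneq (m - i)%N a; last by rewrite !mulr0.
  rewrite mulr1; congr (_ * qpoch _ _ _ * _); rewrite /w; ring.
rewrite (eq_bigr _ (fun i _ => E i)).
have [kam|_] := eqVneq (k' + a)%N m; last by rewrite big1 // => i _; rewrite andbF.
have km : (k' < m.+1)%N by rewrite ltnS -kam leq_addr.
rewrite (bigD1 (Ordinal km)) //= eqxx /= big1 ?addr0 // => i ni.
by rewrite (_ : (i == k' :> nat) = false) //; apply: contraNF ni.
Qed.

End VertexCoefficients.

(** * Resonance of vertex operators and their products *)

Section VertexEntries.
Variables (R : realType) (eta : R[i]).
Hypothesis heta : 0 < complex.Im eta.
Local Notation C := R[i].
Local Notation q := (qpow eta).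
Local Notation br := (qnum eta).
Variable Phi :
  C -> C -> nat -> {linear {freeg nat / C} -> {freeg (nat * nat) / C}}.
Hypothesis hPhi :
  forall lam Lam m, is_vertex_operator eta lam Lam m (Phi lam Lam m).

Definition vertex_coef (lam Lam : C) (m k k' a : nat) : C :=
  coeff (k', a) (Phi lam Lam m << k >>).

(** Vertex operators preserve weights.  Stated on indices it follows from
    the relation for [F], without comparing powers of [q]. *)
Lemma vertex_coef_supp lam Lam m k k' a : (k' + a != k + m)%N ->
  vertex_coef lam Lam m k k' a = 0.
Proof.
elim: k k' a => [|k IH] k' a N.
  rewrite /vertex_coef (vertex_init heta (hPhi _ _ _)) add0n in N *.
  by rewrite (negPf N).
apply: (mulfI (qnum_nat_neq0 heta k)); rewrite mulr0 /vertex_coef.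
rewrite (vertex_F (hPhi _ _ _)); case: k' N => [|k'] N; case: a N => [|a] N.
- by rewrite addr0.
- by rewrite [coeff _ _]IH ?mulr0 ?addr0 //; lia.
- by rewrite [coeff _ _]IH ?mulr0 ?addr0 //; lia.
- by rewrite ![coeff _ _]IH ?mulr0 ?addr0 //; lia.
Qed.

(** Along [u_0] the relation for [F] has one term only. *)
Lemma vertex_coef_top lam Lam m k : vertex_coef lam Lam m k (k + m) 0 =
  q (m%:R * (lam - Lam + m%:R) - k%:R * Lam) * (qfact eta (k + m) / qfact eta k).
Proof.
elim: k => [|k IH].
  rewrite /vertex_coef (vertex_init heta (hPhi _ _ _)) add0n addn0 eqxx.
  rewrite /qpoch big_ord0 mulr1 mul0r subr0; congr (q _ * _).
  by rewrite -mul2n natrM; ring.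
apply: (mulfI (qnum_nat_neq0 heta k)); 
rewrite /vertex_coef addSn (vertex_F (hPhi _ _ _)) /=.
rewrite -/(vertex_coef lam Lam m k (k + m) 0) IH addr0 double0 subr0.
rewrite [qfact eta (k + m).+1]qfactS.
rewrite [qfact eta k.+1]qfactS.
have -> : q (m%:R * (lam - Lam + m%:R) - k.+1%:R * Lam) =
   q (- Lam) * q (m%:R * (lam - Lam + m%:R) - k%:R * Lam).
  by rewrite -qpowD; congr q; rewrite -natr1; ring.
by field; rewrite qfact_neq0 // qnum_nat_neq0.
Qed.

(** The relation for [E], solved for the component along [u_(a+1)]: by
    induction on [a] it determines all components from those along [u_0]. *)
Lemma vertex_coef_E lam Lam m k k' a :
  q (lam - Lam + m.*2%:R - 1 - k'.*2%:R) * br a.+1%:R *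
    vertex_coef lam Lam m k k' a.+1 =
  (if k is k1.+1 then br (lam - k%:R) * vertex_coef lam Lam m k1 k' a else 0) -
  br (lam - Lam + m.*2%:R - 1 - k'%:R) * vertex_coef lam Lam m k k'.+1 a.
Proof.
apply/eqP; rewrite eq_sym subr_eq eq_sym addrC; apply/eqP.
exact: vertex_E (hPhi lam Lam m) k k' a.
Qed.

(** Restriction to the submodule generated by [F^d v], on which
    [v^(k)] is [qfact (k + d) / qfact k] times the vector of index [k + d] of
    the large module.  Both sides satisfy the relations for [E], and they agree
    along [u_0]. *)
Lemma vertex_coef_source Lam (m k k' a d : nat) : (d <= m)%N ->
  vertex_coef (- d%:R) Lam m k k' a * qfact eta k =
  vertex_coef d%:R Lam (m - d) (k + d) k' a * qfact eta (k + d).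
Proof.
move=> dm; case: d dm => [|d] dm; first by rewrite mulr0n oppr0 subn0 addn0.
elim: a k k' => [|a IH] k k'.
  have [->|N] := eqVneq k' (k + m)%N; last first.
    by rewrite !vertex_coef_supp ?mul0r //; lia.
  rewrite vertex_coef_top; have E : (k + m = k + d.+1 + (m - d.+1))%N by lia.
  rewrite E vertex_coef_top -E; have := @qfact_neq0 _ _ heta k.
  have := @qfact_neq0 _ _ heta (k + d.+1) => n1 n2.
  rewrite (mulrA (q _)) mulfVK // (mulrA (q _)) mulfVK //; congr (q _ * _).
  by rewrite natrB // natrD; ring.
have wE : d.+1%:R - Lam + (m - d.+1).*2%:R = - d.+1%:R - Lam + m.*2%:R :> C.
  by rewrite -!mul2n !natrM natrB //; ring.
have nz : q (- d.+1%:R - Lam + m.*2%:R - 1 - k'.*2%:R) * br a.+1%:R != 0.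
  by rewrite mulf_neq0 ?qpow_neq0 ?qnum_nat_neq0.
have E1 := vertex_coef_E (- d.+1%:R) Lam m k k' a.
have E2 := vertex_coef_E d.+1%:R Lam (m - d.+1) (k + d.+1) k' a; rewrite wE in E2.
apply: (mulfI nz); rewrite [LHS]mulrA E1 [RHS]mulrA E2 [LHS]mulrBl [RHS]mulrBl.
congr (_ - _); last by rewrite -[LHS]mulrA -[RHS]mulrA IH.
(* For [k = 0] the right-hand side of the second relation has the factor
   [d - (0 + d)], as [E] kills the singular vector [F^d v]. *)
case: k {E1 E2} => [|k]; first by rewrite add0n subrr qnum0 !mul0r.
rewrite addSn [qfact eta k.+1]qfactS [qfact eta (k + d.+1).+1]qfactS.
have -> : - d.+1%:R - k.+1%:R = - (k + d.+1).+1%:R :> C.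
  by rewrite -!natr1 natrD -!natr1; ring.
have -> : d.+1%:R - (k + d.+1).+1%:R = - k.+1%:R :> C.
  by rewrite -!natr1 natrD -!natr1; ring.
rewrite !qnumN.
have := IH k k'; set u := vertex_coef _ _ _ k _ _.
set v := vertex_coef _ _ _ (k + _)%N _ _ => uv.
have -> : - br (k + d.+1).+1%:R * u * (qfact eta k * br k.+1%:R) =
  - br (k + d.+1).+1%:R * br k.+1%:R * (u * qfact eta k) by ring.
by rewrite uv; ring.
Qed.

(** The embedding applied after the vertex operator, compared along
    [u_0]. *)
Lemma vertex_coef_target lam Lam (m k k' a d : nat) :
  lam - Lam + m.*2%:R = - d%:R ->
  vertex_coef lam Lam (m + d) k (k' + d) a * qfact eta k' =
  vertex_coef lam Lam m k k' a * qfact eta (k' + d).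
Proof.
move=> wE; have wE' : lam - Lam + (m + d).*2%:R = d%:R.
  rewrite doubleD natrD addrA wE -mul2n natrM; ring.
elim: a k k' => [|a IH] k k'.
  have [->|N] := eqVneq k' (k + m)%N; last first.
    by rewrite !vertex_coef_supp ?mul0r //; lia.
  rewrite -addnA !vertex_coef_top addnA.
  have -> : (m + d)%:R * (lam - Lam + (m + d)%:R) = m%:R * (lam - Lam + m%:R) :> C.
    have -> : lam - Lam = - d%:R - m.*2%:R by rewrite -wE; ring.
    by rewrite natrD -mul2n natrM; ring.
  by field; rewrite qfact_neq0.
have nz : q (- d%:R - 1 - k'.*2%:R) * br a.+1%:R != 0.
  by rewrite mulf_neq0 ?qpow_neq0 ?qnum_nat_neq0.
have E1 := vertex_coef_E lam Lam (m + d) k (k' + d) a; rewrite wE' in E1.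
have E2 := vertex_coef_E lam Lam m k k' a; rewrite wE in E2.
have wE2 : d%:R - 1 - (k' + d).*2%:R = - d%:R - 1 - k'.*2%:R :> C.
  by rewrite doubleD natrD -!mul2n !natrM; ring.
rewrite wE2 in E1.
apply: (mulfI nz); rewrite [LHS]mulrA E1 [RHS]mulrA E2 [LHS]mulrBl [RHS]mulrBl.
congr (_ - _).
  by case: k {E1 E2} => [|k]; rewrite ?mul0r // -[LHS]mulrA -[RHS]mulrA IH.
have -> : d%:R - 1 - (k' + d)%:R = - k'.+1%:R :> C by rewrite -natr1 natrD; ring.
have -> : - d%:R - 1 - k'%:R = - (k' + d).+1%:R :> C by rewrite -natr1 natrD; ring.
have := IH k k'.+1.
rewrite addSn [qfact eta k'.+1]qfactS [qfact eta (k' + d).+1]qfactS !qnumN.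
set u := vertex_coef _ _ (m + d) _ _ _; set v := vertex_coef _ _ m _ _ _ => uv.
have -> : - br k'.+1%:R * u * qfact eta k' = - (u * (qfact eta k' * br k'.+1%:R)).
  by ring.
by rewrite uv; ring.
Qed.

(** The image of the embedding starts at the index [d]. *)
Lemma vertex_coef_target0 lam Lam (m k k' a d : nat) :
  lam - Lam + m.*2%:R = - d%:R -> (k' < d)%N ->
  vertex_coef lam Lam (m + d) k k' a = 0.
Proof.
move=> wE; have wE' : lam - Lam + (m + d).*2%:R = d%:R.
  rewrite doubleD natrD addrA wE -mul2n natrM; ring.
elim: a k k' => [|a IH] k k' kd; first by rewrite vertex_coef_supp //; lia.
have nz : q (lam - Lam + (m + d).*2%:R - 1 - k'.*2%:R) * br a.+1%:R != 0.
  by rewrite mulf_neq0 ?qpow_neq0 ?qnum_nat_neq0.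
apply: (mulfI nz); rewrite vertex_coef_E mulr0 wE'.
have -> : (if k is k1.+1 then br (lam - k%:R) * vertex_coef lam Lam (m + d) k1 k' a
   else 0) = 0 by case: k => [|k] //; rewrite IH ?mulr0.
move: kd; rewrite leq_eqVlt => /orP[/eqP <-|kd].
  by rewrite -natr1 addrK subrr qnum0 mul0r subr0.
by rewrite IH // mulr0 subr0.
Qed.

(** Since vertex operators preserve weights, the indices of the dual components
    determine that of the Verma component.
    Truncation at [0] is harmless, since [vertex_coef] then vanishes. *)
Definition outidx (s : seq (C * nat)) (t : seq nat) (k : nat) : nat :=
  (k + sumn (map snd s) - sumn t)%N.

Fixpoint product_coef (lam : C) (s : seq (C * nat)) (t : seq nat) (k : nat) : C :=
  match s, t with
  | p :: s', a :: t' => product_coef lam s' t' k *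
      vertex_coef (lam - \sum_(p' <- s') (p'.1 - p'.2.*2%:R)) p.1 p.2
        (outidx s' t' k) (outidx s t k) a
  | [::], [::] => 1
  | _, _ => 0
  end.

(** At the factor where the index would become negative, the truncated index
    [0] violates [vertex_coef_supp]. *)
Lemma product_coef_neg lam s t k : (k + sumn (map snd s) < sumn t)%N ->
  product_coef lam s t k = 0.
Proof.
elim: s t => [|p s IH] [|a t] //=; rewrite ?addn0 // => H.
have [/IH ->|le] := ltnP (k + sumn (map snd s)) (sumn t); first by rewrite mul0r.
by rewrite vertex_coef_supp ?mulr0 // /outidx /=; lia.
Qed.

(** By [vertex_coef_supp] only one intermediate basis vector contributes,
    so that the coefficient is a product instead of a sum. *)
Lemma coeff_vertex_product lam s t k k' :
  coeff (k', t) (vertex_product Phi lam s << k >>) =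
  if (k' + sumn t == k + sumn (map snd s))%N then product_coef lam s t k else 0.
Proof.
elim: s t k' => [|p s IH] t k' /=.
  rewrite fgliftB coeff_basis xpair_eqE.
  case: t => [|a t] /=; last by rewrite andbF; case: ifP.
  by rewrite !addn0 andbT eq_sym; case: eqP.
set lam' := lam - _; set step := (fun kt : nat * seq nat => _).
rewrite (coeff_lin (fglift step)).
have stepE y : coeff (k', t) (fglift step << y >>) =
   if t is a :: t' then (y.2 == t')%:R * vertex_coef lam' p.1 p.2 y.1 k' a else 0.
  rewrite fgliftB /step (coeff_lin (fglift _)) /vertex_coef.
  case: t {IH} => [|a t].
    by rewrite big1 // => z _; rewrite /= fgliftB coeff_basis xpair_eqE andbF mulr0.
  have E z : coeff (k', a :: t)
      (fglift (fun ka : nat * nat =>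
          << (ka.1, ka.2 :: y.2) >> : {freeg (nat * seq nat) / C}) << z >>) =
      (y.2 == t)%:R * (z == (k', a))%:R.
    rewrite fgliftB coeff_basis; case: z => z1 z2; rewrite !xpair_eqE eqseq_cons /=.
    by case: (z1 == k'); case: (z2 == a); case: (y.2 == t);
      rewrite /= ?mul0r ?mulr1 ?mulr0.
  under eq_bigr do rewrite E mulrCA.
  rewrite -mulr_sumr; congr (_ * _).
  rewrite -[in RHS](freeg_sumE (Phi _ _ _ _)) [RHS]coeflE linear_sum /=.
  by apply: eq_bigr => z _; rewrite -coeflE coeffU.
under eq_bigr do rewrite stepE.
case: t {stepE} => [|a t].
  by rewrite big1 ?if_same // => y _; rewrite mulr0.
set D := vertex_product Phi lam s << k >>.
pose y0 := (outidx s t k, t).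
have -> : \sum_(y <- dom D) coeff y D *
     ((y.2 == t)%:R * vertex_coef lam' p.1 p.2 y.1 k' a)
   = coeff y0 D * vertex_coef lam' p.1 p.2 y0.1 k' a.
  rewrite -[in RHS](freeg_sumE D) coeflE linear_sum /= mulr_suml.
  apply: eq_bigr => y _; rewrite -coeflE coeffU.
  have [->|ny] := eqVneq y y0; first by rewrite eqxx mulr1 mul1r.
  rewrite mulr0 mul0r; have [yt|] := eqVneq y.2 t; last by rewrite mul0r mulr0.
  have -> : coeff y D = 0; last by rewrite mul0r.
  have -> : y = (y.1, y.2) by case: y {ny yt}.
  rewrite /D IH; case: eqP => // E; case/negP: ny; apply/eqP.
  rewrite /y0 -yt; case: y E {yt} => y1 y2 /= E.
  by rewrite /outidx; congr pair; lia.
rewrite /D IH /= -/lam'.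
have [neg|le] := ltnP (k + sumn (map snd s)) (sumn t).
  have -> : (outidx s t k + sumn t == k + sumn (map snd s))%N = false.
    by apply/negbTE; rewrite /outidx; lia.
  by rewrite product_coef_neg // !mul0r if_same.
have -> : (outidx s t k + sumn t == k + sumn (map snd s))%N.
  by rewrite /outidx subnK.
case: eqP => [E|N].
  by congr (_ * vertex_coef _ _ _ _ _ _); rewrite /outidx /=; lia.
by rewrite vertex_coef_supp ?mulr0 //= /outidx; apply/eqP; lia.
Qed.

End VertexEntries.

(** * Dependence of the coefficients on the parameters *)

Section PolynomialFactor.
Variables (K : fieldType) (T : Type) (B : T -> K).
Implicit Types (A f g : T -> K) (a b : K) (N : nat).

(** The two dependences to be controlled, on [lam] and on [k], are both of the
    form prefactor times polynomial of bounded degree in an exponential; the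
    constant term is tracked for the sake of the normalisation of [Psi]. *)
Definition pfac A N f a := exists P : {poly K},
  [/\ (size P <= N.+1)%N, P`_0 = a & forall u, f u = A u * P.[B u]].

Lemma pfac_ext A N f g a : f =1 g -> pfac A N f a -> pfac A N g a.
Proof. by move=> fg [P [s0 c0 E]]; exists P; split=> // u; rewrite -fg. Qed.

Lemma pfac_extA A A' N f a : A =1 A' -> pfac A N f a -> pfac A' N f a.
Proof. by move=> fg [P [s0 c0 E]]; exists P; split=> // u; rewrite -fg. Qed.

Lemma pfac0 A N : pfac A N (fun=> 0) 0.
Proof.
by exists 0; split; rewrite ?size_poly0 ?coef0 // => u; rewrite horner0 mulr0.
Qed.

Lemma pfacZ A N f a (c : K) : pfac A N f a -> pfac A N (fun u => c * f u) (c * a).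
Proof.
move=> [P [s0 c0 E]]; exists (c *: P); split; rewrite ?coefZ ?c0 //.
  exact: leq_trans (size_scale_leq _ _) s0.
by move=> u; rewrite hornerZ E mulrCA.
Qed.

Lemma pfacD A N f g a b : pfac A N f a -> pfac A N g b ->
  pfac A N (fun u => f u + g u) (a + b).
Proof.
move=> [P [s0 c0 E]] [Q [s1 c1 E1]]; exists (P + Q); split.
- by apply: leq_trans (size_polyD _ _) _; rewrite geq_max s0.
- by rewrite coefD c0 c1.
- by move=> u; rewrite hornerD E E1 mulrDr.
Qed.

Lemma pfacM A A' N N' f g a b : pfac A N f a -> pfac A' N' g b ->
  pfac (fun u => A u * A' u) (N + N') (fun u => f u * g u) (a * b).
Proof.
move=> [P [s0 c0 E]] [Q [s1 c1 E1]]; exists (P * Q); split.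
- by apply: leq_trans (size_polyMleq _ _) _; lia.
- by rewrite coefM big_ord1 c0 c1.
- by move=> u; rewrite hornerM E E1; ring.
Qed.

Lemma pfac_monomial A n : pfac A n (fun u => A u * B u ^+ n) (n == 0%N)%:R.
Proof.
exists 'X^n; split; first by rewrite size_polyXn.
  by rewrite coefXn eq_sym.
by move=> u; rewrite hornerXn.
Qed.

Lemma pfac_binomial A (c d : K) n : (0 < n)%N ->
  pfac A n (fun u => A u * (c + d * B u ^+ n)) c.
Proof.
move=> n0; exists (c%:P + d *: 'X^n); split.
- apply: leq_trans (size_polyD _ _) _; rewrite geq_max.
  rewrite (leq_trans (size_polyC_leq1 _)) //=.
  by apply: leq_trans (size_scale_leq _ _) _; rewrite size_polyXn.
- by rewrite coefD coefC coefZ coefXn; case: n n0 => // n _; rewrite /= mulr0 addr0.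
- by move=> u; rewrite hornerD hornerC hornerZ hornerXn.
Qed.

End PolynomialFactor.

Section EntryStructure.
Variables (R : realType) (eta : R[i]).
Hypothesis heta : 0 < complex.Im eta.
Local Notation C := R[i].
Local Notation q := (qpow eta).
Local Notation br := (qnum eta).
Variable Phi :
  C -> C -> nat -> {linear {freeg nat / C} -> {freeg (nat * nat) / C}}.
Hypothesis hPhi :
  forall lam Lam m, is_vertex_operator eta lam Lam m (Phi lam Lam m).
Local Notation vc := (vertex_coef Phi).
Local Notation vprod := (product_coef Phi).
Local Notation D := (q 1 - q (- 1)).

(** Laurent polynomials in [q^lam] with exponents [- d], [2 - d], up to [d].
    The value [a] is the coefficient of [q^(- d lam)]. *)
Definition lpoly d (f : C -> C) a :=
  pfac (fun lam => q (lam *+ 2)) (fun lam => q (- (d%:R * lam))) d f a.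

Lemma lpolyM d e f g a b : lpoly d f a -> lpoly e g b ->
  lpoly (d + e) (fun lam => f lam * g lam) (a * b).
Proof.
move=> H1 H2; apply: pfac_extA (pfacM H1 H2) => lam.
by rewrite -qpowD; congr q; rewrite natrD; ring.
Qed.

Lemma lpolyZ d f a c : lpoly d f a -> lpoly d (fun lam => c * f lam) (c * a).
Proof. exact: pfacZ. Qed.

Lemma lpoly_cst c : lpoly 0 (fun=> c) c.
Proof.
exists c%:P; rewrite size_polyC_leq1 coefC; split=> // lam.
by rewrite mul0r oppr0 qpow0 mul1r hornerC.
Qed.

Lemma lpoly_shift d f a c : lpoly d f a ->
  lpoly d (fun lam => f (lam - c)) (q (d%:R * c) * a).
Proof.
move=> [P [s0 c0 E]].
exists (q (d%:R * c) *: \poly_(i < d.+1) (P`_i * q (- (c *+ 2)) ^+ i)).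
split.
- by apply: leq_trans (size_scale_leq _ _) _; exact: size_poly.
- by rewrite coefZ coef_poly /= c0 expr0 mulr1.
move=> lam; rewrite E hornerZ horner_poly (horner_coef_wide _ s0).
have -> : - (d%:R * (lam - c)) = - (d%:R * lam) + d%:R * c by ring.
rewrite [X in _ * X = _](eq_bigr (fun i : 'I_d.+1 =>
    P`_i * q (- (c *+ 2)) ^+ i * q (lam *+ 2) ^+ i)).
  by rewrite (qpowD eta (- (d%:R * lam))); ring.
move=> i _; rewrite -mulrA -exprMn; congr (_ * _ ^+ _).
by rewrite -qpowD mulrnBl addrC.
Qed.

Lemma lpoly_qnum c : lpoly 1 (fun lam => br (c - lam)) (q c / D).
Proof.
have H := @pfac_binomial _ _ (fun lam => q (lam *+ 2))
   (fun lam => q (- (1%:R * lam)))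
   (q c / D) (- (q (- c) / D)) 1 isT.
apply: pfac_ext H => lam; rewrite /qnum expr1 mul1r.
have -> : q (- (c - lam)) = q (- c) * q (lam *+ 2) * q (- lam).
  by rewrite -!qpowD; congr q; ring.
by rewrite (qpowD eta c (- lam)); ring.
Qed.

Lemma lpoly_qpow n c : lpoly n (fun lam => q (n%:R * lam + c))
  (if n == 0%N then q c else 0).
Proof.
have H := pfacZ (q c) (@pfac_monomial _ _ (fun lam => q (lam *+ 2))
  (fun lam => q (- (n%:R * lam))) n).
have -> : (if n == 0%N then q c else 0) = q c * (n == 0%N)%:R.
  by case: eqP; rewrite ?mulr1 ?mulr0.
apply: pfac_ext H => lam; rewrite -qpowMn -!qpowD; congr q.
by rewrite -mulr_natl -[lam *+ 2]mulr_natl; ring.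
Qed.

(** The lowest coefficient of the component along [u_m] of the image of
    the highest weight vector. *)
Definition low0 (Lam : C) m : C := \prod_(j < m) (q (1 + Lam - m.*2%:R + j%:R) / D).

(** The relation for [F] does not involve [lam], so the shape has to be
    checked for [k = 0] only.  There the exponent [- m] occurs only for
    [v (x) u_m], and [F] maps [u_a] to multiples of [u_(a+1)]. *)
Lemma lpoly_vertex_coef Lam m k k' a : exists L,
  [/\ lpoly m (fun lam => vc lam Lam m k k' a) L,
  (a < m)%N -> L = 0 &
  a = m -> k' = k -> L = q (- (k%:R * (Lam - m.*2%:R))) * low0 Lam m].
Proof.
elim: k k' a => [|k IH] k' a.
  have [kam|N] := eqVneq (k' + a)%N m; last first.
    exists 0; split => //; last by move=> am k0; rewrite am k0 add0n eqxx in N.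
    apply: pfac_ext (pfac0 _ _ _) => lam.
    by rewrite /vertex_coef (vertex_init heta (hPhi _ _ _)) (negPf N).
  have HP n c : lpoly n (fun lam => qpoch eta (c - lam) n)
      (\prod_(j < n) (q (c + j%:R) / D)).
    rewrite /qpoch; elim: n => [|n IHn].
      rewrite big_ord0; apply: pfac_ext (lpoly_cst 1) => lam.
      by rewrite big_ord0.
    have H := lpolyM IHn (lpoly_qnum (c + n%:R)).
    rewrite addn1 in H; rewrite big_ord_recr /=; apply: pfac_ext H => lam.
    by rewrite big_ord_recr /=; congr (_ * br _); ring.
  have HQ := lpoly_qpow k' (k'%:R * (m.*2%:R - Lam - k'%:R)).
  have H := lpolyZ (qfact eta m / qfact eta a)
    (lpolyM HQ (HP a (1 + Lam - m.*2%:R + k'%:R))).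
  rewrite kam in H.
  eexists; split.
  - apply: pfac_ext H => lam.
    rewrite /vertex_coef (vertex_init heta (hPhi _ _ _)) kam eqxx mulrC.
    congr (q _ * qpoch eta _ _ * _); ring.
  - move=> am; have -> : (k' == 0%N) = false by apply/negbTE; lia.
    by rewrite mul0r mulr0.
  - move=> am k0; rewrite k0 eqxx am !mulr0n !mul0r oppr0 qpow0 !mul1r.
    rewrite divff ?qfact_neq0 // mul1r /low0.
    by apply: eq_bigr => j _; rewrite addr0.
have [L1 [H1 z1 e1]] : exists L, [/\ lpoly m (fun lam =>
    if k' is k1.+1 then br k'%:R * q (- (Lam - a.*2%:R)) * vc lam Lam m k k1 a
    else 0) L, (a < m)%N -> L = 0 & a = m -> k' = k.+1 -> L = br k.+1%:R *
      (q (- (k.+1%:R * (Lam - m.*2%:R))) * low0 Lam m)].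
  case: k' => [|k1]; first by exists 0; split=> //; exact: pfac0.
  have [L [H z e]] := IH k1 a.
  exists (br k1.+1%:R * q (- (Lam - a.*2%:R)) * L); split.
  - exact: pfacZ.
  - by move=> /z ->; rewrite mulr0.
  - move=> am [k1k]; rewrite e // am k1k -natr1.
    have -> : - ((k%:R + 1) * (Lam - m.*2%:R)) =
      - (Lam - m.*2%:R) + - (k%:R * (Lam - m.*2%:R)) by ring.
    by rewrite [q (_ + - (_ * _))]qpowD; ring.
have [L2 [H2 z2]] : exists L, [/\ lpoly m (fun lam =>
    if a is a1.+1 then br (Lam - a1%:R) * vc lam Lam m k k' a1 else 0) L &
    (a <= m)%N -> L = 0].
  case: a {z1 e1 H1} => [|a1]; first by exists 0; split=> //; exact: pfac0.
  have [L [H z e]] := IH k' a1.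
  exists (br (Lam - a1%:R) * L); split; first exact: pfacZ.
  by move=> /z ->; rewrite mulr0.
exists ((br k.+1%:R)^-1 * (L1 + L2)); split.
- apply: pfac_ext (pfacZ (br k.+1%:R)^-1 (pfacD H1 H2)) => lam.
  by rewrite -(vertex_F (hPhi _ _ _)) mulKf // qnum_nat_neq0.
- by move=> am; rewrite z1 // z2 ?(ltnW am) // addr0 mulr0.
- move=> am k'k; rewrite e1 // z2 ?am // addr0 mulKf //.
  exact: qnum_nat_neq0.
Qed.

Fixpoint lowcoef (s : seq (C * nat)) : C :=
  if s is p :: s' then
    lowcoef s' * (q (p.2%:R * \sum_(p' <- s') (p'.1 - p'.2.*2%:R)) * low0 p.1 p.2)
  else 1.

(** A lowest coefficient is nonzero only if every factor has [a >= m]. *)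
Lemma lpoly_product_coef s t k : exists L,
  [/\ lpoly (sumn (map snd s)) (fun lam => vprod lam s t k) L,
     ~~ all2 leq (map snd s) t -> L = 0 &
     t = map snd s ->
       L = q (- (k%:R * \sum_(p <- s) (p.1 - p.2.*2%:R))) * lowcoef s].
Proof.
elim: s t => [|p s IH] [|a t] /=.
- exists 1; split=> //; first exact: lpoly_cst.
  by move=> _; rewrite big_nil mulr0 oppr0 qpow0 mulr1.
- by exists 0; split=> //; exact: pfac0.
- by exists 0; split=> //; exact: pfac0.
have [L [H z e]] := IH t.
set k1 := outidx s t k; set k2 := outidx (p :: s) (a :: t) k.
have [L1 [H1 z1 e1]] := lpoly_vertex_coef p.1 p.2 k1 k2 a.
set c := \sum_(p' <- s) _.
exists (L * (q (p.2%:R * c) * L1)); split.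
- by rewrite addnC; exact: lpolyM H (lpoly_shift c H1).
- rewrite negb_and -ltnNge => /orP[/z1 ->|/z ->]; last by rewrite mul0r.
  by rewrite !mulr0.
- move=> [ap tE]; have k1k : k1 = k by rewrite /k1 /outidx tE addnK.
  have k2k : k2 = k by rewrite /k2 /outidx /= tE ap addnK.
  rewrite e // e1 // ?k1k ?k2k // big_cons.
  have -> : - (k%:R * (p.1 - p.2.*2%:R + \sum_(j <- s) (j.1 - j.2.*2%:R))) =
    - (k%:R * c) + - (k%:R * (p.1 - p.2.*2%:R)) by rewrite -/c; ring.
  by rewrite [in RHS]qpowD; ring.
Qed.

(** Exponential polynomials in [k]; the term [e] collects the
    weights, whose total is an integer for a full trace. *)
Definition epoly (e : C) (L : nat) (f : nat -> C) := exists b,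
  pfac (fun k : nat => q k%:R) (fun k : nat => q (- (k%:R * (e + L%:R)))) L.*2 f b.

Lemma epoly_ext e L f g : f =1 g -> epoly e L f -> epoly e L g.
Proof. by move=> fg [b H]; exists b; exact: pfac_ext H. Qed.

Lemma epolyM e e' L L' f g : epoly e L f -> epoly e' L' g ->
  epoly (e + e') (L + L') (fun k => f k * g k).
Proof.
move=> [b H] [b' H']; exists (b * b'); rewrite doubleD.
apply: pfac_extA (pfacM H H') => k.
by rewrite -qpowD; congr q; rewrite natrD; ring.
Qed.

Lemma epolyZ e L f c : epoly e L f -> epoly e L (fun k => c * f k).
Proof. by move=> [b H]; exists (c * b); exact: pfacZ. Qed.

Lemma epolyB e L f g : epoly e L f -> epoly e L g ->
  epoly e L (fun k => f k - g k).
Proof.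
move=> [b H] [b' H']; exists (b + -1 * b').
by apply: pfac_ext (pfacD H (pfacZ (-1) H')) => k; rewrite mulN1r.
Qed.

Lemma epoly_cst c : epoly 0 0 (fun=> c).
Proof.
exists c; exists c%:P; rewrite size_polyC_leq1 coefC; split=> // k.
by rewrite addr0 mulr0 oppr0 qpow0 mul1r hornerC.
Qed.

Lemma epoly_qnum c : epoly 0 1 (fun k => br (c + k%:R)).
Proof.
exists (- (q (- c) / D)).
have H := @pfac_binomial _ _ (fun k : nat => q k%:R)
   (fun k : nat => q (- (k%:R * (0 + 1%:R)))) (- (q (- c) / D)) (q c / D) 2 isT.
apply: pfac_ext H => k; rewrite /qnum add0r mulr1 -qpowMn.
rewrite opprD (qpowD eta c) (qpowD eta (- c)).
have -> : q k%:R = q (- k%:R) * q (k%:R *+ 2).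
  by rewrite -qpowD; congr q; ring.
ring.
Qed.

Lemma epoly_qnumN c : epoly 0 1 (fun k => br (c - k%:R)).
Proof.
apply: epoly_ext (epolyZ (-1) (epoly_qnum (- c))) => k.
by rewrite mulN1r -qnumN opprD opprK.
Qed.

Lemma epoly_qpow2 c : epoly 0 2 (fun k => q (c + k.*2%:R)).
Proof.
exists (q c * (4 == 0%N)%:R).
have H := pfacZ (q c) (@pfac_monomial _ _ (fun k : nat => q k%:R)
   (fun k : nat => q (- (k%:R * (0 + 2%:R)))) 4).
apply: pfac_ext H => k; rewrite -qpowMn -!qpowD; congr q.
by rewrite -mul2n natrM; ring.
Qed.

(** Induction on [a] by the relation for [E], in which no factor
    depending on [k] has to be inverted, unlike in the relation for [F].  Each
    step multiplies by [q^(2 k)] and by a quantum number, hence the [3 a]. *)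
Lemma epoly_vertex_coef lam Lam m a d : (a <= d)%N ->
  epoly Lam (m + 3 * a) (fun k => vc lam Lam m (k + d) (k + d + m - a) a).
Proof.
elim: a d => [|a IH] d ad.
  have Hq : epoly Lam 0 (fun k => q (m%:R * (lam - Lam + m%:R) - (k + d)%:R * Lam)).
    have H := pfacZ (q (m%:R * (lam - Lam + m%:R) - d%:R * Lam)) (@pfac_monomial _ _
      (fun k : nat => q k%:R) (fun k : nat => q (- (k%:R * (Lam + 0%:R)))) 0).
    eexists; apply: pfac_ext H => k; rewrite expr0 mulr1 -qpowD; congr q.
    by rewrite natrD; ring.
  have Hf : epoly 0 m (fun k => qfact eta (k + d + m) / qfact eta (k + d)).
    elim: (m) => [|n IHn].
      apply: epoly_ext (epoly_cst 1) => k.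
      by rewrite addn0 divff // qfact_neq0.
    have H := epolyM IHn (epoly_qnum (d + n.+1)%:R).
    rewrite addr0 addn1 in H; apply: epoly_ext H => k.
    rewrite [(k + d + n.+1)%N]addnS qfactS [LHS]mulrAC; congr (_ * br _ / _).
    by rewrite -natrD; congr (_%:R); lia.
  have := epolyM Hq Hf; rewrite addr0 muln0 addn0 add0n.
  by apply: epoly_ext => k; rewrite subn0 (vertex_coef_top heta hPhi).
case: d ad => [//|d] ad.
have br0 : br a.+1%:R != 0 by exact: qnum_nat_neq0.
pose z : C := lam - Lam + m.*2%:R - 1.
have H1 := epolyM (epoly_qnumN (lam - d.+1%:R)) (IH d ad).
have H2 := epolyM (epoly_qnumN (z - (d + m - a)%:R)) (IH d.+1 (leqW ad)).
have H3 := epolyM (epolyZ (br a.+1%:R)^-1 (epoly_qpow2 ((d + m - a).*2%:R - z)))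
  (epolyB H1 H2).
move: H3; rewrite !add0r; have -> : (2 + (1 + (m + 3 * a)) = m + 3 * a.+1)%N by lia.
apply: epoly_ext => k.
have E := vertex_coef_E hPhi lam Lam m (k + d).+1 (k + d + m - a) a.
have kE : (k + d.+1 + m - a.+1 = k + d + m - a)%N by lia.
have kE1 : (k + d.+1 + m - a = (k + d + m - a).+1)%N by lia.
have kE2 : (k + d + m - a = k + (d + m - a))%N by lia.
have e1 : lam - d.+1%:R - k%:R = lam - (k + d).+1%:R :> C.
  by rewrite -!natr1 natrD; ring.
have e2 : z - (d + m - a)%:R - k%:R = z - (k + d + m - a)%:R :> C.
  by rewrite kE2 natrD; ring.
rewrite kE kE1 addnS e1 e2 -E -/z.
have -> : z - (k + d + m - a).*2%:R = - ((d + m - a).*2%:R - z + k.*2%:R).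
  by rewrite kE2 doubleD natrD; ring.
set X := _ - z + k.*2%:R; set u := vertex_coef _ _ _ _ _ _ _.
have -> : (br a.+1%:R)^-1 * q X * (q (- X) * br a.+1%:R * u) =
   ((br a.+1%:R)^-1 * br a.+1%:R) * (q X * q (- X)) * u by ring.
by rewrite qpowK mulVf // !mul1r.
Qed.

Lemma epoly_product_coef lam s t d : (sumn t <= d)%N ->
  epoly (\sum_(p <- s) p.1) (sumn (map snd s) + 3 * sumn t)
    (fun k => vprod lam s t (k + d)).
Proof.
elim: s t => [|p s IH] [|a t] /= td.
- by rewrite big_nil muln0; exact: epoly_cst.
- rewrite big_nil; exists 0; exact: pfac0.
- exists 0; exact: pfac0.
have td' : (sumn t <= d)%N by lia.
set d' := (d + sumn (map snd s) - sumn t)%N.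
have H := epolyM (IH t td')
  (epoly_vertex_coef (lam - \sum_(p' <- s) (p'.1 - p'.2.*2%:R)) p.1 p.2
     (_ : a <= d')%N).
rewrite big_cons; have {}H := H (ltac:(rewrite /d'; lia)).
rewrite [p.1 + _]addrC.
have -> : (p.2 + sumn (map snd s) + 3 * (a + sumn t) =
   sumn (map snd s) + 3 * sumn t + (p.2 + 3 * a))%N by lia.
apply: epoly_ext H => k; congr (_ * vertex_coef _ _ _ _ _ _ _).
  by rewrite /outidx /d' addnBA ?addnA // (leq_trans td') ?leq_addr.
have dT : (sumn t <= k + d + sumn (map snd s))%N.
  by rewrite -addnA addnCA (leq_trans td') // leq_addr.
rewrite /outidx /d' /= addnBA ?addnA ?addnBAC // ?(leq_trans td') ?leq_addr //.
rewrite -subnDA [(sumn t + a)%N]addnC; congr (_ - _)%N.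
by rewrite -!addnA; congr (_ + (_ + _))%N; rewrite addnC.
Qed.

Section Differentiability.
Variables (V : normedModType C) (v : V).
Implicit Types (f g : V -> C^o).

Lemma differentiable_const (c : C) : differentiable (fun _ : V => c : C^o) v.
Proof. exact: differentiable_cst. Qed.

Lemma differentiable_qpow f : differentiable f v ->
  differentiable (fun v => q (f v) : C^o) v.
Proof.
move=> df; rewrite /qpow.
apply: (@differentiable_comp _ _ _ _
  (fun v => pi%:C * 'i%C * eta * f v : C^o) (@cexp R : C^o -> C^o)).
  apply: (@differentiableM _ _ (fun=> pi%:C * 'i%C * eta) f) => //.
exact: differentiable_cexp.
Qed.

Lemma differentiable_qnum f : differentiable f v ->
  differentiable (fun v => br (f v) : C^o) v.
Proof.
move=> df.
apply: (@differentiable_mul _ _ (fun v => q (f v) - q (- f v)) (fun=> D^-1)).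
  apply: differentiableB; first exact: differentiable_qpow.
  by apply: differentiable_qpow; exact: differentiableN.
exact: differentiable_const.
Qed.

Lemma differentiable_bigprod n (f : 'I_n -> V -> C^o) :
  (forall i, differentiable (f i) v) ->
  differentiable (fun v => \prod_(i < n) f i v : C^o) v.
Proof.
elim: n f => [|n IH] f df.
  have -> : (fun v => \prod_(i < 0) f i v : C^o) = cst 1.
    by apply/funext => u; rewrite big_ord0.
  exact: differentiable_const.
have -> : (fun v => \prod_(i < n.+1) f i v : C^o) =
    (fun v => (\prod_(i < n) f (widen_ord (leqnSn n) i) v) * f ord_max v).
  by apply/funext => u; rewrite big_ord_recr.
by apply: differentiable_mul => //; exact: IH.
Qed.

Lemma differentiable_vertex_coef (fl fL : V -> C^o) m k k' a :
  differentiable fl v -> differentiable fL v ->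
  differentiable (fun v => vc (fl v) (fL v) m k k' a : C^o) v.
Proof.
move=> dl dL; elim: k k' a => [|k IH] k' a.
  have [kam|N] := eqVneq (k' + a)%N m; last first.
    have -> : (fun v => vc (fl v) (fL v) m 0 k' a : C^o) = cst 0.
      by apply/funext => u; rewrite (vertex_coef_supp heta hPhi).
    exact: differentiable_const.
  have -> : (fun v => vc (fl v) (fL v) m 0 k' a : C^o) = (fun v =>
     q (k'%:R * (fl v - fL v + m.*2%:R - k'%:R)) *
     (\prod_(i < a) br (1 - (fl v - fL v + m.*2%:R) + k'%:R + i%:R)) *
     (qfact eta m / qfact eta a)).
    apply/funext => u; rewrite /vertex_coef (vertex_init heta (hPhi _ _ _)).
    by rewrite kam eqxx.
  have dw : differentiable (fun v => fl v - fL v + m.*2%:R : C^o) v.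
    by apply: differentiableD; [exact: differentiableB|exact: differentiable_const].
  apply: differentiable_mul; last exact: differentiable_const.
  apply: differentiable_mul.
    apply: differentiable_qpow; apply: differentiable_mul.
      exact: differentiable_const.
    by apply: differentiableB => //; exact: differentiable_const.
  apply: differentiable_bigprod => i; apply: differentiable_qnum.
  apply: differentiableD; last exact: differentiable_const.
  apply: differentiableD; last exact: differentiable_const.
  by apply: differentiableB => //; exact: differentiable_const.
have -> : (fun v => vc (fl v) (fL v) m k.+1 k' a : C^o) = (fun v =>
  (br k.+1%:R)^-1 * ((if k' is k1.+1 then br k'%:R * q (- (fL v - a.*2%:R)) *
      vc (fl v) (fL v) m k k1 a else 0) +
  (if a is a1.+1 then br (fL v - a1%:R) * vc (fl v) (fL v) m k k' a1 else 0))).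
  apply/funext => u; rewrite -(vertex_F (hPhi _ _ _)) mulKf //.
  exact: qnum_nat_neq0.
apply: differentiable_mul; first exact: differentiable_const.
apply: differentiableD.
  case: k' => [|k']; first exact: differentiable_const.
  apply: differentiable_mul; last exact: IH.
  apply: differentiable_mul; first exact: differentiable_const.
  apply: differentiable_qpow; apply: differentiableN.
  by apply: differentiableB => //; exact: differentiable_const.
case: a => [|a]; first exact: differentiable_const.
apply: differentiable_mul; last exact: IH.
apply: differentiable_qnum.
by apply: differentiableB => //; exact: differentiable_const.
Qed.

Lemma differentiable_drift (s : seq ((V -> C^o) * nat)) :
  (forall i, differentiable (nth (cst 0, 0%N) s i).1 v) ->
  differentiable (fun u => \sum_(j <- s) (j.1 u - j.2.*2%:R) : C^o) v.
Proof.
elim: s => [|j s IHs] ds.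
  rewrite (_ : (fun _ => _) = cst 0); first exact: differentiable_const.
  by apply/funext => u; rewrite big_nil.
rewrite (_ : (fun _ => _) =
   (fun u => (j.1 u - j.2.*2%:R) + \sum_(j0 <- s) (j0.1 u - j0.2.*2%:R))).
  apply: differentiableD; last by apply: IHs => i; exact: (ds i.+1).
  by apply: differentiableB; [exact: (ds 0%N)|exact: differentiable_const].
by apply/funext => u; rewrite big_cons.
Qed.

Lemma differentiable_product_coef lam (s : seq ((V -> C^o) * nat)) t k :
  (forall i, differentiable (nth (cst 0, 0%N) s i).1 v) ->
  differentiable (fun v => vprod lam [seq (p.1 v, p.2) | p <- s] t k : C^o) v.
Proof.
move=> ds; elim: s ds t => [|p s IH] ds [|a t] /=; try exact: differentiable_const.
have ds' i : differentiable (nth (cst 0, 0%N) s i).1 v by exact: (ds i.+1).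
apply: differentiable_mul; first exact: IH.
have E u : [seq j.2 | j <- [seq (j.1 u, j.2) | j <- s]] = map snd s.
  by rewrite -map_comp; apply: eq_map => j.
have -> : (fun u => vc
   (lam - \sum_(p' <- [seq (j.1 u, j.2) | j <- s]) (p'.1 - p'.2.*2%:R)) (p.1 u) p.2
   (outidx [seq (j.1 u, j.2) | j <- s] t k)
   (outidx ((p.1 u, p.2) :: [seq (j.1 u, j.2) | j <- s]) (a :: t) k) a : C^o) =
  (fun u => vc (lam - \sum_(j <- s) (j.1 u - j.2.*2%:R)) (p.1 u) p.2
   (k + sumn (map snd s) - sumn t)%N
   (k + (p.2 + sumn (map snd s)) - (a + sumn t))%N a).
  by apply/funext => u; rewrite /outidx /= E big_map.
apply: differentiable_vertex_coef; last exact: (ds 0%N).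
apply: differentiableB; first exact: differentiable_const.
exact: differentiable_drift.
Qed.

End Differentiability.

End EntryStructure.

(** * Resonance relations and lowest coefficients of products *)

Section ResonanceOfProducts.
Variables (R : realType) (eta : R[i]).
Hypothesis heta : 0 < complex.Im eta.
Local Notation C := R[i].
Local Notation q := (qpow eta).
Local Notation qf := (qfact eta).
Variable Phi :
  C -> C -> nat -> {linear {freeg nat / C} -> {freeg (nat * nat) / C}}.
Hypothesis hPhi :
  forall lam Lam m, is_vertex_operator eta lam Lam m (Phi lam Lam m).
Local Notation vc := (vertex_coef Phi).
Local Notation vprod := (product_coef Phi).
Implicit Types (p r : C * nat) (s : seq (C * nat)) (t : seq nat) (d k : nat).

Definition drift s : C := \sum_(p <- s) (p.1 - p.2.*2%:R).
Definition height s : nat := sumn (map snd s).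

Lemma product_coef_consE lam p s a t k : vprod lam (p :: s) (a :: t) k =
  vprod lam s t k * vc (lam - drift s) p.1 p.2 (k + height s - sumn t)%N
     (k + (p.2 + height s) - (a + sumn t))%N a.
Proof. by []. Qed.

Lemma drift_cons p s : drift (p :: s) = p.1 - p.2.*2%:R + drift s.
Proof. by rewrite /drift big_cons. Qed.

Lemma drift_cat s s' : drift (s ++ s') = drift s + drift s'.
Proof. by rewrite /drift big_cat. Qed.

Lemma height_cat s s' : height (s ++ s') = (height s + height s')%N.
Proof. by rewrite /height map_cat sumn_cat. Qed.

Lemma product_coef_head_eq lam s1 s s' t k :
  (forall t, vprod lam s t k = vprod lam s' t k) ->
  drift s = drift s' -> height s = height s' ->
  vprod lam (s1 ++ s) t k = vprod lam (s1 ++ s') t k.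
Proof.
move=> E Ed Eh; elim: s1 t => [|p s1 IH] [|a t] //.
by rewrite !cat_cons !product_coef_consE IH !drift_cat !height_cat Ed Eh.
Qed.

(** [vertex_coef_target] for the last factor applied, the head of the
    list. *)
Lemma product_coef_target lam p s a t k d : lam - drift (p :: s) = - d%:R ->
  (a + sumn t <= k + (p.2 + height s))%N ->
  vprod lam ((p.1, (p.2 + d)%N) :: s) (a :: t) k *
    qf (k + (p.2 + height s) - (a + sumn t)) =
  vprod lam (p :: s) (a :: t) k *
    qf (k + (p.2 + height s) - (a + sumn t) + d).
Proof.
move=> wE le; rewrite !product_coef_consE /=.
have -> : (k + (p.2 + d + height s) - (a + sumn t) =
  k + (p.2 + height s) - (a + sumn t) + d)%N by lia.
rewrite -mulrA (vertex_coef_target heta hPhi); first by rewrite mulrA.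
by rewrite -wE drift_cons; ring.
Qed.

Lemma product_coef_target0 lam p s a t k d : lam - drift (p :: s) = - d%:R ->
  (k + (p.2 + height s) < a + sumn t)%N ->
  vprod lam ((p.1, (p.2 + d)%N) :: s) (a :: t) k = 0.
Proof.
move=> wE lt; have [neg|le] := ltnP (k + height s) (sumn t).
  by rewrite product_coef_consE (product_coef_neg heta hPhi lam neg) mul0r.
rewrite product_coef_consE /=.
have [le'|lt'] := leqP (a + sumn t) (k + (p.2 + d + height s)).
  rewrite (vertex_coef_target0 heta hPhi) ?mulr0 //; last by lia.
  by rewrite -wE drift_cons; ring.
by rewrite (vertex_coef_supp heta hPhi) ?mulr0 //; lia.
Qed.

(** Both sides factor through the embedding inserted between the factors
    [r] and [p]. *)
Lemma product_coef_resonance lam s1 p r s2 t k d : (d <= p.2)%N ->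
  lam - drift (r :: s2) = - d%:R ->
  vprod lam (s1 ++ p :: r :: s2) t k =
  vprod lam (s1 ++ (p.1, (p.2 - d)%N) :: (r.1, (r.2 + d)%N) :: s2) t k.
Proof.
move=> dp wE.
have dE : drift ((r.1, (r.2 + d)%N) :: s2) = drift (r :: s2) - (d + d)%:R.
  by rewrite !drift_cons /= doubleD natrD -!addnn !natrD; ring.
apply: product_coef_head_eq; last 2 first.
- by rewrite drift_cons [in RHS]drift_cons dE /= doubleB natrB ?leq_double //
    -!addnn !natrD; ring.
- by rewrite /height /=; lia.
case=> [|a [|b t']] //; first by rewrite !product_coef_consE /= !mul0r.
rewrite product_coef_consE [RHS]product_coef_consE dE wE.
have -> : lam - (drift (r :: s2) - (d + d)%:R) = d%:R.
  by rewrite opprB addrCA wE natrD; ring.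
rewrite [height _]/= [height (_ :: s2)]/= -/(height s2) [sumn (b :: t')]/=.
have -> : (k + (p.2 + (r.2 + height s2)) - (a + (b + sumn t')) =
   k + (p.2 - d + (r.2 + d + height s2)) - (a + (b + sumn t')))%N by lia.
rewrite [(p.1, _).1]/= [(p.1, _).2]/=.
set k1 := (k + (p.2 - d + _) - _)%N.
have [le|lt] := leqP (b + sumn t') (k + (r.2 + height s2)); last first.
  rewrite (product_coef_target0 wE lt) mul0r product_coef_consE.
  have [neg|le'] := ltnP (k + height s2) (sumn t').
    by rewrite (product_coef_neg heta hPhi lam neg) !mul0r.
  by rewrite [vc _ r.1 _ _ _ _](vertex_coef_supp heta hPhi) ?mulr0 ?mul0r //; lia.
(* Both factors change by the scalar of the embedding at the index [k2]. *)
have T := product_coef_target wE le.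
set k2 := (k + (r.2 + height s2) - (b + sumn t'))%N in T *.
have -> : (k + (r.2 + d + height s2) - (b + sumn t') = k2 + d)%N.
  by rewrite /k2; lia.
have S := vertex_coef_source heta hPhi p.1 k2 k1 a dp.
apply: (mulIf (qfact_neq0 heta k2)); apply: (mulIf (qfact_neq0 heta (k2 + d))).
move: T S; set A := vprod _ (r :: s2) _ _; set A' := vprod _ _ _ _.
set B := vc _ _ _ _ _ _; set B' := vc _ _ _ _ _ _ => T S.
have -> : A * B * qf k2 * qf (k2 + d) = (A * qf (k2 + d)) * (B * qf k2) by ring.
by rewrite -T S; ring.
Qed.

(** [vertex_coef_source] for the first factor applied, the end of the
    list. *)
Lemma product_coef_source s p t k d : (d <= p.2)%N ->
  vprod (- d%:R) (rcons s p) t k * qf k =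
  vprod d%:R (rcons s (p.1, (p.2 - d)%N)) t (k + d) * qf (k + d).
Proof.
move=> dp; elim: s t => [|r s IH] [|a t]; rewrite ?rcons_cons;
  try by rewrite /= !mul0r.
  rewrite /rcons !product_coef_consE /drift big_nil !subr0 /height /=.
  case: t => [|b t]; last by rewrite !mul0r.
  rewrite !mul1r /= !addn0 !subn0 (vertex_coef_source heta hPhi _ _ _ _ dp).
  by congr (vc _ _ _ _ _ _ * _); lia.
rewrite !product_coef_consE mulrAC IH mulrAC; congr (_ * _ * _).
have dE : drift (rcons s p) = drift (rcons s (p.1, (p.2 - d)%N)) - (d + d)%:R.
  rewrite -!cats1 !drift_cat !drift_cons /= doubleB natrB ?leq_double //.
  by rewrite -!addnn !natrD; ring.
have hE : (height (rcons s p) = d + height (rcons s (p.1, (p.2 - d)%N)))%N.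
  by rewrite -!cats1 !height_cat /height /=; lia.
rewrite dE hE; congr (vc _ _ _ _ _ _).
- by rewrite natrD; ring.
- lia.
- lia.
Qed.

Definition addhead d s : seq (C * nat) :=
  if s is p :: s' then (p.1, (p.2 + d)%N) :: s' else [::].

(** Moving the embedding from the source of the product to its target.  It
    maps the index [k] of the small module to the index [k + d] of the large
    one, whence the shift. *)
Lemma product_coef_cyclic s p t k d : (d <= p.2)%N -> drift (rcons s p) = 0 ->
  height (rcons s p) = sumn t ->
  vprod d%:R (addhead d (rcons s (p.1, (p.2 - d)%N))) t (k + d) =
  vprod (- d%:R) (rcons s p) t k.
Proof.
move=> dp D0 H0; apply: (mulIf (qfact_neq0 heta k)); rewrite product_coef_source //.
have dE : drift (rcons s (p.1, (p.2 - d)%N)) = (d + d)%:R.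
  apply/eqP; rewrite -subr_eq0 -{1}D0 -!cats1 !drift_cat !drift_cons /=.
  by rewrite doubleB natrB ?leq_double // -!addnn !natrD; apply/eqP; ring.
have hE : (height (rcons s (p.1, (p.2 - d)%N)) + d = sumn t)%N.
  by rewrite -H0 -!cats1 !height_cat /height /=; lia.
move: dE hE; rewrite headI; set r := head _ _; set s' := behead _ => dE hE.
case: t hE {H0} => [|a t] hE; first by rewrite /= !mul0r.
have wE : d%:R - drift (r :: s') = - d%:R by rewrite dE natrD; ring.
have le : (a + sumn t <= k + d + (r.2 + height s'))%N.
  by move: hE; rewrite /height /=; lia.
have := product_coef_target wE le.
have -> : (k + d + (r.2 + height s') - (a + sumn t) = k)%N.
  by move: hE; rewrite /height /=; lia.
by [].
Qed.

(** The diagonal coefficients of the large module outside the image of the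
    embedding. *)
Lemma product_coef_cyclic0 s p t k d : (d <= p.2)%N -> drift (rcons s p) = 0 ->
  height (rcons s p) = sumn t -> (k < d)%N ->
  vprod d%:R (addhead d (rcons s (p.1, (p.2 - d)%N))) t k = 0.
Proof.
move=> dp D0 H0 kd.
have dE : drift (rcons s (p.1, (p.2 - d)%N)) = (d + d)%:R.
  apply/eqP; rewrite -subr_eq0 -{1}D0 -!cats1 !drift_cat !drift_cons /=.
  by rewrite doubleB natrB ?leq_double // -!addnn !natrD; apply/eqP; ring.
have hE : (height (rcons s (p.1, (p.2 - d)%N)) + d = sumn t)%N.
  by rewrite -H0 -!cats1 !height_cat /height /=; lia.
move: dE hE; rewrite headI; set r := head _ _; set s' := behead _ => dE hE.
case: t hE {H0} => [|a t] hE; first by [].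
have wE : d%:R - drift (r :: s') = - d%:R by rewrite dE natrD; ring.
by apply: (product_coef_target0 wE); move: hE; rewrite /height /=; lia.
Qed.

End ResonanceOfProducts.

Section LowestCoefficient.
Variables (R : realType) (eta : R[i]).
Hypothesis heta : 0 < complex.Im eta.
Local Notation C := R[i].
Local Notation q := (qpow eta).
Local Notation D := (q 1 - q (- 1)).

Lemma low0E (Lam : C) m :
  low0 eta Lam m * D ^+ m = q (m%:R * (Lam - m.*2%:R) + (m * m.+1)%:R / 2).
Proof.
rewrite /low0 (eq_bigr (fun j : 'I_m => q (Lam - m.*2%:R + j.+1%:R) / D)).
  2: by move=> j _; rewrite -[j.+1%:R]natr1; congr (q _ / _); ring.
move: (Lam - m.*2%:R) => c.
elim: m => [|m IH].
  by rewrite big_ord0 expr0 mulr1 !mul0r addr0 qpow0.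
have -> : m.+1%:R * c + (m.+1 * m.+2)%:R / 2 =
   (m%:R * c + (m * m.+1)%:R / 2) + (c + m.+1%:R).
  by rewrite !natrM -!natr1; field.
rewrite qpowD -IH big_ord_recr exprS /=.
have := qdiff1_neq0 heta; set d := D => d0; set P := \prod_(_ < _) _.
by field.
Qed.

Fixpoint lowexp (s : seq (C * nat)) : C :=
  if s is p :: s' then
    lowexp s' + (p.2%:R * drift s' +
      (p.2%:R * (p.1 - p.2.*2%:R) + (p.2 * p.2.+1)%:R / 2))
  else 0.

Lemma lowcoefE s : lowcoef eta s * D ^+ height s = q (lowexp s).
Proof.
elim: s => [|p s IH] /=; first by rewrite expr0 mulr1 qpow0.
rewrite (qpowD eta (lowexp s)) (qpowD eta (p.2%:R * drift s)) -IH -low0E.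
by rewrite exprD /drift /height; ring.
Qed.

Fixpoint xiexp (c : C) (s : seq (C * nat)) : C :=
  if s is p :: s' then p.2%:R * c + xiexp (c + (p.1 - p.2%:R)) s' else 0.

(** The identity behind the form of [Xi].  A start value [c] is needed for
    the induction, since [xiexp] runs over partial sums from the left and
    [lowexp] over partial sums from the right. *)
Lemma lowexp_xiexp c s : lowexp s + xiexp c s =
  (height s)%:R * (c + drift s) + (height s * (height s).+1)%:R / 2.
Proof.
elim: s c => [|p s IH] c; first by rewrite /= !mul0r !addr0.
have := IH (c + (p.1 - p.2%:R)); rewrite drift_cons => {}IH.
rewrite /= -/(height s).
have -> : xiexp (c + (p.1 - p.2%:R)) s =
   (height s)%:R * (c + (p.1 - p.2%:R) + drift s) +
     (height s * (height s).+1)%:R / 2 - lowexp s by rewrite -IH; ring.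
have -> : height (p :: s) = (p.2 + height s)%N by [].
by rewrite -mul2n !natrM !natrD -![_.+1%:R]natr1 natrD; field.
Qed.

Lemma xiexp_enum n (L : 'I_n -> C) (m : 'I_n -> nat) c :
  xiexp c [seq (L i, m i) | i <- enum 'I_n] =
  \sum_(j < n) (m j)%:R * (c + \sum_(i < n | (i < j)%N) (L i - (m i)%:R)).
Proof.
elim: n L m c => [|n IH] L m c; first by rewrite enum_ord0 big_ord0.
rewrite enum_ordSl big_ord_recl /= big1 ?addr0 //; congr (_ + _).
rewrite -map_comp.
rewrite (IH (fun i => L (fintype.lift ord0 i)) (fun i => m (fintype.lift ord0 i))).
apply: eq_bigr => j _; congr (_ * _); rewrite -addrA; congr (_ + _).
by rewrite [in RHS]big_mkcond big_ord_recl /= -big_mkcond.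
Qed.

End LowestCoefficient.

(** * Generating functions with geometric tails *)

Section GeneratingFunction.
Variables (K : fieldType) (D : nat) (y : nat -> K).
Hypothesis y0 : forall c, y c != 0.
Implicit Types (e : nat -> K) (t : K) (N : nat).

(** The common denominator of the series of coefficients [y c ^+ k]. *)
Definition denom : {poly K} := \prod_(c < D) (1 - y c *: 'X).

Lemma size_denom : (size denom <= D.+1)%N.
Proof.
rewrite /denom; elim: D => [|d IH]; first by rewrite big_ord0 size_poly1.
rewrite big_ord_recr /=; apply: leq_trans (size_polyMleq _ _) _.
have : (size (1 - y d *: 'X : {poly K})%R <= 2)%N.
  apply: leq_trans (size_polyD _ _) _; rewrite size_polyN geq_max size_poly1 /=.
  by apply: leq_trans (size_scale_leq _ _) _; rewrite size_polyX.
move=> s2; apply: (@leq_trans (d.+1 + 2).-1); last by rewrite addn2.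
by rewrite -!subn1 leq_sub2r // leq_add.
Qed.

Lemma denomE t : denom.[t] = \prod_(c < D) (1 - y c * t).
Proof.
rewrite /denom horner_prod; apply: eq_bigr => c _.
by rewrite hornerD hornerN hornerZ hornerX hornerC.
Qed.

Lemma denom_root c : (c < D)%N -> denom.[(y c)^-1] = 0.
Proof.
move=> cD; rewrite denomE (bigD1 (Ordinal cD)) //= mulfV ?y0 //.
by rewrite subrr mul0r.
Qed.

Definition psum e t N : K := \sum_(k < N) t ^+ k * e k.

(** The partial sum of order [N] of the series with coefficients [e],
    multiplied by the denominator and truncated at degree [N] in [t].  It
    is a finite linear combination of values of [e], so that it inherits
    their properties. *)
Definition numer N e t : K :=
  \sum_(j < D.+1) denom`_j * t ^+ j * psum e t (N - j)%N.

Definition expsum K0 e := exists a : nat -> K,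
  forall k, e (k + K0)%N = \sum_(c < D) a c * y c ^+ k.

(** The recurrence with characteristic polynomial [denom], whose roots
    are the inverses of the [y c]. *)
Lemma expsum_annihilated K0 e N : expsum K0 e -> (K0 + D <= N)%N ->
  \sum_(j < D.+1) denom`_j * e (N - j)%N = 0.
Proof.
move=> [a E] N0.
have E1 (j : 'I_D.+1) : denom`_j * e (N - j)%N =
    \sum_(c < D) a c * y c ^+ (N - K0) * (denom`_j * (y c)^-1 ^+ j).
  have jD := ltn_ord j.
  have -> : (N - j = (N - K0 - j) + K0)%N by lia.
  rewrite E mulr_sumr; apply: eq_bigr => c _.
  have -> : y c ^+ (N - K0) = y c ^+ (N - K0 - j) * y c ^+ j.
    by rewrite -exprD; congr (_ ^+ _); lia.
  rewrite exprVn; field; exact: expf_neq0.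
rewrite (eq_bigr _ (fun j _ => E1 j)) exchange_big /= big1 // => c _.
by rewrite -mulr_sumr -(horner_coef_wide _ size_denom) denom_root // mulr0.
Qed.

Lemma numerS N e t : (D <= N)%N -> numer N.+1 e t =
  numer N e t + t ^+ N * \sum_(j < D.+1) denom`_j * e (N - j)%N.
Proof.
move=> DN; rewrite /numer mulr_sumr -big_split /=; apply: eq_bigr => j _.
have jN : (j <= N)%N by apply: leq_trans DN; rewrite -ltnS.
rewrite subSn // /psum big_ord_recr /= mulrDr; congr (_ + _).
have -> : t ^+ N = t ^+ j * t ^+ (N - j) by rewrite -exprD subnKC.
by ring.
Qed.

Lemma numer_stable K0 e t N : expsum K0 e -> (K0 + D <= N)%N ->
  numer N e t = numer (K0 + D) e t.
Proof.
move=> He; elim: N => [|N IH] le; first by congr (numer _ _ _); lia.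
move: le; rewrite leq_eqVlt => /orP[/eqP -> //|le].
rewrite numerS ?(expsum_annihilated He) ?mulr0 ?addr0 ?IH //; lia.
Qed.

Lemma psum_shift e e' t d N :
  (forall k, e' (k + d)%N = e k) -> (forall k, (k < d)%N -> e' k = 0) ->
  psum e' t N = t ^+ d * psum e t (N - d)%N.
Proof.
move=> E E0; elim: N => [|N IH]; first by rewrite /psum !big_ord0 mulr0.
rewrite {1}/psum big_ord_recr /= -/(psum e' t N) IH.
have [Nd|dN] := ltnP N d.
  by rewrite E0 // mulr0 addr0; congr (_ * psum _ _ _); lia.
rewrite subSn // [in RHS]/psum big_ord_recr /= mulrDr -/(psum e t _); congr (_ + _).
by rewrite -{2}(subnK dN) E mulrA -exprD subnKC.
Qed.

Lemma numer_shift e e' t d N :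
  (forall k, e' (k + d)%N = e k) -> (forall k, (k < d)%N -> e' k = 0) ->
  numer N e' t = t ^+ d * numer (N - d) e t.
Proof.
move=> E E0; rewrite /numer mulr_sumr; apply: eq_bigr => j _.
by rewrite (psum_shift _ _ E E0) subnAC mulrCA.
Qed.

Lemma psum_geometric t N : psum (fun=> 1) t N * (1 - t) = 1 - t ^+ N.
Proof.
elim: N => [|N IH]; first by rewrite /psum big_ord0 mul0r subrr.
rewrite /psum big_ord_recr /= mulrDl -/(psum _ t N) IH exprS; ring.
Qed.

(** For the series with all coefficients [1] both sides can be computed
    from partial geometric sums. *)
Lemma numer_geometric t N : (D <= N)%N -> denom.[1] = 0 ->
  numer N (fun=> 1) t * (1 - t) = denom.[t].
Proof.
move=> DN d1; rewrite /numer mulr_suml.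
have E (j : 'I_D.+1) : denom`_j * t ^+ j * psum (fun=> 1) t (N - j) * (1 - t) =
    denom`_j * t ^+ j - t ^+ N * (denom`_j * 1 ^+ j).
  have jN : (j <= N)%N by apply: leq_trans DN; rewrite -ltnS.
  rewrite -mulrA psum_geometric expr1n.
  have -> : t ^+ N = t ^+ j * t ^+ (N - j) by rewrite -exprD subnKC.
  by ring.
rewrite (eq_bigr _ (fun j _ => E j)) sumrB -mulr_sumr.
by rewrite -!(horner_coef_wide _ size_denom) d1 mulr0 subr0.
Qed.

Lemma numerZ c e t N : numer N (fun k => c * e k) t = c * numer N e t.
Proof.
rewrite /numer mulr_sumr; apply: eq_bigr => j _; rewrite mulrCA; congr (_ * _).
by rewrite /psum mulr_sumr; apply: eq_bigr => k _; rewrite mulrCA.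
Qed.

Lemma eq_numer e e' t N : e =1 e' -> numer N e t = numer N e' t.
Proof.
move=> E; apply: eq_bigr => j _; congr (_ * _).
by apply: eq_bigr => k _; rewrite E.
Qed.

End GeneratingFunction.

Section GeneratingLimit.
Variables (R : realType) (D : nat) (y : nat -> R[i]).
Local Notation C := R[i].
Hypothesis y0 : forall c, y c != 0.

Lemma cvg_sum_ord d (f : 'I_d -> nat -> C^o) (l : 'I_d -> C^o) :
  (forall j, f j @ \oo --> l j) ->
  (fun N => \sum_(j < d) f j N) @ \oo --> \sum_(j < d) l j.
Proof.
elim: d f l => [|d IH] f l fl.
  rewrite big_ord0 (_ : (fun _ => _) = cst 0); first exact: cvg_cst.
  by apply/funext => N; rewrite big_ord0.
rewrite big_ord_recr /= (_ : (fun _ => _) =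
  (fun N => \sum_(j < d) f (widen_ord (leqnSn d) j) N + f ord_max N)).
  by apply: cvgD => //; exact: IH.
by apply/funext => N; rewrite big_ord_recr.
Qed.

(** Multiplying the limit by each monomial of the denominator shifts the
    partial sums; their combination is [numer], which is eventually
    constant. *)
Lemma psum_limit K0 e t (T : C^o) : expsum D y K0 e ->
  (psum e t : nat -> C^o) @ \oo --> T ->
  (denom D y).[t] * T = numer D y (K0 + D) e t.
Proof.
move=> He cT.
have c1 : ((fun N => numer D y N e t) : nat -> C^o) @ \oo -->
    ((denom D y).[t] * T : C^o).
  rewrite (horner_coef_wide _ (size_denom D y)) mulr_suml.
  apply: cvg_sum_ord => j; apply: cvgM; first exact: cvg_cst.
  have := cT; rewrite -(cvg_centern j); exact.
have c2 : ((fun N => numer D y N e t) : nat -> C^o) @ \oo -->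
    (numer D y (K0 + D) e t : C^o).
  apply: cvg_near_cst; exists (K0 + D)%N => // N /= le.
  by rewrite (numer_stable y0 _ He le).
exact: (cvg_unique _ c1 c2).
Qed.

End GeneratingLimit.

(** * Diagonal coefficients of the trace *)

Section OrdinalEnumeration.
Variable n : nat.

Lemma mem_take_enum p (i : 'I_n) : i \in take p (enum 'I_n) -> (i < p)%N.
Proof.
move=> /(map_f val); rewrite map_take val_enum_ord take_iota mem_iota add0n.
by rewrite leq_min => /andP[_ /andP[]].
Qed.

Lemma mem_drop_enum p (i : 'I_n) : i \in drop p (enum 'I_n) -> (p <= i)%N.
Proof.
move=> /(map_f val); rewrite map_drop val_enum_ord drop_iota mem_iota add0n.
by move=> /andP[].
Qed.

Lemma drop_enum (j : 'I_n) : drop j (enum 'I_n) = j :: drop j.+1 (enum 'I_n).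
Proof. by rewrite (drop_nth j) ?size_enum_ord // nth_ord_enum. Qed.

Lemma sum_gt_enum (V : nmodType) (p : nat) (F : 'I_n -> V) :
  \sum_(i < n | (p < i)%N) F i = \sum_(i <- drop p.+1 (enum 'I_n)) F i.
Proof.
rewrite big_mkcond -[LHS]big_enum /= -{1}(cat_take_drop p.+1 (enum 'I_n)).
rewrite big_cat /=.
rewrite big1_seq ?add0r => [|i /andP[_ /mem_take_enum]]; last first.
  by rewrite ltnS leqNgt => /negPf ->.
by apply: eq_big_seq => i /mem_drop_enum ->.
Qed.

End OrdinalEnumeration.

Section TraceEntries.
Variables (R : realType) (eta : R[i]).
Hypothesis heta : 0 < complex.Im eta.
Local Notation C := R[i].
Local Notation q := (qpow eta).
Variable Phi :
  C -> C -> nat -> {linear {freeg nat / C} -> {freeg (nat * nat) / C}}.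
Hypothesis hPhi :
  forall lam Lam m, is_vertex_operator eta lam Lam m (Phi lam Lam m).
Variables (n M : nat).
Implicit Types (Lam : 'rV[C]_n) (m : n.-tuple nat).

Definition wlist Lam m : seq (C * nat) :=
  [seq (Lam 0 i, tnth m i) | i <- enum 'I_n].

Definition trace_entry lam Lam m m' k := product_coef Phi lam (wlist Lam m) m' k.

Lemma wlist_snd Lam m : map snd (wlist Lam m) = m.
Proof.
rewrite /wlist -map_comp -[RHS]map_tnth_enum.
by apply: eq_map => i.
Qed.

Lemma height_wlist Lam m : height (wlist Lam m) = sumn m.
Proof. by rewrite /height wlist_snd. Qed.

Lemma sumn_tnth m : sumn m = (\sum_(i < n) tnth m i)%N.
Proof. by rewrite sumnE big_tuple. Qed.

Lemma drift_wlist Lam m : weights M Lam -> compositions M m ->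
  drift (wlist Lam m) = 0.
Proof.
rewrite /weights /= => SL /eqP Sm; rewrite /drift /wlist big_map big_enum /=.
rewrite sumrB SL; apply/eqP; rewrite subr_eq0 -Sm sumn_tnth; apply/eqP.
rewrite -mul2n natrM natr_sum mulr_sumr; apply: eq_bigr => i _.
by rewrite -mul2n natrM.
Qed.

Lemma tnth_tau (j : 'I_n) d m i : tnth (tau j d m) i =
  (tnth m i + d * (i == ordS j) - d * (i == j))%N.
Proof. by rewrite tnth_mktuple. Qed.

Lemma trace_entry_resonance Lam m m' k (j : 'I_n) d : (d <= tnth m j)%N ->
  (j.+1 < n)%N ->
  let c := - d%:R + \sum_(i < n | (j < i)%N) (Lam 0 i - (tnth m i).*2%:R) in
  trace_entry c Lam m m' k = trace_entry c Lam (tau j d m) m' k.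
Proof.
move=> dm jn c.
have Sj : ordS j = j.+1 :> nat by rewrite /= modn_small.
have Sjj : (ordS j == j) = false by apply/negP => /eqP E; move: Sj; rewrite E; lia.
have dE : drop j.+1 (enum 'I_n) = ordS j :: drop j.+2 (enum 'I_n).
  by rewrite -{1}Sj drop_enum Sj.
have eE : enum 'I_n = take j (enum 'I_n) ++ j :: ordS j :: drop j.+2 (enum 'I_n).
  by rewrite -{1}(cat_take_drop j (enum 'I_n)) drop_enum dE.
pose f m i := (Lam 0 i, tnth m i).
have E1 : wlist Lam m = map (f m) (take j (enum 'I_n)) ++
   (Lam 0 j, tnth m j) :: (Lam 0 (ordS j), tnth m (ordS j)) ::
   map (f m) (drop j.+2 (enum 'I_n)).
  by rewrite /wlist {1}eE map_cat.
have E2 : wlist Lam (tau j d m) = map (f m) (take j (enum 'I_n)) ++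
   (Lam 0 j, (tnth m j - d)%N) :: (Lam 0 (ordS j), (tnth m (ordS j) + d)%N) ::
   map (f m) (drop j.+2 (enum 'I_n)).
  rewrite /wlist {1}eE map_cat /= !tnth_tau !eqxx Sjj [j == _]eq_sym Sjj.
  rewrite !muln0 !muln1 addn0 subn0; congr (_ ++ _ :: _ :: _).
    apply/eq_in_map => i /mem_take_enum ij; rewrite /f tnth_tau.
    have -> : (i == j) = false by apply/eqP => iE; move: ij; rewrite iE; lia.
    have -> : (i == ordS j) = false.
      by apply/eqP => iE; move: ij; rewrite iE Sj; lia.
    by rewrite !muln0 addn0 subn0.
  apply/eq_in_map => i /mem_drop_enum ij; rewrite /f tnth_tau.
  have -> : (i == j) = false by apply/eqP => iE; move: ij; rewrite iE; lia.
  have -> : (i == ordS j) = false.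
    by apply/eqP => iE; move: ij; rewrite iE Sj; lia.
  by rewrite !muln0 addn0 subn0.
rewrite /trace_entry E1 E2; apply: (product_coef_resonance heta hPhi) => //.
rewrite /c sum_gt_enum dE.
rewrite -[_ :: map _ _]/(map (f m) (ordS j :: drop j.+2 (enum 'I_n))).
by rewrite /drift big_map /f /= addrK.
Qed.

Section LastIndex.
Variables (Lam : 'rV[C]_n) (m m' : n.-tuple nat) (j : 'I_n) (d : nat).
Hypotheses (hLam : weights M Lam) (hm : compositions M m)
  (hm' : compositions M m') (dm : (d <= tnth m j)%N) (jn : (n <= j.+1)%N).

Let jE : j.+1 = n. Proof. by apply/eqP; rewrite eqn_leq jn ltn_ord. Qed.

(** For the last index, [tau] lowers the end of the list and raises its head;
    for [n = 1] both changes affect the same entry. *)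
Lemma wlist_last : exists s, wlist Lam m = rcons s (Lam 0 j, tnth m j) /\
  wlist Lam (tau j d m) = addhead d (rcons s (Lam 0 j, (tnth m j - d)%N)).
Proof.
have Sj : ordS j = 0%N :> nat by rewrite /= jE modnn.
have eE : enum 'I_n = rcons (take j (enum 'I_n)) j.
  rewrite -{1}(cat_take_drop j (enum 'I_n)) drop_enum.
  by rewrite drop_oversize ?cats1 // size_enum_ord.
have eE0 : enum 'I_n = ordS j :: drop 1 (enum 'I_n).
  by rewrite -{1}[enum 'I_n]drop0 -Sj drop_enum Sj.
exists [seq (Lam 0 i, tnth m i) | i <- take j (enum 'I_n)]; split.
  by rewrite /wlist {1}eE map_rcons.
have -> : rcons [seq (Lam 0 i, tnth m i) | i <- take j (enum 'I_n)]
    (Lam 0 j, (tnth m j - d)%N) =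
    [seq (Lam 0 i, (tnth m i - d * (i == j))%N) | i <- enum 'I_n].
  rewrite [in RHS]eE map_rcons eqxx muln1; congr rcons.
  apply/eq_in_map => i /mem_take_enum ij.
  have -> : (i == j) = false by apply/eqP => iE; move: ij; rewrite iE; lia.
  by rewrite muln0 subn0.
rewrite /wlist eE0 /= tnth_tau eqxx muln1; congr cons.
  congr pair; case: (ordS j =P j) => [E|_]; last by rewrite !muln0 !subn0.
  by rewrite !muln1 E addnK subnK.
apply/eq_in_map => i /mem_drop_enum ij; rewrite tnth_tau.
have -> : (i == ordS j) = false by apply/eqP => iE; move: ij; rewrite iE Sj.
by rewrite muln0 addn0.
Qed.

Lemma trace_entry_cyclic k :
  trace_entry d%:R Lam (tau j d m) m' (k + d) = trace_entry (- d%:R) Lam m m' k.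
Proof.
have [s [E1 E2]] := wlist_last; rewrite /trace_entry E2 E1.
apply: (product_coef_cyclic heta hPhi (p := (Lam 0 j, tnth m j))) => //;
  rewrite -E1; first exact: drift_wlist.
by rewrite height_wlist; move: hm hm' => /eqP -> /eqP ->.
Qed.

Lemma trace_entry_cyclic0 k : (k < d)%N ->
  trace_entry d%:R Lam (tau j d m) m' k = 0.
Proof.
move=> kd; have [s [E1 E2]] := wlist_last; rewrite /trace_entry E2.
apply: (product_coef_cyclic0 heta hPhi (p := (Lam 0 j, tnth m j))) => //;
  rewrite -E1; first exact: drift_wlist.
by rewrite height_wlist; move: hm hm' => /eqP -> /eqP ->.
Qed.

End LastIndex.

Lemma trace_psumE lam x Lam m m' N : compositions M m -> compositions M m' ->
  trace_psum eta Phi lam x Lam m m' N =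
  q (x * (lam - 1)) * psum (trace_entry lam Lam m m') (q (- (x *+ 2))) N.
Proof.
move=> /eqP hm /eqP hm'; rewrite /trace_psum /psum mulr_sumr.
apply: eq_bigr => k _.
have -> : uK (verma eta (lam - 1)) x << val k >> =
    q (x * (lam - 1 - (val k).*2%:R)) *: << val k >> :> {freeg nat / C}.
  by rewrite /= fgliftB.
rewrite linearZ coeffZ /= (coeff_vertex_product heta hPhi).
rewrite wlist_snd hm hm' eqxx -qpowMn mulrA -qpowD /trace_entry; congr (q _ * _).
by rewrite -mul2n natrM -[_ *+ k]mulr_natr -[x *+ 2]mulr_natr; ring.
Qed.

Definition nroots : nat := (8 * M).+1.
Definition rootq (c : nat) : C := q (c%:R - (6 * M)%:R).

Lemma rootq_neq0 c : rootq c != 0. Proof. exact: qpow_neq0. Qed.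

(** The weights add up to [2 M], so that the exponents are the integers
    from [- 6 M] to [2 M].  Starting at [k = 2 M] keeps every intermediate
    index nonnegative. *)
Lemma trace_entry_expsum lam Lam m m' : weights M Lam -> compositions M m ->
  compositions M m' -> expsum nroots rootq (2 * M) (trace_entry lam Lam m m').
Proof.
move=> hL /eqP hm /eqP hm'.
have d0 : (sumn m' <= 2 * M)%N by rewrite hm'; lia.
have [b [P [sP _ PE]]] := epoly_product_coef heta hPhi lam (wlist Lam m) d0.
exists (fun c => P`_c) => k; rewrite /trace_entry PE.
move: sP; rewrite wlist_snd hm hm' => sP.
have sP' : (size P <= nroots)%N by apply: leq_trans sP _; rewrite /nroots; lia.
have -> : \sum_(p <- wlist Lam m) p.1 = M.*2%:R.
  by rewrite /wlist big_map big_enum.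
rewrite (horner_coef_wide _ sP') mulr_sumr; apply: eq_bigr => c _.
rewrite mulrCA; congr (_ * _); rewrite /rootq -!qpowMn -qpowD; congr q.
rewrite -(mulr_natr k%:R c) -(mulr_natr (c%:R - (6 * M)%:R) k).
by rewrite -mul2n natrD !natrM; ring.
Qed.

End TraceEntries.

(** * The trace as an explicit quotient *)

Lemma all2_leq_sumn (s t : seq nat) : all2 leq s t -> (sumn t <= sumn s)%N -> t = s.
Proof.
have mono s1 t1 : all2 leq s1 t1 -> (sumn s1 <= sumn t1)%N.
  by elim: s1 t1 => [|a s1 IH] [|b t1] //= /andP[ab /IH]; exact: leq_add.
elim: s t => [|a s IH] [|b t] //= /andP[ab st] le.
have le' := mono _ _ st; have E : a = b by lia.
by rewrite E (IH t) // -(leq_add2l b) -{2}E.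
Qed.

Lemma lpoly_numer (R : realType) (eta : R[i]) D (y : nat -> R[i]) N t d
    (e : R[i] -> nat -> R[i]) (L : nat -> R[i]) :
  (forall k, lpoly eta d (fun lam => e lam k) (L k)) ->
  lpoly eta d (fun lam => numer D y N (e lam) t) (numer D y N L t).
Proof.
move=> H.
have lsum r (f : nat -> R[i] -> R[i]) (a : nat -> R[i]) :
    (forall k, lpoly eta d (f k) (a k)) ->
    lpoly eta d (fun lam => \sum_(k < r) f k lam) (\sum_(k < r) a k).
  move=> Hf; elim: r => [|r IH].
    rewrite big_ord0; apply: pfac_ext (pfac0 _ _ _) => lam.
    by rewrite big_ord0.
  rewrite big_ord_recr; apply: pfac_ext (pfacD IH (Hf r)) => lam.
  by rewrite big_ord_recr.
rewrite /numer.
apply: (lsum _ (fun j lam => (denom D y)`_j * t ^+ j * psum (e lam) t (N - j)%N)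
  (fun j => (denom D y)`_j * t ^+ j * psum L t (N - j)%N)) => j.
apply: pfacZ; rewrite /psum.
apply: (lsum _ (fun k lam => t ^+ k * e lam k) (fun k => t ^+ k * L k)) => k.
exact: (pfacZ _ (H k)).
Qed.

Section ExplicitTrace.
Variables (R : realType) (eta : R[i]).
Hypothesis heta : 0 < complex.Im eta.
Local Notation C := R[i].
Local Notation q := (qpow eta).
Variable Phi :
  C -> C -> nat -> {linear {freeg nat / C} -> {freeg (nat * nat) / C}}.
Hypothesis hPhi :
  forall lam Lam m, is_vertex_operator eta lam Lam m (Phi lam Lam m).
Variables (n M : nat).
Implicit Types (Lam : 'rV[C]_n) (m : n.-tuple nat) (lam x : C).
Local Notation roots := (rootq eta M).
Local Notation nr := (nroots M).
Local Notation entry := (trace_entry Phi).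

Definition tpar x : C := q (- (x *+ 2)).
Definition den x : C := (denom nr roots).[tpar x].
(** Beyond [2 M + nroots M] the numerator is stable; the additional [M] leaves
    room for the shift by [d <= M] in the cyclic relations. *)
Definition series_order : nat := (2 * M + nr + M)%N.
(** The normalising factor in the definition of the universal trace
    matrix. *)
Definition trace_cst : C := q (- ((M * M.+1)%:R / 2)) * (q 1 - q (- 1)) ^+ M.
Definition num lam x Lam m m' : C := trace_cst * (q x - q (- x)) *
  q (x * (lam - 1)) * numer nr roots series_order (entry lam Lam m m') (tpar x).

Lemma roots_neq0 c : roots c != 0. Proof. exact: rootq_neq0. Qed.

Lemma denom1 : (denom nr roots).[1] = 0.
Proof.
have r1 : roots (6 * M) = 1 by rewrite /rootq subrr qpow0.
by have := denom_root (D := nr) roots_neq0 (c := 6 * M);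
  rewrite r1 invr1; apply; rewrite /nroots; lia.
Qed.

Lemma tpar_neq1 x : den x != 0 -> 1 - tpar x != 0.
Proof.
rewrite /den denomE; apply: contraNneq => t1.
have c6 : (6 * M < nr)%N by rewrite /nroots; lia.
rewrite (bigD1 (Ordinal c6)) //= /rootq subrr qpow0 mul1r t1 mul0r.
by rewrite eqxx.
Qed.

Lemma lpoly_entry Lam m m' k : weights M Lam -> compositions M m ->
  compositions M m' ->
  lpoly eta M (fun lam => entry lam Lam m m' k)
    ((m == m')%:R * lowcoef eta (wlist Lam m)).
Proof.
move=> hL hm hm'.
have [L [H z e]] := lpoly_product_coef heta hPhi (wlist Lam m) m' k.
rewrite wlist_snd in H z e; rewrite (eqP hm) in H.
suff -> : (m == m')%:R * lowcoef eta (wlist Lam m) = L by [].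
have [mm|N] := eqVneq m m'.
  rewrite mul1r e -?mm // -/(drift (wlist Lam m)) (drift_wlist hL hm).
  by rewrite mulr0 oppr0 qpow0 mul1r.
rewrite mul0r z //; apply: contraNN N => /all2_leq_sumn E.
by rewrite eq_sym -val_eqE /= E // (eqP hm) (eqP hm').
Qed.

Lemma XiE Lam m : Xi eta Lam m = q (xiexp 0 (wlist Lam m)).
Proof.
rewrite /Xi xiexp_enum; congr q; apply: eq_bigr => j _; by rewrite add0r.
Qed.

(** The normalisation of [Psi], which explains the exponent of [Xi]. *)
Lemma lowcoef_Xi Lam m : weights M Lam -> compositions M m ->
  trace_cst * lowcoef eta (wlist Lam m) * Xi eta Lam m = 1.
Proof.
move=> hL hm; rewrite XiE /trace_cst.
have hE : height (wlist Lam m) = M by rewrite height_wlist (eqP hm).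
have := lowcoefE heta (wlist Lam m); rewrite hE => E.
rewrite -(mulrA (q _)) [_ ^+ M * _]mulrC E -mulrA -qpowD lowexp_xiexp hE.
by rewrite (drift_wlist hL hm) addr0 mulr0 add0r mulrC qpowK.
Qed.

(** The numerator is linear in the diagonal coefficients.  For the lowest
    coefficients, which form a constant sequence, the quotient is a geometric
    series, whose sum cancels the factor [q^x - q^(-x)]. *)
Lemma explicit_solution x Lam m' : den x != 0 -> weights M Lam ->
  compositions M m' ->
  is_resonance_solution eta M x Lam m'
    (fun lam m => num lam x Lam m m' / den x * Xi eta Lam m').
Proof.
move=> dx hL hm'; split.
  have HP m : exists P : {poly C}, compositions M m ->
     [/\ (size P <= M.+1)%N, P`_0 = (m == m')%:R *
        (lowcoef eta (wlist Lam m) * (den x / (1 - tpar x))) &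
      forall lam, numer nr roots series_order (entry lam Lam m m') (tpar x) =
         q (- (M%:R * lam)) * P.[q (lam *+ 2)]].
    have [hm|nm] := boolP (compositions M m); last by exists 0.
    have [P [sP P0 PE]] := lpoly_numer nr roots series_order (tpar x)
      (fun k => lpoly_entry k hL hm hm').
    exists P => _; split=> //; rewrite P0.
    have -> : (fun=> (m == m')%:R * lowcoef eta (wlist Lam m)) =
       (fun k : nat => ((m == m')%:R * lowcoef eta (wlist Lam m)) * 1).
      by apply/funext => k; rewrite mulr1.
    rewrite numerZ -mulrA; congr (_ * (_ * _)).
    apply: (canRL (mulfK (tpar_neq1 dx))).
    by rewrite numer_geometric ?denom1 // /series_order; lia.
  have [P {}HP] := choice HP.
  pose A := trace_cst * (q x - q (- x)) * q (- x) / den x * Xi eta Lam m'.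
  exists (fun k m => A * (P m)`_k); split.
    move=> m hm; have [_ -> _] := HP m hm.
    have [mm|] := eqVneq m m'; last by rewrite mul0r mulr0.
    have E := lowcoef_Xi hL hm; rewrite {}mm in E *.
    have T : (q x - q (- x)) * q (- x) = 1 - tpar x.
      by rewrite mulrBl qpowK -qpowD /tpar; congr (1 - q _); ring.
    have t1 := tpar_neq1 dx.
    have -> : A = trace_cst * (1 - tpar x) / den x * Xi eta Lam m'.
      by rewrite /A -T; ring.
    rewrite mul1r -[RHS]E; move: t1 dx; set u := 1 - tpar x; set v := den x.
    set c1 := trace_cst; set c2 := lowcoef _ _; set c3 := Xi _ _ _ => u0 v0.
    by field; rewrite u0 v0.
  move=> lam m hm; have [sP _ PE] := HP m hm.
  rewrite /num PE (horner_coef_wide _ sP).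
  have -> : q (lam * (x - M%:R)) = q (x * (lam - 1)) * q (- (M%:R * lam)) / q (- x).
    by rewrite -qpowN -!qpowD; congr q; ring.
  have -> : \sum_(k < M.+1) q (k.*2%:R * lam) * (A * (P m)`_k) =
     A * \sum_(k < M.+1) (P m)`_k * q (lam *+ 2) ^+ k.
    rewrite mulr_sumr; apply: eq_bigr => k _.
    rewrite -qpowMn mulrCA [X in _ = A * X]mulrC; congr (_ * (q _ * _)).
    by rewrite -mul2n natrM -mulr_natr -[lam *+ 2]mulr_natr; ring.
  rewrite /A; set Sg := \sum_(_ < _) _.
  have := qpow_neq0 eta (- x).
  set c1 := trace_cst; set c2 := Xi _ _ _; set c3 := q (- x); set c4 := q (x * _).
  set c5 := q (- (_ * _)); set c6 := q x; move: dx; set c7 := den x => d0 c30.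
  by field; rewrite ?c30 ?d0.
move=> m hm j d /andP[d0 dm].
have dM : (d <= M)%N.
  apply: leq_trans dm _; rewrite -(eqP hm) sumn_tnth (bigD1 j) //=.
  exact: leq_addr.
case: ifP => [jn|/negbT jn]; congr (_ / _ * _); rewrite /num.
  congr (_ * _); apply: eq_numer => k.
  exact: (trace_entry_resonance heta hPhi).
rewrite -leqNgt in jn.
have S := numer_shift nr roots (tpar x) series_order
  (trace_entry_cyclic heta hPhi hL hm hm' dm jn)
  (trace_entry_cyclic0 heta hPhi hL hm hm' dm jn).
rewrite S; have st := trace_entry_expsum heta hPhi (- d%:R) hL hm hm'.
rewrite !(numer_stable roots_neq0 _ st); last 2 first.
- by rewrite /series_order; lia.
- by rewrite /series_order; lia.
rewrite -[LHS]mulrA -[RHS]mulrA; congr (_ * _).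
rewrite [RHS]mulrA; congr (_ * _); rewrite /tpar -qpowMn -qpowD; congr q.
by rewrite -(mulr_natr (- (x *+ 2)) d) -(mulr_natr x 2); ring.
Qed.

Section JointDifferentiability.
Variables (V : normedModType C) (v : V) (fx : V -> C^o) (fL : V -> 'rV[C]_n).
Hypotheses (dx : differentiable fx v)
  (dL : forall i, differentiable (fun v => fL v 0 i : C^o) v).

Lemma differentiable_bigsum (I : Type) (r : seq I) (P : pred I)
    (f : I -> V -> C^o) :
  (forall i, differentiable (f i) v) ->
  differentiable (fun v => \sum_(i <- r | P i) f i v : C^o) v.
Proof.
move=> df; elim: r => [|i r IH].
  rewrite (_ : (fun _ => _) = cst 0); first exact: differentiable_const.
  by apply/funext => u; rewrite big_nil.
rewrite (_ : (fun _ => _) = (fun v => (if P i then f i v else 0) +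
    \sum_(i <- r | P i) f i v)).
  apply: differentiableD; last exact: IH.
  by case: (P i); [exact: df|exact: differentiable_const].
by apply/funext => u; rewrite big_cons; case: ifP; rewrite ?add0r.
Qed.

Lemma differentiable_tpar : differentiable (fun v => tpar (fx v) : C^o) v.
Proof.
apply: differentiable_qpow; apply: differentiableN.
rewrite (_ : (fun _ => _) = (fun v => fx v + fx v)); first exact: differentiableD.
by apply/funext => u; rewrite mulr2n.
Qed.

Lemma differentiable_den : differentiable (fun v => den (fx v) : C^o) v.
Proof.
rewrite (_ : (fun _ => _) =
   (fun v => \prod_(c < nr) (1 - roots c * tpar (fx v)) : C^o)).
  apply: differentiable_bigprod => c; apply: differentiableB.
    exact: differentiable_const.
  apply: differentiable_mul; first exact: differentiable_const.
  exact: differentiable_tpar.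
by apply/funext => u; rewrite /den denomE.
Qed.

Lemma differentiable_entry lam m m' k :
  differentiable (fun v => entry lam (fL v) m m' k : C^o) v.
Proof.
pose s := [seq ((fun v => fL v 0 i : C^o), tnth m i) | i <- enum 'I_n].
rewrite (_ : (fun _ => _) =
  (fun v => product_coef Phi lam [seq (p.1 v, p.2) | p <- s] m' k)).
  apply: (differentiable_product_coef heta hPhi) => i.
  have [si|si] := ltnP i (size s); last first.
    by rewrite nth_default //; exact: differentiable_const.
  rewrite size_map in si; have sn : (i < n)%N by rewrite size_enum_ord in si.
  by rewrite (nth_map (Ordinal sn)) //; exact: dL.
by apply/funext => u; rewrite /trace_entry /wlist /s -map_comp.
Qed.

Lemma differentiable_num lam m m' :
  differentiable (fun v => num lam (fx v) (fL v) m m' : C^o) v.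
Proof.
apply: differentiable_mul.
  apply: differentiable_mul.
    apply: differentiable_mul; first exact: differentiable_const.
    apply: differentiableB; first exact: differentiable_qpow.
    by apply: differentiable_qpow; exact: differentiableN.
  apply: differentiable_qpow.
  by apply: differentiable_mul; [exact: dx|exact: differentiable_const].
have dt k : differentiable (fun v => tpar (fx v) ^+ k : C^o) v.
  by apply: differentiable_exp; exact: differentiable_tpar.
apply: differentiable_bigsum => j; apply: differentiable_mul.
  by apply: differentiable_mul => //; exact: differentiable_const.
apply: differentiable_bigsum => k; apply: differentiable_mul => //.
exact: differentiable_entry.
Qed.

Lemma differentiable_Xi m :
  differentiable (fun v => Xi eta (fL v) m : C^o) v.
Proof.
apply: differentiable_qpow; apply: differentiable_bigsum => j.
apply: differentiable_mul; first exact: differentiable_const.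
apply: differentiable_bigsum => i.
by apply: differentiableB; [exact: dL|exact: differentiable_const].
Qed.

End JointDifferentiability.

Lemma entire_den : entire (fun x : C^o => den x : C^o).
Proof. by move=> x; apply: (differentiable_den (fx := fun x : C^o => x)). Qed.

Lemma entire_num lam Lam m m' :
  entire (fun x : C^o => num lam x Lam m m' : C^o).
Proof.
move=> x; apply: (differentiable_num (fx := fun x : C^o => x) (fL := fun=> Lam)).
  by [].
by move=> i; exact: differentiable_const.
Qed.

(** At [x = 1/4] the exponents [c - 2 x], [c] an integer, are nonzero reals. *)
Lemma den_quarter : den (1 / 4)%:C != 0.
Proof.
rewrite /den denomE prodf_seq_neq0; apply/allP => c _ /=.
rewrite subr_eq0 /rootq /tpar -qpowD eq_sym.
have -> : c%:R - (6 * M)%:R + - ((1 / 4)%:C *+ 2) =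
    (c%:R - (6 * M)%:R - 1 / 2 : R)%:C.
  rewrite !rmorphB /= !rmorph_nat; congr (_ - _).
  by rewrite -rmorphMn /=; congr (_%:C); rewrite -mulr_natr; field.
apply/eqP => /(qpow_real_eq1 heta) E.
have : (2 * c)%:R = (12 * M + 1)%:R :> R.
  have -> : (12 * M + 1)%:R = 2 * (6 * M)%:R + 1 :> R by rewrite natrD !natrM; ring.
  by rewrite natrM; lra.
by move/eqP; rewrite eqr_nat => /eqP; lia.
Qed.

Variable F : C -> C -> 'rV[C]_n -> n.-tuple nat -> n.-tuple nat -> C.
Hypothesis hF : is_universal_trace_matrix eta M Phi F.

(** Both sides agree where the trace converges, a set with interior
    points: [x] real and very negative. *)
Lemma trace_quotient lam x Lam m m' : den x != 0 -> weights M Lam ->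
  compositions M m -> compositions M m' ->
  F lam x Lam m m' = num lam x Lam m m' / den x.
Proof.
move=> dx hL hm hm'; have [mer [rho H]] := hF lam hL hm hm'.
have hI : 0 < 2 * (pi * complex.Im eta) by rewrite mulr_gt0 ?mulr_gt0 ?pi_gt0.
pose a : R := - ((`|rho| + 1) / (2 * (pi * complex.Im eta))).
have big : rho < cabs (q (a%:C *+ 2)).
  rewrite -rmorphMn /= cabs_qpow_real.
  have -> : - (pi * complex.Im eta * (a *+ 2)) = `|rho| + 1.
    have -> : - (pi * complex.Im eta * (a *+ 2)) =
        - a * (2 * (pi * complex.Im eta)).
      by rewrite -mulr_natr; ring.
    by rewrite /a opprK divfK // gt_eqF.
  apply: lt_le_trans (expR_ge1Dx _); have := ler_norm rho; lra.
have cq : {for (a%:C : C^o), continuous (fun x : C^o => q (x *+ 2) : C^o)}.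
  apply: differentiable_continuous; apply: differentiable_qpow.
  rewrite (_ : (fun _ => _) = (fun x : C^o => x + x)); first exact: differentiableD.
  by apply/funext => u; rewrite mulr2n.
apply: (@meromorphic_quotient _ (fun x : C^o => F lam x Lam m m' : C^o)
   (fun x : C^o => den x : C^o) (fun x : C^o => num lam x Lam m m' : C^o)
   (a%:C : C^o) mer entire_den (@entire_num lam Lam m m') _ x dx).
have near_big : \forall z \near (a%:C : C^o), rho < cabs (q (z *+ 2)).
  have cc := continuous_comp cq (@cabs_continuous R _).
  exact: (cvgr_gt _ cc _ big).
apply: filterS near_big => x1; rewrite -ltcR -cabsE => /H [T cT FT].
have cT' : (psum (entry lam Lam m m') (tpar x1) : nat -> C^o) @ \oo -->
    ((q (x1 * (lam - 1)))^-1 * T : C^o).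
  have -> : psum (entry lam Lam m m') (tpar x1) = (fun N =>
      (q (x1 * (lam - 1)))^-1 * trace_psum eta Phi lam x1 Lam m m' N).
    apply/funext => N; rewrite (trace_psumE heta hPhi _ _ _ _ hm hm') mulKf //.
    exact: qpow_neq0.
  by apply: cvgM; [exact: cvg_cst|exact: cT].
have st := trace_entry_expsum heta hPhi lam hL hm hm'.
have L := psum_limit roots_neq0 st cT'.
have oN : (2 * M + nr <= series_order)%N by rewrite /series_order leq_addr.
rewrite -FT /num (numer_stable roots_neq0 _ st oN) -L -/(den x1).
have := qpow_neq0 eta (x1 * (lam - 1)); set c := q (x1 * _) => c0.
rewrite /trace_cst.
set c1 := q (- (_ / _)); set c2 := _ ^+ M; set c3 := den x1; set c4 := q x1 - _.
have -> : c1 * c2 * c4 * c * (c3 * (c^-1 * T)) =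
    (c * c^-1) * (c1 * c2 * c4 * T * c3).
  by ring.
by rewrite mulfV // mul1r.
Qed.

End ExplicitTrace.

(** * Identification with the fundamental resonance matrix *)

Lemma differentiable_fst (K : numFieldType) (U V : normedModType K) (p : U * V) :
  differentiable (fst : U * V -> U) p.
Proof.
apply: (linear_differentiable (f := (fst : {linear (U * V)%type -> U}))).
by move=> z; exact: cvg_fst.
Qed.

Lemma differentiable_snd (K : numFieldType) (U V : normedModType K) (p : U * V) :
  differentiable (snd : U * V -> V) p.
Proof.
apply: (linear_differentiable (f := (snd : {linear (U * V)%type -> V}))).
by move=> z; exact: cvg_snd.
Qed.

Unset Implicit Arguments.

Theorem theorem3p5 (R : realType) (eta : R[i]) (heta : 0 < complex.Im eta)
    (n M : nat) (hn : (1 <= n)%N)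
    (Phi : R[i] -> R[i] -> nat ->
      {linear {freeg nat / R[i]} -> {freeg (nat * nat) / R[i]}})
    (hPhi : forall lam Lam m, is_vertex_operator eta lam Lam m (Phi lam Lam m))
    (F : R[i] -> R[i] -> 'rV[R[i]]_n -> n.-tuple nat -> n.-tuple nat -> R[i])
    (hF : is_universal_trace_matrix eta M Phi F)
    (Psi : R[i] -> R[i] -> 'rV[R[i]]_n -> n.-tuple nat -> n.-tuple nat -> R[i])
    (hPsi : is_fundamental_resonance_matrix eta M Psi) :
  generic [set: R[i]^o] (fun x : R[i]^o =>
    forall Lam : 'rV[R[i]]_n, weights M Lam ->
    forall (lam : R[i]) (m m' : n.-tuple nat),
      compositions M m -> compositions M m' ->
      Psi lam x Lam m m' = F lam x Lam m m' * Xi eta Lam m').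
Proof.
case: n hn Phi hPhi F hF Psi hPsi => // n _ Phi hPhi F hF Psi [[h [hh unique]] mer].
exists (fun=> fun x : R[i]^o => den eta M x); split.
  move=> _; split; first exact: entire_den.
  by exists (1 / 4)%:C => //; exact: den_quarter.
move=> x _ /(_ 0%N) dx Lam hL lam m m' hm hm'.
rewrite (trace_quotient heta hPhi hF) //.
pose V : normedModType R[i] := (R[i]^o * 'rV[R[i]]_n.+1)%type.
pose G (p : V) : R[i]^o :=
  num eta Phi M lam p.1 p.2 m m' / den eta M p.1 * Xi eta p.2 m'.
have dfst p : differentiable (fun p : R[i]^o * 'rV[R[i]]_n.+1 => p.1) p.
  exact: differentiable_fst.
have dsnd i p : differentiable
    (fun p : R[i]^o * 'rV[R[i]]_n.+1 => p.2 0 i : R[i]^o) p.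
  apply: (@differentiable_comp _ _ _ _ snd
    (fun L : 'rV[R[i]]_n.+1 => L 0 i : R[i]^o)).
    exact: differentiable_snd.
  exact: differentiable_coord.
have near_den (p : V) : den eta M p.1 != 0 -> \forall z \near p, den eta M z.1 != 0.
  move=> dp; apply: (near_neq0 (h := fun z : V => den eta M z.1 : R[i]^o) _ dp).
  apply: differentiable_continuous.
  exact: (differentiable_den eta M (dfst p)).
rewrite -[RHS]/(G (x, Lam)) -[LHS]/((fun p => Psi lam p.1 p.2 m m') (x, Lam)).
apply: (meromorphic_eq (S := [set p | weights M p.2])) => //.
- exact: mer.
- have := near_den (x, Lam) dx; apply: filterS => p dp.
  have dp2 i := dsnd i p.
  apply: differentiable_mul; last exact: (differentiable_Xi eta dp2).
  apply: differentiable_mul.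
    exact: (differentiable_num heta hPhi M (dfst p) dp2).
  by apply: differentiableV => //; exact: (differentiable_den eta M (dfst p)).
have := near_den (x, Lam) dx; apply: filterS => p dp Sp U pU.
have [z [Sz [Uz dz] hz]] := generic_dense hh Sp (filterI pU (near_den p dp)).
exists z; split => //.
have [_ uz] := unique z Sz hz m' hm'.
by rewrite /G (uz _ (explicit_solution heta hPhi dz Sz hm')).
Qed.
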